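(* Assume the APSP Conjecture. Then for every $\varepsilon>0$ there is no algorithm that solves the dynamic APSP problem in planar graphs on $N$ nodes with amortized update time and amortized query time both $O(N^{\frac12-\varepsilon})$. This holds even if the only updates allowed are weight updates (changing the weight of an existing edge).
   Context: APSP Conjecture: there is no algorithm that solves the all-pairs shortest paths problem in general weighted static graphs on $n$ nodes in time $O(n^{3-\varepsilon})$ for any $\varepsilon>0$. (Weights are integers bounded by a polynomial in the number of nodes, and running times are in the standard word-RAM model with logarithmic word size, both for the conjecture and for the dynamic problem.) Dynamic APSP problem in planar graphs: maintain an edge-weighted planar graph $G$ on $N$ nodes under updates, each of which inserts an edge, deletes an edge, or changes the weight of an edge, subject to $G$ being planar at all times, while answering queries: given nodes $u,v$, return the shortest-path distance $d_G(u,v)$ in the current graph. In the weight-update model an initial graph is given and the only updates allowed are changes of weights of existing edges. Amortized update time $u(N)$ and query time $q(N)$: the total time for processing any sequence of $U$ updates and $Q$ queries is $O(U\cdot u(N)+Q\cdot q(N))$, where setting up the initial graph is counted as a number of updates linear in its size. *)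

(* Defs.v *)
From Stdlib Require Import ZArith.
From mathcomp Require Import all_boot all_order all_algebra.
From mathcomp Require Import all_classical all_reals all_analysis.
Import Order.TTheory GRing.Theory Num.Theory numFieldNormedType.Exports.
Set Implicit Arguments.
Unset Strict Implicit.
Unset Printing Implicit Defensive.

(* Machine words and edge weights are in Stdlib's Z, which has the bitwise
   operations. *)

(* MathComp uses the key Z for its own integers. *)
Delimit Scope Z_scope with ZZ.

Local Open Scope classical_set_scope.
Local Open Scope ring_scope.

Inductive binop := Add | Sub | Mul | Div | Mod | And | Or | Xor | Shl | Shr.

Definition eval_binop (o : binop) : Z -> Z -> Z :=
  match o with
  | Add => Z.add | Sub => Z.sub | Mul => Z.mul | Div => Z.div | Mod => Z.modulo
  | And => Z.land | Or => Z.lor | Xor => Z.lxor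
  | Shl => Z.shiftl | Shr => Z.shiftr
  end.

(* [r], [a], [b], [addr] are indices of registers; [addr] holds the address of the
   memory cell to be accessed. *)
Inductive instr :=
| Const (r : nat) (z : Z)
| Op (o : binop) (r a b : nat)
| Read (r addr : nat)
| Write (addr r : nat)
| JumpEq (a b target : nat)
| JumpLt (a b target : nat).

Definition program := seq instr.

Record state := State { reg : nat -> Z; cell : nat -> Z }.

Definition set_reg (s : state) (r : nat) (v : Z) : state :=
  State (fun i => if i == r then v else reg s i) (cell s).

Definition set_cell (s : state) (a : nat) (v : Z) : state :=
  State (reg s) (fun i => if i == a then v else cell s i).

Definition fits (w : nat) (v : Z) : bool :=
  ((- 2 ^ (Z.of_nat w - 1) <=? v) && (v <? 2 ^ (Z.of_nat w - 1)))%ZZ.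

(* One instruction on a machine with [w]-bit signed words.  [None] means that
   the program counter is outside the program, or that the machine traps: a
   value that does not fit in a word is produced, or an address is negative.
   Since overflow traps, a computation that succeeds with [w]-bit words is the
   same for every larger word size; arithmetic modulo 2^w is available
   through [Mod]. *)
Definition step (w : nat) (p : program) (pc : nat) (s : state) :
    option (nat * state) :=
  let write r v := if fits w v then Some (pc.+1, set_reg s r v) else None in
  match onth p pc with
  | None => None
  | Some (Const r z) => write r z
  | Some (Op o r a b) => write r (eval_binop o (reg s a) (reg s b))
  | Some (Read r a) =>
      if (0 <=? reg s a)%ZZ then write r (cell s (Z.to_nat (reg s a))) else None
  | Some (Write a r) =>
      if (0 <=? reg s a)%ZZ
      then Some (pc.+1, set_cell s (Z.to_nat (reg s a)) (reg s r)) else None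
  | Some (JumpEq a b l) =>
      Some (if (reg s a =? reg s b)%ZZ then l else pc.+1, s)
  | Some (JumpLt a b l) =>
      Some (if (reg s a <? reg s b)%ZZ then l else pc.+1, s)
  end.

(* [run w p pc s t s']: started at [pc] in state [s], the program halts (control
   leaves the program) after exactly [t] instructions, in state [s']. *)
Inductive run (w : nat) (p : program) : nat -> state -> nat -> state -> Prop :=
| run_halt pc s of (size p <= pc)%N : run w p pc s 0 s
| run_step pc s pc1 s1 t s' of
    step w p pc s = Some (pc1, s1) & run w p pc1 s1 t s' :
    run w p pc s t.+1 s'.

Definition exec (w : nat) (p : program) (s : state) (t : nat) (s' : state) :=
  run w p 0 s t s'.

Definition word_size (k n : nat) : nat := (k * (trunc_log 2 n).+1)%N.

Definition input_state (regs cells : seq Z) : state :=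
  State (nth 0%ZZ regs) (nth 0%ZZ cells).

Definition set_args (s : state) (args : seq Z) : state :=
  State (fun r => nth (reg s r) args r) (cell s).

(* A possibly infinite weight or distance takes two words, a flag (0 for
   infinity) and a value. *)
Definition encode_weight (o : option Z) : seq Z :=
  if o is Some z then [:: 1%ZZ; z] else [:: 0%ZZ; 0%ZZ].

Definition decode_dist (flag v : Z) : option Z :=
  if (flag =? 0)%ZZ then None else Some v.

Definition zord (n : nat) (i : 'I_n) : Z := Z.of_nat i.

(* [g x y = Some w] iff there is an edge from [x] to [y], and it has weight [w].
   Undirected graphs are the symmetric ones. *)
Definition wgraph (n : nat) := 'I_n -> 'I_n -> option Z.

Definition edge (n : nat) (g : wgraph n) : rel 'I_n := fun x y => isSome (g x y).

(* The walk [x :: p] is given as in [path]. *)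
Definition walk (n : nat) (g : wgraph n) (x : 'I_n) (p : seq 'I_n) : bool :=
  path (edge g) x p.

Fixpoint wlen (n : nat) (g : wgraph n) (x : 'I_n) (p : seq 'I_n) : Z :=
  if p is y :: p' then (odflt 0 (g x y) + wlen g y p')%ZZ else 0%ZZ.

Definition is_dist (n : nat) (g : wgraph n) (x y : 'I_n) (d : option Z) : Prop :=
  match d with
  | Some d =>
      (exists p, [/\ walk g x p, last x p = y & wlen g x p = d]) /\
      (forall p, walk g x p -> last x p = y -> (d <= wlen g x p)%ZZ)
  | None => forall p, walk g x p -> last x p <> y
  end.

Definition no_negative_cycle (n : nat) (g : wgraph n) : Prop :=
  forall x p, walk g x p -> last x p = x -> (0 <= wlen g x p)%ZZ.

(* Register 0 holds [n]; the weight of (i, j) is in cells 2(in + j) and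
   2(in + j) + 1.  The distance matrix is returned in the same place. *)
Definition apsp_input (n : nat) (g : wgraph n) : state :=
  input_state [:: Z.of_nat n]
    (flatten [seq encode_weight (g i j) | i <- enum 'I_n, j <- enum 'I_n]).

Definition apsp_output (n : nat) (s : state) (i j : 'I_n) : option Z :=
  decode_dist (cell s (2 * (i * n + j))) (cell s (2 * (i * n + j)).+1).

Definition apsp_algorithm (R : realType) (c : nat) (p : program)
    (T : nat -> R) : Prop :=
  exists k : nat, forall (n : nat) (g : wgraph n),
    (0 < n)%N ->
    (forall x y w, g x y = Some w -> (Z.abs w <= Z.of_nat (n ^ c))%ZZ) ->
    no_negative_cycle g ->
    exists t s', [/\ exec (word_size k n) p (apsp_input g) t s',
      t%:R <= T n & forall i j, is_dist g i j (apsp_output s' i j)].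

Definition APSP_conjecture (R : realType) : Prop :=
  forall eps : R, 0 < eps ->
  ~ (forall c : nat, exists (p : program) (T : nat -> R),
       apsp_algorithm c p T /\
       (T : nat -> R^o) =O_\oo (fun n => (n%:R `^ (3 - eps) : R^o))).

(* A drawing in the plane R * R.  An edge {x, y} of an undirected graph may be
   given two unrelated arcs, for (x, y) and for (y, x); either one can be
   discarded. *)
Definition planar (R : realType) (n : nat) (e : rel 'I_n) : Prop :=
  exists (pt : 'I_n -> R * R) (arc : 'I_n -> 'I_n -> R -> R * R),
  [/\ injective pt,
      forall x y, e x y ->
        [/\ {within `[0, 1], continuous (arc x y)},
            {in `[0, 1] &, injective (arc x y)},
            arc x y 0 = pt x & arc x y 1 = pt y],
      forall x y z (t : R), e x y -> t \in `]0, 1[ -> arc x y t <> pt z &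
      forall x y x' y' (t t' : R), e x y -> e x' y' ->
        [set x; y]%SET != [set x'; y']%SET ->
        t \in `]0, 1[ -> t' \in `]0, 1[ -> arc x y t <> arc x' y' t'].

Definition valid_graph (R : realType) (c n : nat) (g : wgraph n) : Prop :=
  [/\ forall x y, g x y = g y x,
      forall x, g x x = None,
      forall x y w, g x y = Some w -> (0 <= w <= Z.of_nat (n ^ c))%ZZ &
      planar R (edge g)].

Inductive update (n : nat) :=
| Insert of 'I_n & 'I_n & Z
| Delete of 'I_n & 'I_n
| Change of 'I_n & 'I_n & Z.

Inductive operation (n : nat) :=
| Update of update n
| Query of 'I_n & 'I_n.

Definition set_edge (n : nat) (g : wgraph n) (u v : 'I_n) (o : option Z) :
    wgraph n :=
  fun x y => if [set x; y]%SET == [set u; v]%SET then o else g x y.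

Definition apply_update (n : nat) (g : wgraph n) (a : update n) : wgraph n :=
  match a with
  | Insert u v w => set_edge g u v (Some w)
  | Delete u v => set_edge g u v None
  | Change u v w => set_edge g u v (Some w)
  end.

Definition applicable (n : nat) (g : wgraph n) (a : update n) : bool :=
  match a with
  | Insert u v _ => ~~ edge g u v
  | Delete u v => edge g u v
  | Change u v _ => edge g u v
  end.

Inductive model := Fully_dynamic | Weight_updates_only.

Definition allowed (M : model) (n : nat) (a : update n) : bool :=
  match M, a with
  | Fully_dynamic, _ => true
  | Weight_updates_only, Change _ _ _ => true
  | Weight_updates_only, _ => false
  end.

Fixpoint legal (R : realType) (M : model) (c n : nat) (g : wgraph n)
    (ops : seq (operation n)) : Prop :=
  match ops with
  | [::] => True
  | Update a :: ops' =>
      [/\ allowed M a, applicable g a, valid_graph R c (apply_update g a) &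
          legal R M c (apply_update g a) ops']
  | Query _ _ :: ops' => legal R M c g ops'
  end.

Definition n_updates (n : nat) (ops : seq (operation n)) : nat :=
  count (fun o => if o is Update _ then true else false) ops.

Definition n_queries (n : nat) (ops : seq (operation n)) : nat :=
  count (fun o => if o is Query _ _ then true else false) ops.

(* The routines share registers and memory, which persist between calls. *)
Record dyn_program := DynProgram {
  init_code : program;
  insert_code : program;
  delete_code : program;
  change_code : program;
  query_code : program }.

Definition update_code (D : dyn_program) (n : nat) (a : update n) : program :=
  match a with
  | Insert _ _ _ => insert_code D
  | Delete _ _ => delete_code D
  | Change _ _ _ => change_code D
  end.

Definition update_args (n : nat) (a : update n) : seq Z :=
  match a with
  | Insert u v w => [:: zord u; zord v; w]
  | Delete u v => [:: zord u; zord v]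
  | Change u v w => [:: zord u; zord v; w]
  end.

(* Every edge occurs exactly once, in one of its two orientations. *)
Definition edge_listing (n : nat) (g : wgraph n) (es : seq ('I_n * 'I_n)) : Prop :=
  let ends := [seq [set e.1; e.2]%SET | e <- es] in
  uniq ends /\ forall x y, edge g x y = ([set x; y]%SET \in ends).

Definition graph_input (n : nat) (g : wgraph n) (es : seq ('I_n * 'I_n)) : state :=
  input_state [:: Z.of_nat n; Z.of_nat (size es)]
    (flatten [seq [:: zord e.1; zord e.2; odflt 0%ZZ (g e.1 e.2)] | e <- es]).

(* From state [s], representing the graph [g], the operations are processed one
   after the other in [t] steps altogether, and all queries are answered
   correctly, in registers 0 and 1. *)
Fixpoint serves (w : nat) (D : dyn_program) (n : nat) (g : wgraph n) (s : state)
    (ops : seq (operation n)) (t : nat) : Prop :=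
  match ops with
  | [::] => t = 0%N
  | Update a :: ops' =>
      exists t1 s1 t2,
        [/\ exec w (update_code D a) (set_args s (update_args a)) t1 s1,
            serves w D (apply_update g a) s1 ops' t2 & t = (t1 + t2)%N]
  | Query u v :: ops' =>
      exists t1 s1 t2,
        [/\ exec w (query_code D) (set_args s [:: zord u; zord v]) t1 s1,
            is_dist g u v (decode_dist (reg s1 0) (reg s1 1)),
            serves w D g s1 ops' t2 & t = (t1 + t2)%N]
  end.

(* [D] has amortized update time [u] and query time [q] on weights up to N^c.
   Setting up the initial graph counts as (nodes + edges) updates. *)
Definition dyn_algorithm (R : realType) (M : model) (c : nat) (D : dyn_program)
    (u q : nat -> R) : Prop :=
  exists (k : nat) (K : R),
  forall (N : nat) (g : wgraph N) (es : seq ('I_N * 'I_N))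
      (ops : seq (operation N)),
    (0 < N)%N -> valid_graph R c g -> edge_listing g es ->
    legal R M c g ops ->
    exists t0 s0 t,
      [/\ exec (word_size k N) (init_code D) (graph_input g es) t0 s0,
          serves (word_size k N) D g s0 ops t &
          (t0 + t)%:R <=
            K * ((N + size es + n_updates ops)%:R * u N
                 + (n_queries ops)%:R * q N)].

Definition dynamic_planar_APSP_solvable (R : realType) (M : model) (a : R) : Prop :=
  forall c : nat, exists (D : dyn_program) (u q : nat -> R),
    [/\ dyn_algorithm M c D u q,
        (u : nat -> R^o) =O_\oo (fun N => (N%:R `^ a : R^o)) &
        (q : nat -> R^o) =O_\oo (fun N => (N%:R `^ a : R^o))].

(* Main.v *)
Require Import Defs.
From Stdlib Require Import ZArith Lia.
From mathcomp Require Import all_boot all_order all_algebra.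
From mathcomp Require Import all_classical all_reals all_analysis.
From mathcomp Require Import zify ring lra.
Import Order.TTheory GRing.Theory Num.Theory numFieldNormedType.Exports.
Set Implicit Arguments.
Unset Strict Implicit.
Unset Printing Implicit Defensive.

(** Shortest paths reduce to O(log n) min-plus squarings of an n x n matrix X, and one
    squaring takes O(n^2) operations on a planar grid with O(n^2) nodes, so an update
    and query time of N^(1/2 - eps) would give n^2 (n^2)^(1/2 - eps) log n time.

    Let S be large.  The grid has a left and a right half of n columns each.  Row k has
    horizontal weights S(n - k) + X[x,k] - X[x+1,k] on the left and
    S(k + 1) + X[k,y+1] - X[k,y] on the right, and all vertical edges are heavy and have
    the same weight.  A shortest path from the top of column i on the left to the bottom
    of column j on the right goes down to some row k, along this row, and down again.
    The sums telescope to S(n-1-i)(n-k) + X[i,k] - X[n-1,k] and Sj(k+1) + X[k,j] - X[k,0],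
    and the middle edge of row k adds X[n-1,k] + X[k,0].  Now (n-1-i)(n-k) + j(k+1) is
    (k+1)(i+j-n+1) up to a term without k, so for each of the 2n - 1 values of i + j it
    suffices to update the n middle edges to make the multiple of S independent of k;
    then the distances for all (i, j) with this sum give the entries of the product.  All
    rounds use the same grid, whose edges never change.

    The random access machine is programmed in a small structured language, whose
    semantics over the abstract grid records the operations that are performed.  This
    determines the whole sequence of operations before the dynamic algorithm is run, as
    is needed because its running time is only amortized. *)

(** * Multi-step execution and expressions *)

(** The dynamic algorithm expects memory that is zero beyond its input, and may use any address; so
    it gets all cells from 2n^2 on and the odd registers, while the reduction keeps the old and the
    new matrix interleaved in the 2n^2 cells of its own input. Since overflow traps, every value of
    the reduction needs an explicit polynomial bound.

    The grid is undirected, and a walk in it may climb back or change rows repeatedly. The lower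
    bound on a distance is therefore not proved by analysing walks but certified by a potential that
    changes along each edge by at most the weight. The constants come from this test: between
    adjacent rows the potential changes by the vertical weight minus a multiple of S and four
    entries of X, hence S = 4L, where L bounds the entries; the middle weights contain a constant
    that keeps them at least 2L.

    L is 4nW when edge weights are at most W in absolute value. It also stands for infinity: the
    squarings can lower it by less than 2nW in total, so it stays recognizable. *)

Inductive msteps (w : nat) (P : program) : nat -> state -> nat -> nat -> state -> Prop :=
| msteps_refl pc s : msteps w P pc s 0 pc s
| msteps_step pc s pc1 s1 t pc2 s2 of
    step w P pc s = Some (pc1, s1) & msteps w P pc1 s1 t pc2 s2 :
    msteps w P pc s t.+1 pc2 s2.

Lemma msteps_trans w P pc1 s1 t pc2 s2 t' pc3 s3 :
  msteps w P pc1 s1 t pc2 s2 -> msteps w P pc2 s2 t' pc3 s3 ->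
  msteps w P pc1 s1 (t + t') pc3 s3.
Proof.
elim=> // {}pc1 {}s1 pc s {}t pc' s' st _ IH H.
by rewrite addSn; apply: msteps_step st _; apply: IH.
Qed.

Lemma msteps1 w P pc s pc1 s1 :
  step w P pc s = Some (pc1, s1) -> msteps w P pc s 1 pc1 s1.
Proof. by move=> H; apply: msteps_step H _; constructor. Qed.

(** [run] describes only executions that leave the program, so it does not compose. Code fragments
    are treated with [msteps], and the whole is converted once, here. *)
Lemma msteps_run w P pc s t pc' s' :
  msteps w P pc s t pc' s' -> size P <= pc' -> run w P pc s t s'.
Proof.
elim=> [{}pc {}s le|{}pc {}s pc1 s1 {}t pc2 s2 st _ IH le]; first by constructor.
by apply: run_step st _; apply: IH.
Qed.

Definition code_at (P : program) (off : nat) (l : program) :=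
  forall j i, onth l j = Some i -> onth P (off + j) = Some i.

Lemma code_at_cat P off l1 l2 :
  code_at P off (l1 ++ l2) <->
  code_at P off l1 /\ code_at P (off + size l1) l2.
Proof.
split=> [H|[H1 H2] j i].
  split=> j i Hj; last by rewrite -addnA; apply: H; rewrite onth_cat ltnNge leq_addr /= addKn.
  apply: H; rewrite onth_cat; case: ltnP => // le.
  by move: Hj; rewrite onth_default.
rewrite onth_cat; case: ltnP => [_|le]; first exact: H1.
by move/H2; rewrite -addnA subnKC.
Qed.

Lemma code_at_cons P off i l :
  code_at P off (i :: l) <-> onth P off = Some i /\ code_at P off.+1 l.
Proof.
rewrite -cat1s code_at_cat addn1; split=> [[H1 H2]|[H1 H2]]; split=> //.
  by have := H1 0 i erefl; rewrite addn0.
by case=> [|[|j]] //= i' [<-]; rewrite addn0.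
Qed.

Lemma code_at0 P : code_at P 0 P.
Proof. by []. Qed.

Inductive aop := APlus | AMinus | ATimes.

Definition binop_of (o : aop) : binop :=
  match o with APlus => Add | AMinus => Defs.Sub | ATimes => Mul end.

Inductive expr := Var (v : nat) | Cst (z : Z) | Bin (o : aop) (a b : expr).

Fixpoint eval (f : nat -> Z) (e : expr) : Z :=
  match e with
  | Var v => f v
  | Cst z => z
  | Bin o a b => eval_binop (binop_of o) (eval f a) (eval f b)
  end.

Fixpoint small (B : Z) (f : nat -> Z) (e : expr) : Prop :=
  match e with
  | Var v => (Z.abs (f v) <= B)%ZZ
  | Cst z => (Z.abs z <= B)%ZZ
  | Bin _ a b => small B f a /\ small B f b
  end.

Fixpoint leaves (e : expr) : nat :=
  if e is Bin _ a b then leaves a + leaves b else 1.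

Lemma leaves_gt0 e : 0 < leaves e.
Proof. by elim: e => //= o a Ha b Hb; lia. Qed.

(** For p, q >= 2 the product pq also bounds p + q, so one power of [B] covers sums, differences and
    products alike. Only the number of leaves then matters for the word size. *)
Lemma eval_small B f e : (2 <= B)%ZZ -> small B f e ->
  (Z.abs (eval f e) <= B ^ Z.of_nat (leaves e))%ZZ.
Proof.
move=> B2; elim: e => [v|z|o a IHa b IHb]; try by rewrite Z.pow_1_r.
case=> /IHa Ha /IHb Hb.
have ga : (2 <= B ^ Z.of_nat (leaves a))%ZZ.
  have := leaves_gt0 a; case: (leaves a) => // k _.
  rewrite Nat2Z.inj_succ Z.pow_succ_r; last lia.
  have : (0 < B ^ Z.of_nat k)%ZZ by apply: Z.pow_pos_nonneg; lia.
  nia.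
have gb : (2 <= B ^ Z.of_nat (leaves b))%ZZ.
  have := leaves_gt0 b; case: (leaves b) => // k _.
  rewrite Nat2Z.inj_succ Z.pow_succ_r; last lia.
  have : (0 < B ^ Z.of_nat k)%ZZ by apply: Z.pow_pos_nonneg; lia.
  nia.
rewrite [leaves _]/= [eval _ _]/=.
have -> : Z.of_nat (leaves a + leaves b) = (Z.of_nat (leaves a) + Z.of_nat (leaves b))%ZZ by
  lia.
rewrite Z.pow_add_r; try lia.
move: (eval f a) (eval f b) (B ^ _)%ZZ (B ^ _)%ZZ Ha Hb ga gb => x y p q *.
by case: o => /=; [nia|nia|rewrite Z.abs_mul; nia].
Qed.

(* The registers of the compiled program: variables, temporaries, and the registers of
   the dynamic algorithm.  Temporary 0 holds the address where the memory of the dynamic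
   algorithm starts, temporary 1 is used for addresses and constants. *)
Definition rvar (v : nat) : nat := 4 * v.
Definition rtmp (d : nat) : nat := 4 * d + 2.
Definition rdyn (r : nat) : nat := 2 * r + 1.

(** The machine has no move instruction, so a variable is copied by adding a zero. The temporaries
    form a stack: the result is in temporary [d], and only those from [d] on are touched. *)
Fixpoint cexpr (e : expr) (d : nat) : program :=
  match e with
  | Var v => [:: Const (rtmp d.+1) 0; Op Add (rtmp d) (rvar v) (rtmp d.+1)]
  | Cst z => [:: Const (rtmp d) z]
  | Bin o a b => cexpr a d ++ cexpr b d.+1 ++
      [:: Op (binop_of o) (rtmp d) (rtmp d) (rtmp d.+1)]
  end.


Definition same_above (d : nat) (s s' : state) : Prop :=
  cell s' = cell s /\
  forall r, (forall j, d <= j -> r <> rtmp j) -> reg s' r = reg s r.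

Lemma fits_abs w v : (Z.abs v < 2 ^ (Z.of_nat w - 1))%ZZ -> fits w v.
Proof. rewrite /fits; lia. Qed.

Lemma abs_fits w v : fits w v -> (Z.abs v <= 2 ^ Z.of_nat w)%ZZ.
Proof.
rewrite /fits; case: w => [|w]; first by rewrite /=; lia.
have -> : (Z.of_nat w.+1 - 1 = Z.of_nat w)%ZZ by lia.
rewrite Nat2Z.inj_succ Z.pow_succ_r; lia.
Qed.

Lemma step_const w P pc s r z : onth P pc = Some (Const r z) ->
  (Z.abs z < 2 ^ (Z.of_nat w - 1))%ZZ ->
  step w P pc s = Some (pc.+1, set_reg s r z).
Proof. by rewrite /step => -> /fits_abs ->. Qed.

Lemma step_op w P pc s o r a b : onth P pc = Some (Op o r a b) ->
  (Z.abs (eval_binop o (reg s a) (reg s b)) < 2 ^ (Z.of_nat w - 1))%ZZ ->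
  step w P pc s = Some (pc.+1, set_reg s r (eval_binop o (reg s a) (reg s b))).
Proof. by rewrite /step => -> /fits_abs ->. Qed.

Lemma step_read w P pc s r a : onth P pc = Some (Read r a) ->
  (0 <= reg s a)%ZZ ->
  (Z.abs (cell s (Z.to_nat (reg s a))) < 2 ^ (Z.of_nat w - 1))%ZZ ->
  step w P pc s = Some (pc.+1, set_reg s r (cell s (Z.to_nat (reg s a)))).
Proof. by rewrite /step => -> /Z.leb_le -> /fits_abs ->. Qed.

Lemma step_write w P pc s r a : onth P pc = Some (Write a r) ->
  (0 <= reg s a)%ZZ ->
  step w P pc s = Some (pc.+1, set_cell s (Z.to_nat (reg s a)) (reg s r)).
Proof. by rewrite /step => -> /Z.leb_le ->. Qed.

Lemma step_lt w P pc s a b l : onth P pc = Some (JumpLt a b l) ->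
  step w P pc s = Some (if (reg s a <? reg s b)%ZZ then l else pc.+1, s).
Proof. by rewrite /step => ->. Qed.

Lemma step_eq w P pc s a b l : onth P pc = Some (JumpEq a b l) ->
  step w P pc s = Some (if (reg s a =? reg s b)%ZZ then l else pc.+1, s).
Proof. by rewrite /step => ->. Qed.

Lemma reg_set s r v r' : reg (set_reg s r v) r' = if r' == r then v else reg s r'.
Proof. by []. Qed.

Lemma same_above_trans d s1 s2 s3 d' : d <= d' ->
  same_above d s1 s2 -> same_above d' s2 s3 -> same_above d s1 s3.
Proof.
move=> le [c1 r1] [c2 r2]; split=> [|r Hr]; first by rewrite c2.
by rewrite r2 ?r1 // => j Hj; apply: Hr; lia.
Qed.

Lemma same_above_set d s j v : d <= j -> same_above d s (set_reg s (rtmp j) v).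
Proof.
move=> le; split=> // r Hr; rewrite reg_set; case: eqP => // e.
by case: (Hr j le).
Qed.

Lemma same_above_var d s s' v : same_above d s s' -> reg s' (rvar v) = reg s (rvar v).
Proof. by case=> _ H; apply: H => j _; rewrite /rvar /rtmp; lia. Qed.

Lemma same_above_dyn d s s' v : same_above d s s' -> reg s' (rdyn v) = reg s (rdyn v).
Proof. by case=> _ H; apply: H => j _; rewrite /rdyn /rtmp; lia. Qed.

Lemma same_above_tmp d s s' v : v < d -> same_above d s s' -> reg s' (rtmp v) = reg s (rtmp v).
Proof. by move=> lt [_ H]; apply: H => j lj; rewrite /rtmp; lia. Qed.

(** A round bound on the leaves of the expressions in all commands below; it reappears as the factor
    16 in [apsp_words]. *)
Definition max_leaves := 16.

Lemma cexpr_correct w B P f e d off s :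
  (2 <= B)%ZZ -> (B ^ Z.of_nat max_leaves < 2 ^ (Z.of_nat w - 1))%ZZ ->
  leaves e <= max_leaves -> small B f e ->
  (forall v, reg s (rvar v) = f v) -> code_at P off (cexpr e d) ->
  exists s', [/\ msteps w P off s (size (cexpr e d)) (off + size (cexpr e d)) s',
    same_above d s s' & reg s' (rtmp d) = eval f e].
Proof.
move=> B2 Bw.
have fitB e' : leaves e' <= max_leaves -> small B f e' ->
    (Z.abs (eval f e') < 2 ^ (Z.of_nat w - 1))%ZZ.
  move=> le sm; have := eval_small B2 sm.
  have : (B ^ Z.of_nat (leaves e') <= B ^ Z.of_nat max_leaves)%ZZ by apply: Z.pow_le_mono_r;
    lia.
  lia.
elim: e d off s => [v|z|o a IHa b IHb] d off s.
- move=> /= Hl Hs Hv /code_at_cons [c1 /code_at_cons [c2 _]].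
  have F := fitB (Var v) Hl Hs; rewrite /= in F.
  have st1 := step_const (w:=w) s c1 ltac:(lia).
  set s1 := set_reg _ _ _ in st1.
  have e1 : eval_binop Add (reg s1 (rvar v)) (reg s1 (rtmp d.+1)) = f v.
    rewrite /s1 !reg_set eqxx /= ifF ?Hv; first lia.
    by apply/eqP; rewrite /rvar /rtmp; lia.
  have st2 := step_op (s:=s1) (w:=w) c2 ltac:(rewrite e1; exact: F).
  rewrite e1 in st2.
  exists (set_reg s1 (rtmp d) (f v)); split.
  + rewrite addn2; apply: msteps_step st1 _; exact: msteps1.
  + apply: (same_above_trans (leqnn d) (s2:=s1)); last by apply: same_above_set.
    by apply: same_above_set.
  + by rewrite reg_set eqxx.
- move=> Hl Hs Hv /= /code_at_cons [c1 _].
  exists (set_reg s (rtmp d) z); split.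
  + by rewrite addn1; apply: msteps1; apply: step_const => //; apply: (fitB (Cst z)).
  + exact: same_above_set.
  + by rewrite reg_set eqxx.
- move=> Hl Hs Hv; rewrite [cexpr _ _]/=.
  move=> /code_at_cat [ca /code_at_cat [cb /code_at_cons [co _]]].
  case: (Hs) => sa sb; rewrite /= in Hl.
  have [s1 [m1 u1 r1]] := IHa d off s ltac:(lia) sa Hv ca.
  have Hv1 v : reg s1 (rvar v) = f v by rewrite (same_above_var _ u1).
  have [s2 [m2 u2 r2]] := IHb d.+1 _ s1 ltac:(lia) sb Hv1 cb.
  have r1' : reg s2 (rtmp d) = eval f a by rewrite (same_above_tmp _ u2).
  have F := fitB (Bin o a b) Hl Hs; rewrite /= in F.
  have st := step_op (s:=s2) (w:=w) co ltac:(rewrite r1' r2; exact: F).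
  exists (set_reg s2 (rtmp d) (eval f (Bin o a b))); split.
  + rewrite !size_cat /= !addnA; apply: (msteps_trans (msteps_trans m1 m2)).
    by rewrite addn1; apply: msteps1; rewrite st r1' r2.
  + apply: (same_above_trans (leqnn d) (s2:=s2)); last by apply: same_above_set.
    by apply: (same_above_trans (leqnSn d) u1).
  + by rewrite reg_set eqxx.
Qed.

(** * Running a program with relocated registers and memory *)

Definition nop : instr := Const (rtmp 1) 0.

(* Every instruction becomes two, so that jump targets are easily computed. *)
Definition reloc1 (off sz : nat) (i : instr) : program :=
  match i with
  | Const r z => [:: Const (rdyn r) z; nop]
  | Op o r a b => [:: Op o (rdyn r) (rdyn a) (rdyn b); nop]
  | Read r a => [:: Op Add (rtmp 1) (rdyn a) (rtmp 0); Read (rdyn r) (rtmp 1)]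
  | Write a r => [:: Op Add (rtmp 1) (rdyn a) (rtmp 0); Write (rtmp 1) (rdyn r)]
  | JumpEq a b l => [:: JumpEq (rdyn a) (rdyn b) (off + 2 * minn l sz); nop]
  | JumpLt a b l => [:: JumpLt (rdyn a) (rdyn b) (off + 2 * minn l sz); nop]
  end.

Definition reloc (off : nat) (p : program) : program :=
  flatten (map (reloc1 off (size p)) p).

Lemma size_flatten_map (S T : Type) (f : S -> seq T) (b : nat) s :
  (forall x, size (f x) = b) -> size (flatten (map f s)) = b * size s.
Proof. by move=> H; elim: s => [|x s IH] /=; rewrite ?muln0 // size_cat H IH mulnS. Qed.

Lemma size_reloc1 off sz i : size (reloc1 off sz i) = 2.
Proof. by case: i. Qed.

Lemma size_reloc off p : size (reloc off p) = 2 * size p.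
Proof. by rewrite /reloc (@size_flatten_map _ _ _ 2) // => i; apply: size_reloc1. Qed.

Lemma code_at_reloc P off p pc i : code_at P off (reloc off p) ->
  onth p pc = Some i -> code_at P (off + 2 * pc) (reloc1 off (size p) i).
Proof.
rewrite /reloc; move: {1 3}off => o; move: (size p) => sz H.
elim: p o pc H => [|i' p IH] o [|pc] //=; move=> /code_at_cat [H1 H2].
  by case=> <-; rewrite muln0 addn0.
move=> /IH; rewrite mulnS addnA; apply.
by move: H2; rewrite size_reloc1.
Qed.

Section Relocation.
Variables (base : nat) (BD : Z).

(** [sD] is the state that the relocated program would have on a machine of its own. Its registers
    are bounded so that adding [base] to an address cannot overflow; cells need no bound, since
    [Read] checks what it fetches. *)
Definition dsim (s sD : state) : Prop :=
  [/\ forall r, reg s (rdyn r) = reg sD r,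
      reg s (rtmp 0) = Z.of_nat base,
      forall a, cell s (base + a) = cell sD a &
      forall r, (Z.abs (reg sD r) <= BD)%ZZ].

Definition same_own (s s' : state) : Prop :=
  (forall v, reg s' (rvar v) = reg s (rvar v)) /\
  (forall a, a < base -> cell s' a = cell s a).

Lemma same_own_trans s1 s2 s3 : same_own s1 s2 -> same_own s2 s3 -> same_own s1 s3.
Proof.
case=> r1 c1 [r2 c2]; split=> [v|a lt]; first by rewrite r2.
by rewrite c2 ?c1.
Qed.

Lemma dsim_tmp s sD d v : 0 < d -> dsim s sD ->
  dsim (set_reg s (rtmp d) v) sD /\ same_own s (set_reg s (rtmp d) v).
Proof.
move=> d0 [H1 H2 H3 H4]; split; last first.
  by split=> // u; rewrite reg_set ifF //; apply/eqP; rewrite /rvar /rtmp; lia.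
split=> // [r|]; rewrite reg_set ifF //; apply/eqP; rewrite /rtmp /rdyn; lia.
Qed.

Lemma dsim_dyn s sD r v : (Z.abs v <= BD)%ZZ -> dsim s sD ->
  dsim (set_reg s (rdyn r) v) (set_reg sD r v) /\ same_own s (set_reg s (rdyn r) v).
Proof.
move=> vB [H1 H2 H3 H4]; split; last first.
  by split=> // u; rewrite reg_set ifF //; apply/eqP; rewrite /rvar /rdyn; lia.
split=> // [r'||r'].
- rewrite !reg_set; case: eqP => [e|ne]; first by rewrite ifT //; apply/eqP; move: e;
  rewrite /rdyn; lia.
  by rewrite ifF //; apply/eqP => e; apply: ne; rewrite e.
- by rewrite reg_set ifF //; apply/eqP; rewrite /rtmp /rdyn; lia.
- by rewrite reg_set; case: ifP.
Qed.

Variables (w wD : nat).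
Hypothesis (wD_BD : (2 ^ Z.of_nat wD <= BD)%ZZ).
Hypothesis (BD_w : (BD + Z.of_nat base < 2 ^ (Z.of_nat w - 1))%ZZ).

Lemma step_nop P pc s : onth P pc = Some nop ->
  step w P pc s = Some (pc.+1, set_reg s (rtmp 1) 0).
Proof.
move=> c; apply: step_const => //=.
have : (0 < 2 ^ Z.of_nat wD)%ZZ by apply: Z.pow_pos_nonneg; lia.
lia.
Qed.

(** A value that passes the trap on [wD] bits is at most [BD], hence fits the larger words. The
    program may leave at any counter beyond its end; the [minn] sends all such exits to the end of
    the relocated code. *)
Lemma reloc_step P off p pc pc1 s sD sD1 :
  code_at P off (reloc off p) -> dsim s sD ->
  step wD p pc sD = Some (pc1, sD1) ->
  exists t s1, [/\ t <= 2,
    msteps w P (off + 2 * minn pc (size p)) s t (off + 2 * minn pc1 (size p)) s1,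
    dsim s1 sD1 & same_own s s1].
Proof.
move=> cP; case Ei: (onth p pc) => [i|]; last by rewrite /step Ei.
have lt : pc < size p by rewrite ltnNge; apply/negP => le; rewrite onth_default in Ei.
have -> : minn pc (size p) = pc by lia.
have ci := code_at_reloc cP Ei.
have e2 : off + 2 * minn pc.+1 (size p) = (off + 2 * pc).+2 by lia.
have fw v : fits wD v -> (Z.abs v <= BD)%ZZ by move/abs_fits; lia.
have fw' v : fits wD v -> (Z.abs v < 2 ^ (Z.of_nat w - 1))%ZZ by move/fw; lia.
rewrite /step Ei => st H; have [H1 H2 H3 H4] := st.
case: i Ei ci H => [r z|o r a b|r a|a r|a b l|a b l] Ei /code_at_cons [c1 /code_at_cons [c2 _]].
- case: ifP => // fz [<- <-]; exists 2.
  have [d1 o1] := dsim_dyn r (fw _ fz) st.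
  have [d2 o2] := dsim_tmp 0 (ltn0Sn 0) d1.
  exists (set_reg (set_reg s (rdyn r) z) (rtmp 1) 0); split=> //; last exact: same_own_trans o2.
  rewrite e2; apply: msteps_step (step_const s c1 (fw' _ fz)) _.
  by apply: msteps1; apply: step_nop.
- case: ifP => // fz [<- <-]; exists 2.
  have [d1 o1] := dsim_dyn r (fw _ fz) st.
  have [d2 o2] := dsim_tmp 0 (ltn0Sn 0) d1.
  move: d1 o1 d2 o2 fz; set z := eval_binop _ _ _ => d1 o1 d2 o2 fz.
  have ez : eval_binop o (reg s (rdyn a)) (reg s (rdyn b)) = z by rewrite !H1.
  exists (set_reg (set_reg s (rdyn r) z) (rtmp 1) 0); split=> //; last exact: same_own_trans o2.
  rewrite e2; have := step_op (w:=w) (s:=s) c1; rewrite ez => /(_ (fw' _ fz)) st1.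
  apply: msteps_step st1 _.
  by apply: msteps1; apply: step_nop.
- case: Z.leb_spec => // ge; case: ifP => // fz [<- <-]; exists 2.
  have [d1 o1] := dsim_tmp (reg sD a + Z.of_nat base)%ZZ (ltn0Sn 0) st.
  have [d2 o2] := dsim_dyn r (fw _ fz) d1.
  set s1 := set_reg (set_reg _ _ _) _ _ in d2 o2.
  exists s1; split=> //; [|exact: same_own_trans o2].
  rewrite e2; have := step_op (w:=w) (s:=s) c1.
  rewrite /= H1 H2; have := H4 a => Ha /(_ ltac:(lia)) st1.
  apply: msteps_step st1 _; apply: msteps1.
  have := step_read (w:=w) (s:=set_reg s (rtmp 1) (reg sD a + Z.of_nat base)) c2.
  rewrite reg_set eqxx.
  have -> : cell (set_reg s (rtmp 1) (reg sD a + Z.of_nat base))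
     (Z.to_nat (reg sD a + Z.of_nat base)) = cell sD (Z.to_nat (reg sD a)).
    by rewrite -H3 /=; congr (cell s _); lia.
  by apply; [lia|apply: fw'].
- case: Z.leb_spec => // ge [<- <-]; exists 2.
  have [d1 o1] := dsim_tmp (reg sD a + Z.of_nat base)%ZZ (ltn0Sn 0) st.
  set s1 := set_reg s _ _ in d1 o1.
  exists (set_cell s1 (base + Z.to_nat (reg sD a)) (reg sD r)); split=> //.
  + rewrite e2; have := step_op (w:=w) (s:=s) c1.
    rewrite /= H1 H2; have := H4 a => Ha /(_ ltac:(lia)) st1.
    apply: msteps_step st1 _; apply: msteps1.
    have := step_write w (s:=s1) c2.
    rewrite {1 2}/s1 reg_set eqxx => /(_ ltac:(lia)) ->.
    have -> : reg s1 (rdyn r) = reg sD r by case: d1.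
    by congr (Some (_, set_cell _ _ _)); lia.
  + case: d1 => K1 K2 K3 K4; split=> // a'.
    rewrite /= -K3; case: eqP => e; first by rewrite ifT //; lia.
    by rewrite ifF //; lia.
  + apply: same_own_trans o1 _; split=> // a' lt'.
    by rewrite /= ifF //; lia.
- case=> <- <-; rewrite -!H1; have := step_eq w s c1; case: Z.eqb => st1.
    by exists 1, s; split=> //; apply: msteps1.
  have [d1 o1] := dsim_tmp 0 (ltn0Sn 0) st.
  exists 2, (set_reg s (rtmp 1) 0); split=> //.
  by rewrite e2; apply: msteps_step st1 _; apply: msteps1; apply: step_nop.
- case=> <- <-; rewrite -!H1; have := step_lt w s c1; case: Z.ltb => st1.
    by exists 1, s; split=> //; apply: msteps1.
  have [d1 o1] := dsim_tmp 0 (ltn0Sn 0) st.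
  exists 2, (set_reg s (rtmp 1) 0); split=> //.
  by rewrite e2; apply: msteps_step st1 _; apply: msteps1; apply: step_nop.
Qed.

Lemma reloc_run P off p pc s sD t sD' :
  code_at P off (reloc off p) -> dsim s sD -> run wD p pc sD t sD' ->
  exists t1 s', [/\ t1 <= 2 * t,
    msteps w P (off + 2 * minn pc (size p)) s t1 (off + size (reloc off p)) s',
    dsim s' sD' & same_own s s'].
Proof.
move=> cP ds rn; elim: rn s ds => {pc sD t sD'} [pc sD le s ds|pc sD pc1 sD1 t sD' st _ IH s
  ds].
  exists 0, s; split=> //; rewrite size_reloc; have -> : minn pc (size p) = size p by lia.
  by constructor.
have [t1 [s1 [le1 m1 d1 o1]]] := reloc_step cP ds st.
have [t2 [s2 [le2 m2 d2 o2]]] := IH s1 d1.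
exists (t1 + t2), s2; split=> //; [lia|exact: msteps_trans m2|exact: same_own_trans o2].
Qed.

End Relocation.

(** * Grid graphs and a language for programs that use the dynamic algorithm *)

(** There is one column, and also one row, more than the squaring needs: each of the 2n^2 nodes (k,
    x) with k < n and x < 2n then owns exactly one edge to the right and one downwards. *)
Definition width (n : nat) : nat := n.*2.+1.
(** Equal to (n + 1)(2n + 1), written as a successor because [inord] needs one. *)
Definition nodes (n : nat) : nat := (n * (n.*2 + 3)).+1.

Lemma nodesE n : nodes n = n.+1 * width n.
Proof. rewrite /nodes /width; nia. Qed.

Definition vert (n k x : nat) : 'I_(nodes n) := inord (k * width n + x).

(* Node [k * width n + x] is in row [k] and column [x]; the horizontal edge to its
   right has weight [h k x], the vertical edge below it has weight [V].  The last
   row and the last column have no edges of their own. *)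
Definition grid_arc (n : nat) (V : Z) (h : nat -> nat -> Z) (u v : nat) : option Z :=
  let k := u %/ width n in let x := u %% width n in
  if (k < n) && (x < n.*2) then
    if v == u.+1 then Some (h k x)
    else if v == u + width n then Some V else None
  else None.

Definition grid (n : nat) (V : Z) (h : nat -> nat -> Z) : wgraph (nodes n) :=
  fun u v => if grid_arc n V h u v is Some w then Some w else grid_arc n V h v u.

Arguments grid n V h : clear implicits.

Definition upd2 (h : nat -> nat -> Z) (k x : nat) (w : Z) : nat -> nat -> Z :=
  fun k' x' => if (k' == k) && (x' == x) then w else h k' x'.

Lemma set2_eq (T : finType) (a b c d : T) :
  ([set a; b]%SET == [set c; d]%SET) =
  ((a == c) && (b == d)) || ((a == d) && (b == c)).
Proof.
apply/eqP/idP => [e|]; last first.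
  by case/orP => /andP[/eqP -> /eqP ->] //; apply: finset.setUC.
have : a \in [set c; d]%SET by rewrite -e !inE eqxx.
have : b \in [set c; d]%SET by rewrite -e !inE eqxx orbT.
have : c \in [set a; b]%SET by rewrite e !inE eqxx.
have : d \in [set a; b]%SET by rewrite e !inE eqxx orbT.
rewrite !inE ![c == _]eq_sym ![d == _]eq_sym.
by case: (a == c) (a == d) (b == c) (b == d) => [] [] [] [].
Qed.

Lemma divw n k x : x < width n -> (k * width n + x) %/ width n = k.
Proof. by move=> lt; rewrite divnMDl ?divn_small ?addn0. Qed.

Lemma modw n k x : x < width n -> (k * width n + x) %% width n = x.
Proof. by move=> lt; rewrite modnMDl modn_small. Qed.

Lemma vert_lt n k x : k <= n -> x < width n -> k * width n + x < nodes n.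
Proof. by rewrite nodesE => le lt; rewrite mulSn; nia. Qed.

Lemma val_vert n k x : k <= n -> x < width n -> vert n k x = k * width n + x :> nat.
Proof. by move=> le lt; rewrite /vert inordK //; apply: vert_lt. Qed.

Lemma vertE n (u : 'I_(nodes n)) : u = vert n (u %/ width n) (u %% width n).
Proof. by rewrite /vert -divn_eq inord_val. Qed.

Lemma grid_arc_upd n V h k x w a b : k < n -> x < n.*2 ->
  grid_arc n V (upd2 h k x w) a b =
  if (a == k * width n + x) && (b == a.+1) then Some w else grid_arc n V h a b.
Proof.
move=> kn xn; rewrite /grid_arc /upd2.
case: (a =P k * width n + x) => [->|ne] /=.
  have lt : x < width n by rewrite /width; lia.
  by rewrite divw // modw // kn xn !eqxx; case: eqP.
suff -> : (a %/ width n == k) && (a %% width n == x) = false by [].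
apply/andP => [[/eqP e1 /eqP e2]]; apply: ne.
by rewrite {1}(divn_eq a (width n)) e1 e2.
Qed.

Lemma grid_arc_gt n V h a b w : grid_arc n V h a b = Some w -> a < b.
Proof.
rewrite /grid_arc; case: ifP => // _; case: eqP => [->|_] //.
by case: eqP => // -> _; rewrite /width; lia.
Qed.

Lemma grid_sym n V h u v : grid n V h u v = grid n V h v u.
Proof.
rewrite /grid; case E1: (grid_arc n V h u v) => [w|]; case E2: (grid_arc n V h v u) => [w'|] //.
by have := grid_arc_gt E1; have := grid_arc_gt E2; lia.
Qed.

Lemma set_edge_grid n V h k x w : k < n -> x < n.*2 ->
  set_edge (grid n V h) (vert n k x) (vert n k x.+1) (Some w) =
  grid n V (upd2 h k x w).
Proof.
move=> kn xn; apply/funext => a; apply/funext => b.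
have l1 : x < width n by rewrite /width; lia.
have l2 : x.+1 < width n by rewrite /width; lia.
have kn' : k <= n by lia.
rewrite /set_edge set2_eq /grid !grid_arc_upd // -!(inj_eq val_inj) /= !val_vert // !addnS.
case: (a =P k * width n + x :> nat) => [ea|na] /=.
  rewrite ea; case: (b =P (k * width n + x).+1 :> nat) => [eb|nb] //=.
  by rewrite ifF //= ?ifF //; lia.
case: (b =P k * width n + x :> nat) => [eb|nb] /=; last by rewrite !andbF.
rewrite andbT eb; case: (a =P (k * width n + x).+1 :> nat) => [ea|na'] //=.
rewrite ea; case E: grid_arc => [w'|//].
by have := grid_arc_gt E; lia.
Qed.

(** [hor] is a ghost component: it describes the current graph of the dynamic algorithm, and the
    machine does not store it. *)
Record astate := AState { var : nat -> Z; mem : nat -> Z; hor : nat -> nat -> Z }.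

Definition upd (f : nat -> Z) (i : nat) (v : Z) : nat -> Z :=
  fun j => if j == i then v else f j.
Definition set_var (s : astate) v z := AState (upd (var s) v z) (mem s) (hor s).
Definition set_mem (s : astate) a z := AState (var s) (upd (mem s) a z) (hor s).
Definition set_hor (s : astate) k x w := AState (var s) (mem s) (upd2 (hor s) k x w).

Inductive cmd :=
| CSkip
| CAsg (v : nat) (e : expr)
| CLoad (v : nat) (e : expr)
| CStore (a e : expr)
| CSeq (c1 c2 : cmd)
| CIf (a b : expr) (c1 c2 : cmd)
| CWhile (a b : expr) (c : cmd)
| CChange (a b e : expr)
| CQuery (v : nat) (a b : expr).

Section Semantics.
Variables (n c' : nat) (B V : Z) (lim : nat).

(* [ev c s t ops s']: from [s], with the grid graph of [hor s] as the current graph,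
   [c] ends in [s'] after about [t] steps, during which the operations [ops] are
   performed on the graph.  Memory is used only below [lim], and every value that is
   read is at most [B] in absolute value. *)
Inductive ev :
  cmd -> astate -> nat -> seq (operation (nodes n)) -> astate -> Prop :=
| ev_skip s : ev CSkip s 0 [::] s
| ev_asg v e s of small B (var s) e :
    ev (CAsg v e) s 1 [::] (set_var s v (eval (var s) e))
| ev_load v e s a of small B (var s) e & eval (var s) e = Z.of_nat a & a < lim &
    (Z.abs (mem s a) <= B)%ZZ :
    ev (CLoad v e) s 1 [::] (set_var s v (mem s a))
| ev_store ea e s a of small B (var s) ea & small B (var s) e &
    eval (var s) ea = Z.of_nat a & a < lim :
    ev (CStore ea e) s 1 [::] (set_mem s a (eval (var s) e))
| ev_seq c1 c2 s t1 ops1 s1 t2 ops2 s2 of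
    ev c1 s t1 ops1 s1 & ev c2 s1 t2 ops2 s2 :
    ev (CSeq c1 c2) s (t1 + t2) (ops1 ++ ops2) s2
| ev_if a b c1 c2 s t ops s' of small B (var s) a & small B (var s) b &
    ev (if (eval (var s) a <? eval (var s) b)%ZZ then c1 else c2) s t ops s' :
    ev (CIf a b c1 c2) s t.+1 ops s'
| ev_while_stop a b c s of small B (var s) a & small B (var s) b &
    (eval (var s) b <= eval (var s) a)%ZZ :
    ev (CWhile a b c) s 1 [::] s
| ev_while_step a b c s t1 ops1 s1 t2 ops2 s2 of small B (var s) a & small B (var s) b &
    (eval (var s) a < eval (var s) b)%ZZ &
    ev c s t1 ops1 s1 & ev (CWhile a b c) s1 t2 ops2 s2 :
    ev (CWhile a b c) s (t1 + t2).+1 (ops1 ++ ops2) s2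
| ev_change a b e s k x w of lim = 2 * n ^ 2 &
    small B (var s) a & small B (var s) b & small B (var s) e & k < n & x < n.*2 &
    eval (var s) a = Z.of_nat (k * width n + x) &
    eval (var s) b = Z.of_nat (k * width n + x.+1) &
    eval (var s) e = w & (0 <= w <= Z.of_nat (nodes n ^ c'))%ZZ :
    ev (CChange a b e) s 1
      [:: Update (Change (vert n k x) (vert n k x.+1) w)] (set_hor s k x w)
| ev_query v a b s (x y : 'I_(nodes n)) d of lim = 2 * n ^ 2 &
    small B (var s) a & small B (var s) b &
    eval (var s) a = zord x & eval (var s) b = zord y &
    is_dist (grid n V (hor s)) x y (Some d) & (Z.abs d <= B)%ZZ :
    ev (CQuery v a b) s 1 [:: Query x y] (set_var s v d).

End Semantics.
Arguments ev n c' B V lim : clear implicits.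

Definition mov (d s : nat) : program := [:: Const (rtmp 1) 0; Op Add d s (rtmp 1)].

Definition ctest (a b : expr) : program := cexpr a 2 ++ cexpr b 3.

Definition change_head (a b e : expr) : program :=
  cexpr a 2 ++ cexpr b 3 ++ cexpr e 4 ++
  mov (rdyn 0) (rtmp 2) ++ mov (rdyn 1) (rtmp 3) ++ mov (rdyn 2) (rtmp 4).

Definition query_head (a b : expr) : program :=
  cexpr a 2 ++ cexpr b 3 ++ mov (rdyn 0) (rtmp 2) ++ mov (rdyn 1) (rtmp 3).

(** Lengths do not depend on the position of the code, so the targets of forward jumps are known
    before the code is generated. *)
Fixpoint clen (D : dyn_program) (c : cmd) : nat :=
  match c with
  | CSkip => 0
  | CAsg v e => size (cexpr e 2) + 2
  | CLoad v e => size (cexpr e 2) + 1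
  | CStore a e => size (ctest a e) + 1
  | CSeq c1 c2 => clen D c1 + clen D c2
  | CIf a b c1 c2 => size (ctest a b) + (clen D c2 + clen D c1).+2
  | CWhile a b c => size (ctest a b) + (clen D c).+3
  | CChange a b e => size (change_head a b e) + 2 * size (change_code D)
  | CQuery v a b => size (query_head a b) + (2 * size (query_code D) + 2)
  end.

(** [JumpEq] of a register with itself serves as the unconditional jump. In [CIf] the [JumpLt] leads
    to the first branch, so the second one is placed before it. A query reads only register 1,
    because all distances asked for are finite. *)
Fixpoint comp (D : dyn_program) (off : nat) (c : cmd) : program :=
  match c with
  | CSkip => [::]
  | CAsg v e => cexpr e 2 ++ mov (rvar v) (rtmp 2)
  | CLoad v e => cexpr e 2 ++ [:: Read (rvar v) (rtmp 2)]
  | CStore a e => ctest a e ++ [:: Write (rtmp 2) (rtmp 3)]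
  | CSeq c1 c2 => comp D off c1 ++ comp D (off + clen D c1) c2
  | CIf a b c1 c2 =>
      let o := off + size (ctest a b) in
      let oif := (o.+1 + clen D c2).+1 in
      ctest a b ++ JumpLt (rtmp 2) (rtmp 3) oif ::
      comp D o.+1 c2 ++ JumpEq (rtmp 2) (rtmp 2) (oif + clen D c1) ::
      comp D oif c1
  | CWhile a b c =>
      let o := off + size (ctest a b) in
      ctest a b ++ JumpLt (rtmp 2) (rtmp 3) o.+2 ::
      JumpEq (rtmp 2) (rtmp 2) (o + (clen D c).+3) ::
      comp D o.+2 c ++ [:: JumpEq (rtmp 2) (rtmp 2) off]
  | CChange a b e => change_head a b e ++
      reloc (off + size (change_head a b e)) (change_code D)
  | CQuery v a b => query_head a b ++
      reloc (off + size (query_head a b)) (query_code D) ++ mov (rvar v) (rdyn 1)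
  end.

Lemma size_comp D off c : size (comp D off c) = clen D c.
Proof.
elim: c off => [|v e|v e|a e|c1 IH1 c2 IH2|a b c1 IH1 c2 IH2|a b c IH|a b e|v a b] off //=;
  rewrite ?size_cat //= ?size_cat ?size_reloc //= ?size_cat ?IH ?IH1 ?IH2 /=; lia.
Qed.

Fixpoint sized (c : cmd) : bool :=
  match c with
  | CSkip => true
  | CAsg _ e | CLoad _ e => leaves e <= max_leaves
  | CStore a e => (leaves a <= max_leaves) && (leaves e <= max_leaves)
  | CSeq c1 c2 => sized c1 && sized c2
  | CIf a b c1 c2 =>
      [&& leaves a <= max_leaves, leaves b <= max_leaves, sized c1 & sized c2]
  | CWhile a b c => [&& leaves a <= max_leaves, leaves b <= max_leaves & sized c]
  | CChange a b e =>
      [&& leaves a <= max_leaves, leaves b <= max_leaves & leaves e <= max_leaves]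
  | CQuery _ a b => (leaves a <= max_leaves) && (leaves b <= max_leaves)
  end.

Lemma size_cexpr e d : (size (cexpr e d)).+1 <= 3 * leaves e.
Proof.
elim: e d => [v|z|o a IHa b IHb] d //=.
rewrite !size_cat /=; have := IHa d; have := IHb d.+1; lia.
Qed.

(** The recorded run fixes the answer to each query in advance; uniqueness of distances forces the
    dynamic algorithm to return the same one. *)
Lemma is_dist_inj n (g : wgraph n) x y d d' :
  is_dist g x y d -> is_dist g x y d' -> d = d'.
Proof.
case: d => [d|]; case: d' => [d'|] //=.
- move=> [[p [w1 l1 e1]] H1] [[q [w2 l2 e2]] H2].
  have := H1 q w2 l2; have := H2 p w1 l1; rewrite e1 e2 => *; congr Some; lia.
- by move=> [[p [w1 l1 e1]] _] /(_ p w1).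
- by move=> H [[p [w1 l1 e1]] _]; have := H p w1.
Qed.

(** * Correctness of the compiler *)

Lemma rtmp_rdyn j r : (rtmp j == rdyn r) = false.
Proof. by apply/eqP; rewrite /rtmp /rdyn; lia. Qed.

Lemma rtmp_eq i j : (rtmp i == rtmp j) = (i == j).
Proof. by rewrite /rtmp; apply/eqP/eqP; lia. Qed.

Lemma mov_steps w P off d r s : code_at P off (mov d r) -> r != rtmp 1 ->
  (Z.abs (reg s r) < 2 ^ (Z.of_nat w - 1))%ZZ ->
  msteps w P off s 2 (off + 2) (set_reg (set_reg s (rtmp 1) 0) d (reg s r)).
Proof.
move=> /code_at_cons [c1 /code_at_cons [c2 _]] ne fr.
have st1 := step_const (w:=w) s c1 ltac:(lia).
set s1 := set_reg s (rtmp 1) 0 in st1 *.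
have e1 : eval_binop Add (reg s1 r) (reg s1 (rtmp 1)) = reg s r.
  by rewrite /s1 !reg_set eqxx (negbTE ne) /=; lia.
have := step_op (s:=s1) (w:=w) c2; rewrite e1 => /(_ fr) st2.
by rewrite addn2; apply: msteps_step st1 _; apply: msteps1.
Qed.

Section Compilation.
Variables (n c' : nat) (B V : Z) (lim : nat) (D : dyn_program) (w wD : nat) (BD : Z).
Local Notation base := (2 * n ^ 2).
Local Notation top := (2 ^ (Z.of_nat w - 1))%ZZ.
Hypothesis (base_lim : base <= lim).
Hypothesis (B_ge2 : (2 <= B)%ZZ).
Hypothesis (B_w : (B ^ Z.of_nat max_leaves < top)%ZZ).
Hypothesis (wD_BD : (2 ^ Z.of_nat wD <= BD)%ZZ).
Hypothesis (BD_w : (BD + Z.of_nat base < top)%ZZ).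
Hypothesis (nodes_BD : (Z.of_nat (nodes n) <= BD)%ZZ).
Hypothesis (weight_BD : (Z.of_nat (nodes n ^ c') <= BD)%ZZ).

(** Two phases share this relation. With [lim] above [base] the reduction may still write where the
    input of the dynamic algorithm is being built, and the cells of [sD] there are left open. With
    [lim = base] the relation contains [dsim]. *)
Record sim (s : state) (a : astate) (sD : state) : Prop := Sim {
  sim_var : forall v, reg s (rvar v) = var a v;
  sim_mem : forall i, i < lim -> cell s i = mem a i;
  sim_dyn : forall r, reg s (rdyn r) = reg sD r;
  sim_base : reg s (rtmp 0) = Z.of_nat base;
  sim_cell : forall i, lim <= base + i -> cell s (base + i) = cell sD i;
  sim_bound : forall r, (Z.abs (reg sD r) <= BD)%ZZ }.

Lemma sim_above s s' a sD d : 0 < d -> same_above d s s' -> sim s a sD -> sim s' a sD.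
Proof.
move=> d0 sa [H1 H2 H3 H4 H5 H6]; split=> //.
- by move=> v; rewrite (same_above_var _ sa).
- by case: sa => ->.
- by move=> v; rewrite (same_above_dyn _ sa).
- by rewrite (same_above_tmp _ sa).
- by case: sa => ->.
Qed.

Lemma small_w x : (Z.abs x <= B)%ZZ -> (Z.abs x < top)%ZZ.
Proof.
suff : (B <= B ^ Z.of_nat max_leaves)%ZZ by move: B_w; lia.
rewrite -{1}(Z.pow_1_r B); apply: Z.pow_le_mono_r; rewrite /max_leaves; lia.
Qed.

Lemma eval_w f e : leaves e <= max_leaves -> small B f e -> (Z.abs (eval f e) < top)%ZZ.
Proof.
move=> le sm; have := eval_small B_ge2 sm.
have : (B ^ Z.of_nat (leaves e) <= B ^ Z.of_nat max_leaves)%ZZ by apply: Z.pow_le_mono_r; lia.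
move: B_w; lia.
Qed.

Lemma sim_set_var s a sD v z : sim s a sD ->
  sim (set_reg s (rvar v) z) (set_var a v z) sD.
Proof.
move=> [H1 H2 H3 H4 H5 H6]; split=> //=.
- move=> u; rewrite /upd H1 /rvar; case: (u =P v) => [->|ne]; first by rewrite eqxx.
  by rewrite ifF //; apply/eqP; lia.
- by move=> r; rewrite ifF //; apply/eqP; rewrite /rvar /rdyn; lia.
- by rewrite ifF //; apply/eqP; rewrite /rvar /rtmp; lia.
Qed.

Lemma cexpr_sim P off e d s a sD : code_at P off (cexpr e d) -> sim s a sD ->
  0 < d -> leaves e <= max_leaves -> small B (var a) e ->
  exists s', [/\ msteps w P off s (size (cexpr e d)) (off + size (cexpr e d)) s',
    same_above d s s', sim s' a sD & reg s' (rtmp d) = eval (var a) e].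
Proof.
move=> cP ss d0 le sm.
have [s' [m1 sa e1]] := cexpr_correct B_ge2 B_w le sm (sim_var ss) cP.
by exists s'; split=> //; apply: sim_above sa ss.
Qed.

Lemma ctest_sim P off e1 e2 s a sD : code_at P off (ctest e1 e2) -> sim s a sD ->
  leaves e1 <= max_leaves -> leaves e2 <= max_leaves ->
  small B (var a) e1 -> small B (var a) e2 ->
  exists s', [/\ msteps w P off s (size (ctest e1 e2)) (off + size (ctest e1 e2)) s',
    same_above 2 s s', sim s' a sD, reg s' (rtmp 2) = eval (var a) e1 &
    reg s' (rtmp 3) = eval (var a) e2].
Proof.
move=> /code_at_cat [c1 c2] ss le1 le2 sm1 sm2.
have [s1 [m1 sa1 ss1 r1]] := cexpr_sim c1 ss isT le1 sm1.
have [s2 [m2 sa2 ss2 r2]] := cexpr_sim c2 ss1 isT le2 sm2.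
exists s2; split=> //.
- by rewrite /ctest size_cat addnA; apply: msteps_trans m1 m2.
- exact: same_above_trans sa1 sa2.
- by rewrite (same_above_tmp _ sa2).
Qed.

Lemma sim_dsim s a sD : lim = base -> sim s a sD -> dsim base BD s sD.
Proof. by move=> e [H1 H2 H3 H4 H5 H6]; split=> // i; apply: H5; rewrite e leq_addr. Qed.

Lemma dsim_sim s s' a sD sD' : lim = base -> sim s a sD -> dsim base BD s' sD' ->
  same_own base s s' -> sim s' a sD'.
Proof.
move=> e [H1 H2 H3 H4 H5 H6] [K1 K2 K3 K4] [L1 L2]; split=> //.
  by move=> v; rewrite L1.
by move=> i lt; rewrite L2 -?H2 // -e.
Qed.

Lemma mov_arg P off r d x s a sD : lim = base -> code_at P off (mov (rdyn r) (rtmp d)) ->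
  sim s a sD -> 1 < d -> reg s (rtmp d) = x -> (Z.abs x <= BD)%ZZ ->
  exists s', [/\ msteps w P off s 2 (off + 2) s',
    sim s' a (set_reg sD r x) & forall j, 1 < j -> reg s' (rtmp j) = reg s (rtmp j)].
Proof.
move=> el cP ss d1 rx xB.
have xw : (Z.abs (reg s (rtmp d)) < top)%ZZ by rewrite rx; move: BD_w; lia.
have m1 := mov_steps cP _ xw; rewrite rx in m1.
eexists; split; first by apply: m1; rewrite rtmp_eq gtn_eqF.
  have [d2 o2] := dsim_tmp 0 (isT : 0 < 1) (sim_dsim el ss).
  have [d3 o3] := dsim_dyn r xB d2.
  by apply: dsim_sim el ss d3 _; apply: same_own_trans o2 o3.
by move=> j j1; rewrite !reg_set rtmp_rdyn rtmp_eq gtn_eqF.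
Qed.

Lemma set_args3 sD x y z :
  set_args sD [:: x; y; z] = set_reg (set_reg (set_reg sD 0 x) 1 y) 2 z.
Proof. by rewrite /set_args /set_reg /=; congr State; apply/funext => -[|[|[|i]]] //=;
  rewrite nth_nil. Qed.

Lemma set_args2 sD x y :
  set_args sD [:: x; y] = set_reg (set_reg sD 0 x) 1 y.
Proof. by rewrite /set_args /set_reg /=; congr State; apply/funext => -[|[|i]] //=;
  rewrite nth_nil. Qed.

Lemma zord_BD (x : 'I_(nodes n)) : (Z.abs (zord x) <= BD)%ZZ.
Proof. by move: nodes_BD (ltn_ord x); rewrite /zord; lia. Qed.

Lemma comp_correct c a k ops a' :
  ev n c' B V lim c a k ops a' -> sized c ->
  forall P off s sD rest t, code_at P off (comp D off c) -> sim s a sD ->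
  serves wD D (grid n V (hor a)) sD (ops ++ rest) t ->
  exists t1 s' sD' t', [/\ msteps w P off s t1 (off + clen D c) s', sim s' a' sD',
    serves wD D (grid n V (hor a')) sD' rest t', t1 + 2 * t' <= 200 * k + 2 * t &
    ops = [::] -> sD' = sD].
Proof.
elim=> {c a k ops a'}.
- move=> a _ P off s sD rest t cP ss sv; exists 0, s, sD, t; split=> //=.
  by rewrite addn0; constructor.
- move=> v e a sm sz P off s sD rest t /code_at_cat [c1 c2] ss sv.
  have [s1 [m1 sa1 ss1 r1]] := cexpr_sim c1 ss isT sz sm.
  have m2 := mov_steps (s:=s1) c2 (ltac:(by apply/eqP; rewrite /rtmp; lia))
    (ltac:(rewrite r1; exact: eval_w sz sm)).
  rewrite r1 in m2.
  exists (size (cexpr e 2) + 2); eexists; exists sD, t; split=> //.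
    by rewrite /= addnA; apply: msteps_trans m1 m2.
    by apply: sim_set_var; apply: sim_above ss1; last apply: (@same_above_set 1).
  by move: sz; have := size_cexpr e 2; rewrite /= /max_leaves; lia.
- move=> v e a i sm ei il iB sz P off s sD rest t /code_at_cat [c1 /code_at_cons [c2 _]] ss sv.
  have [s1 [m1 sa1 ss1 r1]] := cexpr_sim c1 ss isT sz sm.
  have := step_read (w:=w) (s:=s1) c2; rewrite r1 ei Nat2Z.id (sim_mem ss1) //.
  move=> /(_ (ltac:(lia)) (small_w iB)) st.
  exists (size (cexpr e 2) + 1); eexists; exists sD, t; split=> //.
    by rewrite /= addnA; apply: msteps_trans m1 _; rewrite addn1; apply: msteps1 st.
  - exact: sim_set_var.
  by move: sz; have := size_cexpr e 2; rewrite /= /max_leaves; lia.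
- move=> e1 e2 a i sm1 sm2 ei il /andP [sz1 sz2] P off s sD rest t.
  move=> /code_at_cat [c1 /code_at_cons [c2 _]] ss sv.
  have [s1 [m1 sa1 ss1 r1 r2]] := ctest_sim c1 ss sz1 sz2 sm1 sm2.
  have := step_write w (s:=s1) c2; rewrite r1 ei Nat2Z.id r2.
  move=> /(_ (ltac:(lia))) st.
  exists (size (ctest e1 e2) + 1); eexists; exists sD, t; split=> //.
  - by rewrite /= addnA; apply: msteps_trans m1 _; rewrite addn1; apply: msteps1 st.
  - case: ss1 => H1 H2 H3 H4 H5 H6; split=> //= j lj; last by rewrite ifF ?H5 //; lia.
    by rewrite /upd; case: ifP => // _; apply: H2.
  - move: sz1 sz2; have := size_cexpr e1 2; have := size_cexpr e2 3.
    by rewrite /ctest size_cat /max_leaves; lia.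
- move=> c1 c2 a t1 ops1 a1 t2 ops2 a2 _ IH1 _ IH2 /andP [sz1 sz2] P off s sD rest t.
  move=> /code_at_cat [cP1 cP2] ss; rewrite -catA => sv.
  have [u1 [s1 [sD1 [v1 [m1 ss1 sv1 le1 q1]]]]] := IH1 sz1 _ _ _ _ _ _ cP1 ss sv.
  rewrite size_comp in cP2.
  have [u2 [s2 [sD2 [v2 [m2 ss2 sv2 le2 q2]]]]] := IH2 sz2 _ _ _ _ _ _ cP2 ss1 sv1.
  exists (u1 + u2), s2, sD2, v2; split=> //; [|by lia|]; last first.
    by move: q1 q2; case: (ops1) (ops2) => [|o1 l1] [|o2 l2] //= q1 q2 _; rewrite q2 ?q1.
  by rewrite /= addnA; apply: msteps_trans m1 m2.
- move=> e1 e2 c1 c2 a t1 ops a1 sm1 sm2 _ IH /and4P [sz1 sz2 szc1 szc2] P off s sD rest t.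
  move=> /code_at_cat [cP1 /code_at_cons [cP2 /code_at_cat [cP3 /code_at_cons [cP4 cP5]]]] ss
    sv.
  rewrite size_comp in cP4 cP5.
  have [s1 [m1 sa1 ss1 r1 r2]] := ctest_sim cP1 ss sz1 sz2 sm1 sm2.
  have sz12 : size (ctest e1 e2) <= 96.
    move: sz1 sz2; have := size_cexpr e1 2; have := size_cexpr e2 3.
    by rewrite /ctest size_cat /max_leaves; lia.
  have := step_lt w s1 cP2; rewrite r1 r2; case: Z.ltb_spec IH sv => _ IH sv st.
    have [u2 [s2 [sD2 [v2 [m2 ss2 sv2 le2 q2]]]]] := IH szc1 _ _ _ _ _ _ cP5 ss1 sv.
    exists ((size (ctest e1 e2)).+1 + u2), s2, sD2, v2; split=> //; try by lia.
    have -> : off + clen D (CIf e1 e2 c1 c2) =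
        ((off + size (ctest e1 e2)).+1 + clen D c2).+1 + clen D c1 by rewrite /=; lia.
    apply: msteps_trans m2; rewrite -addn1; apply: msteps_trans m1 _.
    exact: msteps1 st.
  have [u2 [s2 [sD2 [v2 [m2 ss2 sv2 le2 q2]]]]] := IH szc2 _ _ _ _ _ _ cP3 ss1 sv.
  have := step_eq w s2 cP4; rewrite Z.eqb_refl => st2.
  exists ((size (ctest e1 e2)).+1 + u2 + 1), s2, sD2, v2; split=> //; try by lia.
  have -> : off + clen D (CIf e1 e2 c1 c2) =
        ((off + size (ctest e1 e2)).+1 + clen D c2).+1 + clen D c1 by rewrite /=; lia.
  apply: msteps_trans (msteps1 st2).
  apply: msteps_trans m2; rewrite -addn1; apply: msteps_trans m1 _.
  exact: msteps1 st.
- move=> e1 e2 c a sm1 sm2 ge /and3P [sz1 sz2 szc] P off s sD rest t.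
  move=> /code_at_cat [cP1 /code_at_cons [cP2 /code_at_cons [cP3 _]]] ss sv.
  have [s1 [m1 sa1 ss1 r1 r2]] := ctest_sim cP1 ss sz1 sz2 sm1 sm2.
  have := step_lt w s1 cP2; rewrite r1 r2; case: Z.ltb_spec => [|_ st1]; first by lia.
  have := step_eq w s1 cP3; rewrite Z.eqb_refl => st2.
  exists (size (ctest e1 e2) + 2), s1, sD, t; split=> //.
    rewrite /= addnA; apply: msteps_trans m1 _.
    by apply: msteps_step st1 _; apply: msteps1.
  move: sz1 sz2; have := size_cexpr e1 2; have := size_cexpr e2 3.
  by rewrite /ctest size_cat /max_leaves; lia.
- move=> e1 e2 c a t1 ops1 a1 t2 ops2 a2 sm1 sm2 lt _ IH1 _ IH2 sz P off s sD rest t.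
  move=> cP ss; rewrite -catA => sv.
  move: (sz) (cP) => /and3P [sz1 sz2 szc].
  move=> /code_at_cat [cP1 /code_at_cons [cP2 /code_at_cons [cP3 /code_at_cat [cP4
    /code_at_cons [cP5 _]]]]].
  rewrite size_comp in cP5.
  have [s1 [m1 sa1 ss1 r1 r2]] := ctest_sim cP1 ss sz1 sz2 sm1 sm2.
  have := step_lt w s1 cP2; rewrite r1 r2; case: Z.ltb_spec => [_ st1|]; last by lia.
  have [u2 [s2 [sD2 [v2 [m2 ss2 sv2 le2 q2]]]]] := IH1 szc _ _ _ _ _ _ cP4 ss1 sv.
  have := step_eq w s2 cP5; rewrite Z.eqb_refl => st2.
  have [u3 [s3 [sD3 [v3 [m3 ss3 sv3 le3 q3]]]]] := IH2 sz _ _ _ _ _ _ cP ss2 sv2.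
  exists (size (ctest e1 e2) + 1 + u2 + 1 + u3), s3, sD3, v3; split=> //; last first.
    - by move: q2 q3; case: (ops1) (ops2) => [|o1 l1] [|o2 l2] //= q2 q3 _; rewrite q3 ?q2.
    - move: sz1 sz2; have := size_cexpr e1 2; have := size_cexpr e2 3.
    by rewrite /ctest size_cat /max_leaves; lia.
  apply: msteps_trans m3; apply: msteps_trans (msteps1 st2).
  by apply: msteps_trans m2; apply: msteps_trans m1 _; apply: msteps1 st1.
- move=> e1 e2 e3 a k x z el sm1 sm2 sm3 kn xn E1 E2 E3 zN /and3P [sz1 sz2 sz3].
  move=> P off s sD rest t.
  move=> /code_at_cat [/code_at_cat [cP1 /code_at_cat [cP2 /code_at_cat [cP3 /code_at_cat [cP4
    /code_at_cat [cP5 cP6]]]]] cP7] ss.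
  move=> /= [t1 [sD1 [t2 [ex sv ->]]]].
  have xw : x < width n by rewrite /width; lia.
  have xw' : x.+1 < width n by rewrite /width; lia.
  rewrite set_args3 /zord !val_vert ?(ltnW kn) // -E1 -E2 in ex.
  have [s1 [m1 sa1 ss1 r1]] := cexpr_sim cP1 ss isT sz1 sm1.
  have [s2 [m2 sa2 ss2 r2]] := cexpr_sim cP2 ss1 isT sz2 sm2.
  have [s3 [m3 sa3 ss3 r3]] := cexpr_sim cP3 ss2 isT sz3 sm3.
  have b1 : (Z.abs (eval (var a) e1) <= BD)%ZZ.
    by rewrite E1; have := vert_lt (ltnW kn) xw; move: nodes_BD; lia.
  have b2 : (Z.abs (eval (var a) e2) <= BD)%ZZ.
    by rewrite E2; have := vert_lt (ltnW kn) xw'; move: nodes_BD; lia.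
  have b3 : (Z.abs z <= BD)%ZZ by move: weight_BD; lia.
  have r1' : reg s3 (rtmp 2) = eval (var a) e1.
    by rewrite (same_above_tmp _ sa3) ?(same_above_tmp _ sa2).
  have r2' : reg s3 (rtmp 3) = eval (var a) e2.
    by rewrite (same_above_tmp _ sa3).
  have [s4 [m4 ss4 k4]] := mov_arg el cP4 ss3 isT r1' b1.
  have [s5 [m5 ss5 k5]] := mov_arg el cP5 ss4 isT (etrans (k4 3 isT) r2') b2.
  have [s6 [m6 ss6 k6]] := mov_arg el cP6 ss5 isT (etrans (k5 4 isT) (etrans (k4 4 isT)
    (etrans r3 E3))) b3.
  have [t7 [s7 [le7 m7 d7 o7]]] := reloc_run wD_BD BD_w cP7 (sim_dsim el ss6) ex.
  rewrite -/(set_edge _ _ _ _) set_edge_grid // in sv.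
  eexists; exists s7, sD1, t2; split.
  + rewrite min0n muln0 addn0 size_reloc in m7.
    rewrite /= [off + _]addnA; apply: msteps_trans m7.
    rewrite /change_head !size_cat !addnA.
    exact: msteps_trans (msteps_trans (msteps_trans (msteps_trans (msteps_trans m1 m2) m3) m4)
      m5) m6.
  + apply: dsim_sim el _ d7 o7.
    by case: ss6 => H1 H2 H3 H4 H5 H6; split.
  + exact: sv.
  + move: sz1 sz2 sz3; have := size_cexpr e1 2; have := size_cexpr e2 3;
    have := size_cexpr e3 4.
    by rewrite /max_leaves; lia.
  + by [].
- move=> v e1 e2 a x y d el sm1 sm2 E1 E2 isd dB /andP [sz1 sz2].
  move=> P off s sD rest t.
  move=> /code_at_cat [/code_at_cat [cP1 /code_at_cat [cP2 /code_at_cat [cP3 cP4]]]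
    /code_at_cat [cP5 cP6]] ss.
  move=> /= [t1 [sD1 [t2 [ex isd' sv ->]]]].
  rewrite set_args2 -E1 -E2 in ex.
  have [s1 [m1 sa1 ss1 r1]] := cexpr_sim cP1 ss isT sz1 sm1.
  have [s2 [m2 sa2 ss2 r2]] := cexpr_sim cP2 ss1 isT sz2 sm2.
  have b1 : (Z.abs (eval (var a) e1) <= BD)%ZZ by rewrite E1; apply: zord_BD.
  have b2 : (Z.abs (eval (var a) e2) <= BD)%ZZ by rewrite E2; apply: zord_BD.
  have r1' : reg s2 (rtmp 2) = eval (var a) e1 by rewrite (same_above_tmp _ sa2).
  have [s3 [m3 ss3 k3]] := mov_arg el cP3 ss2 isT r1' b1.
  have [s4 [m4 ss4 k4]] := mov_arg el cP4 ss3 isT (etrans (k3 3 isT) r2) b2.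
  have [t5 [s5 [le5 m5 d5 o5]]] := reloc_run wD_BD BD_w cP5 (sim_dsim el ss4) ex.
  have ss5 : sim s5 a sD1 by apply: dsim_sim el ss4 d5 o5.
  (* The recorded answer is finite, so the flag in register 0 is nonzero and register 1 holds the
     distance. *)
  have ed : reg s5 (rdyn 1) = d.
    have := is_dist_inj isd isd'; rewrite /decode_dist (sim_dyn ss5).
    by case: ifP => // _ [].
  have m6 := mov_steps (s:=s5) cP6 (ltac:(by apply/eqP; rewrite /rtmp /rdyn; lia))
    (ltac:(rewrite ed; exact: small_w)).
  rewrite ed in m6.
  do 2 eexists; exists sD1, t2; split.
  + rewrite min0n muln0 addn0 in m5.
    rewrite /= -(size_reloc (off + size (query_head e1 e2))) !addnA; apply: msteps_trans m6.
    apply: msteps_trans m5; rewrite /query_head !size_cat !addnA.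
    exact: msteps_trans (msteps_trans (msteps_trans m1 m2) m3) m4.
  + apply: sim_set_var; apply: sim_above ss5; last by apply: (@same_above_set 1).
    by [].
  + exact: sv.
  + move: sz1 sz2; have := size_cexpr e1 2; have := size_cexpr e2 3.
    by rewrite /max_leaves; lia.
  + by [].
Qed.

End Compilation.

(** * Planarity of the grid *)

Definition grid_edge (n : nat) (V : Z) (h : nat -> nat -> Z) (k x k' x' : nat) (w : Z) :=
  [/\ k < n, x < n.*2 &
    [/\ k' = k, x' = x.+1 & w = h k x] \/ [/\ k' = k.+1, x' = x & w = V]].

Lemma grid_arc_edge n V h (u v : 'I_(nodes n)) w : grid_arc n V h u v = Some w ->
  exists k x k' x', [/\ grid_edge n V h k x k' x' w, u = vert n k x & v = vert n k' x'].
Proof.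
rewrite /grid_arc; case: ifP => // /andP [kn xn].
have l0 : u %% width n < width n by rewrite ltn_pmod.
have l1 : (u %% width n).+1 < width n by rewrite /width ltnS.
case: eqP => [e [<-]|_].
  exists (u %/ width n), (u %% width n), (u %/ width n), (u %% width n).+1.
  split; [by split=> //; left|exact: vertE|].
  by apply: val_inj; rewrite /= val_vert ?(ltnW kn) // addnS -divn_eq.
case: eqP => // e [<-].
exists (u %/ width n), (u %% width n), (u %/ width n).+1, (u %% width n).
split; [by split=> //; right|exact: vertE|].
by apply: val_inj; rewrite /= val_vert // mulSn -addnA -divn_eq addnC.
Qed.

Lemma grid_edgeP n V h u v w : grid n V h u v = Some w ->
  exists k x k' x', grid_edge n V h k x k' x' w /\
    ((u = vert n k x /\ v = vert n k' x') \/ (v = vert n k x /\ u = vert n k' x')).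
Proof.
rewrite /grid; case E: grid_arc => [w'|].
  case=> <-; have [k [x [k' [x' [H -> ->]]]]] := grid_arc_edge E.
  by exists k, x, k', x'; split=> //; left.
move=> E'; have [k [x [k' [x' [H -> ->]]]]] := grid_arc_edge E'.
by exists k, x, k', x'; split=> //; right.
Qed.

Lemma grid_hor n V h k x : k < n -> x < n.*2 ->
  grid n V h (vert n k x) (vert n k x.+1) = Some (h k x).
Proof.
move=> kn xn; have xw : x < width n by rewrite /width; lia.
have xw' : x.+1 < width n by rewrite /width; lia.
rewrite /grid /grid_arc !val_vert ?(ltnW kn) //.
by rewrite divw // modw // kn xn addnS eqxx.
Qed.

Lemma grid_ver n V h k x : k < n -> x < n.*2 ->
  grid n V h (vert n k x) (vert n k.+1 x) = Some V.
Proof.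
move=> kn xn; have xw : x < width n by rewrite /width; lia.
rewrite /grid /grid_arc !val_vert ?(ltnW kn) //.
rewrite divw // modw // kn xn.
have -> : k.+1 * width n + x = k * width n + x + width n by rewrite mulSn; lia.
by rewrite eqxx -[_.+1]addn1 eqn_add2l ifF //; apply/eqP; rewrite /width; lia.
Qed.

Section Planarity.
Variable R : realType.
Local Open Scope ring_scope.

Definition pos n (u : 'I_(nodes n)) : R * R :=
  ((u %/ width n)%:R, (u %% width n)%:R).

Definition segment (p q : R * R) (t : R) : R * R :=
  (p.1 + t * (q.1 - p.1), p.2 + t * (q.2 - p.2)).

Lemma pos_vert n k x : (k <= n)%N -> (x < width n)%N -> pos (vert n k x) = (k%:R, x%:R).
Proof. by move=> kn xn; rewrite /pos val_vert // divw // modw. Qed.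

Lemma pos_inj n : injective (@pos n).
Proof.
move=> u v [/eqP]; rewrite eqr_nat => /eqP e1 /eqP; rewrite eqr_nat => /eqP e2.
by rewrite (vertE u) (vertE v) e1 e2.
Qed.

Lemma segment_continuous p q : continuous (segment p q).
Proof.
move=> t; apply: (@cvg_pair _ _ _ _ (nbhs (segment p q t).1) (nbhs (segment p q t).2)).
  by apply: cvgD; [exact: cvg_cst|apply: cvgM; [exact: cvg_id|exact: cvg_cst]].
by apply: cvgD; [exact: cvg_cst|apply: cvgM; [exact: cvg_id|exact: cvg_cst]].
Qed.

Lemma segment_inj p q : p <> q -> injective (segment p q).
Proof.
case: p q => [a b] [c d] ne s t [] /= /addrI e1 /addrI e2.
case: (c - a =P 0) => [e|/eqP z]; last exact: (mulIf z).
case: (d - b =P 0) => [e'|/eqP z]; last exact: (mulIf z).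
by case: ne; congr pair; lra.
Qed.

Lemma nat_frac (a b : nat) (s t : R) : 0 <= s < 1 -> 0 <= t < 1 ->
  a%:R + s = b%:R + t -> a = b /\ s = t.
Proof.
move=> sb tb e; have ab : a = b.
  apply/eqP; rewrite eqn_leq.
  by apply/andP; split; rewrite -ltnS -(ltr_nat R) -natr1; lra.
by split=> //; move: e; rewrite ab => /addrI.
Qed.

(** The integer parts of an interior point give the node (k, x) that owns the edge, and the
    coordinate with a nonzero fractional part gives its direction, [d] for vertical. So the point
    determines the edge, whichever way it is traversed. *)
Lemma segment_edge n V h (u v : 'I_(nodes n)) t : edge (grid n V h) u v -> t \in `]0, 1[ ->
  exists k x (d : bool) s, [/\ (k < n)%N && (x < n.*2)%N, 0 < s < 1,
    segment (pos u) (pos v) t = (k%:R + d%:R * s, x%:R + (~~ d)%:R * s) &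
    [set u; v]%SET = [set vert n k x; if d then vert n k.+1 x else vert n k x.+1]%SET].
Proof.
rewrite /edge in_itv /=; case E: grid => [w|//] _ tb.
have [k [x [k' [x' [[kn xn H] H']]]]] := grid_edgeP E.
exists k, x, (k' == k.+1).
have [s [sb es]] : exists s, 0 < s < 1 /\
    segment (pos u) (pos v) t = segment (pos (vert n k x)) (pos (vert n k' x')) s.
  case: H' => [[-> ->]|[-> ->]]; first by exists t.
  exists (1 - t); split; first lra.
  by rewrite /segment; congr pair; ring.
exists s; rewrite kn xn; split=> //.
  rewrite es; case: H => [[-> -> _]|[-> -> _]].
    rewrite !pos_vert ?(ltnW kn) ?/width //; [|lia..].
    by rewrite ltn_eqF //= /segment /= -natr1; congr pair; ring.
  rewrite !pos_vert ?(ltnW kn) ?/width //; [|lia..].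
  by rewrite eqxx /= /segment /= -natr1; congr pair; ring.
have -> : [set u; v]%SET = [set vert n k x; vert n k' x']%SET.
  by case: H' => [[-> ->]|[-> ->]] //; rewrite finset.setUC.
by case: H => [[-> -> _]|[-> -> _]]; rewrite ?eqxx // ltn_eqF.
Qed.

Lemma edge_neq n V h (u v : 'I_(nodes n)) : edge (grid n V h) u v -> u <> v.
Proof.
rewrite /edge /grid => H e; move: H; rewrite e; case E: grid_arc => [w|//].
by have := grid_arc_gt E; rewrite ltnn.
Qed.

Lemma grid_planar n V h : planar R (edge (grid n V h)).
Proof.
exists (@pos n), (fun u v => segment (pos u) (pos v)); split; first exact: pos_inj.
- move=> u v euv; split.
  + by apply: continuous_subspaceT; apply: segment_continuous.
  + by move=> s t _ _; apply: segment_inj => /pos_inj; apply: edge_neq euv.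
  + by case: (pos u) (pos v) => [a b] [c d]; rewrite /segment /=; congr pair; ring.
  + by case: (pos u) (pos v) => [a b] [c d]; rewrite /segment /=; congr pair; ring.
- move=> u v z t euv tb; have [k [x [d [s [_ sb -> _]]]]] := segment_edge euv tb.
  rewrite /pos; case: d => -[] e1 e2.
    have [] := @nat_frac k (z %/ width n) s 0 ltac:(lra) ltac:(lra); last by lra.
    by move: e1; rewrite mul1r addr0.
  have [] := @nat_frac x (z %% width n) s 0 ltac:(lra) ltac:(lra); last by lra.
  by move: e2; rewrite mul1r addr0.
- move=> u v u' v' t t' euv euv' ne tb tb'.
  have [k [x [d [s [_ sb -> e]]]]] := segment_edge euv tb.
  have [k' [x' [d' [s' [_ sb' -> e']]]]] := segment_edge euv' tb'.
  rewrite e e' in ne.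
  have db (b : bool) (r : R) : 0 < r < 1 -> 0 <= b%:R * r < 1.
    by case: b => /=; rewrite ?mul1r ?mul0r; lra.
  case=> /(nat_frac (db d _ sb) (db d' _ sb')) [ek ed].
  move=> /(nat_frac (db (~~ d) _ sb) (db (~~ d') _ sb')) [ex _].
  move: ne; rewrite ek ex; suff -> : d = d' by rewrite eqxx.
  by move: ed; case: (d) (d') => [] [] //=; rewrite ?mul1r ?mul0r; lra.
Qed.

End Planarity.

(** * Distances in the grid *)

Definition reach (n : nat) (g : wgraph n) (x y : 'I_n) (d : Z) : Prop :=
  exists p, [/\ walk g x p, last x p = y & wlen g x p = d].

Lemma wlen_cat n (g : wgraph n) x p q :
  wlen g x (p ++ q) = (wlen g x p + wlen g (last x p) q)%ZZ.
Proof. elim: p x => [|y p IH] x //=; rewrite IH; lia. Qed.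

Lemma reach_refl n (g : wgraph n) x : reach g x x 0.
Proof. by exists [::]. Qed.

Lemma reach_trans n (g : wgraph n) x y z d d' :
  reach g x y d -> reach g y z d' -> reach g x z (d + d')%ZZ.
Proof.
move=> [p [w1 l1 e1]] [q [w2 l2 e2]]; exists (p ++ q); split.
- by rewrite /walk cat_path l1; apply/andP.
- by rewrite last_cat l1.
- by rewrite wlen_cat l1 e1 e2.
Qed.

Lemma reach_edge n (g : wgraph n) x y d : g x y = Some d -> reach g x y d.
Proof.
move=> e; exists [:: y]; split=> //; first by rewrite /walk /= /edge e.
by rewrite /= e /=; lia.
Qed.

(** Weak duality: the increments of [phi] telescope along the walk. *)
Lemma wlen_potential n (g : wgraph n) (phi : 'I_n -> Z) x p :
  (forall u v w, g u v = Some w -> (phi v - phi u <= w)%ZZ) ->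
  walk g x p -> (phi (last x p) - phi x <= wlen g x p)%ZZ.
Proof.
move=> H; elim: p x => [|y p IH] x /=; first by lia.
rewrite /walk /= /edge; case E: (g x y) => [w|//] /= /IH.
by have := H _ _ _ E; lia.
Qed.

Lemma reach_ver n V h r d x : r + d <= n -> x < n.*2 ->
  reach (grid n V h) (vert n r x) (vert n (r + d) x) (Z.of_nat d * V)%ZZ.
Proof.
elim: d => [|d IH] le lt; first by rewrite addn0; apply: reach_refl.
have -> : (Z.of_nat d.+1 * V = Z.of_nat d * V + V)%ZZ by lia.
rewrite addnS; apply: reach_trans (IH _ lt) _; first by lia.
by apply: reach_edge; apply: grid_ver => //; lia.
Qed.

Lemma reach_hor n V h k x d (f : nat -> Z) : k < n -> x + d <= n.*2 ->
  (forall x', x <= x' < x + d -> h k x' = (f x'.+1 - f x')%ZZ) ->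
  reach (grid n V h) (vert n k x) (vert n k (x + d)) (f (x + d)%N - f x)%ZZ.
Proof.
move=> kn; elim: d => [|d IH] le Hh; first by rewrite addn0 Z.sub_diag; apply: reach_refl.
have -> : (f (x + d.+1)%N - f x = (f (x + d)%N - f x) + (f (x + d)%N.+1 - f (x + d)%N))%ZZ.
  by rewrite addnS; lia.
rewrite [x + d.+1]addnS; apply: reach_trans; first apply: IH; first by lia.
  by move=> x' H; apply: Hh; lia.
by apply: reach_edge; rewrite -Hh ?grid_hor //; lia.
Qed.

(** * Weights for one min-plus product, and the distances they produce *)

Section Product.
Variables (n : nat) (L : Z) (X : nat -> nat -> Z).
Hypothesis (L_gt0 : (0 < L)%ZZ).
Hypothesis (XL : forall i j, i < n -> j < n -> (Z.abs (X i j) <= L)%ZZ).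

Local Notation zn := (Z.of_nat n).
(** One unit of [scale] outweighs four entries of [X], and [vweight] is n units plus four entries;
    both are what [pot_ver] requires. *)
Definition scale := (4 * L)%ZZ.
Definition vweight := (scale * (zn + 1))%ZZ.
Definition Cmid := (scale * zn * zn)%ZZ.

Definition hleft (k x : nat) : Z :=
  (scale * (zn - Z.of_nat k) + X x k - X x.+1 k)%ZZ.
Definition hright (k y : nat) : Z :=
  (scale * (Z.of_nat k + 1) + X k y.+1 - X k y)%ZZ.
Definition hmid (s k : nat) : Z :=
  (Cmid - scale * (Z.of_nat k + 1) * (Z.of_nat s - zn + 1) + X n.-1 k + X k 0%N)%ZZ.

(** Since (n-1-i)(n-k) + j(k+1) = (k+1)(i+j-n+1) + (n-1-i)(n+1), this is the length of the path that
    turns in row k, without its two entries of [X]. It depends neither on k nor on j. The first term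
    is for the n - 1 vertical edges. *)
Definition offset (i : nat) : Z :=
  ((zn - 1) * vweight + Cmid + scale * (zn - 1 - Z.of_nat i) * (zn + 1))%ZZ.

Lemma side_bound q a b : (1 <= q <= zn)%ZZ -> (Z.abs a <= L)%ZZ -> (Z.abs b <= L)%ZZ ->
  (0 <= scale * q + a - b <= 2 * scale * zn * zn + Cmid)%ZZ.
Proof.
move=> qn ha hb; rewrite /Cmid /scale.
have : (L <= L * q)%ZZ by nia.
have : (L * q <= L * zn)%ZZ by nia.
have : (L * zn <= L * zn * zn)%ZZ by nia.
lia.
Qed.

Lemma hleft_bound k x : k < n -> x.+1 < n ->
  (0 <= hleft k x <= 2 * scale * zn * zn + Cmid)%ZZ.
Proof.
move=> kn xn; apply: side_bound; first by lia.
  by apply: XL => //; lia.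
exact: XL.
Qed.

Lemma hright_bound k y : k < n -> y.+1 < n ->
  (0 <= hright k y <= 2 * scale * zn * zn + Cmid)%ZZ.
Proof.
move=> kn yn; apply: side_bound; first by lia.
  exact: XL.
by apply: XL => //; lia.
Qed.

(** The product (k+1)(s-n+1) is at most n(n-1) in absolute value, so [Cmid] leaves at least
    [scale * n] - 2L >= 2L. A lower bound 0 would not do: 2L is what [pot_hor] uses for the middle
    edge taken from right to left. *)
Lemma hmid_bound s k : k < n -> s < 2 * n - 1 ->
  (2 * L <= hmid s k <= 2 * scale * zn * zn + Cmid)%ZZ.
Proof.
move=> kn sn; rewrite /hmid /Cmid /scale.
have n0 : n.-1 < n by lia.
have n1 : 0 < n by lia.
have := XL n0 kn; have := XL kn n1; move: (X _ _) (X _ _) => a b Ha Hb.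
have : (Z.of_nat s - zn + 1 <= zn - 1)%ZZ by lia.
have : (1 - zn <= Z.of_nat s - zn + 1)%ZZ by lia.
move: (Z.of_nat s - zn + 1)%ZZ => t t1 t2.
have : (1 <= Z.of_nat k + 1 <= zn)%ZZ by lia.
move: (Z.of_nat k + 1)%ZZ => q q1.
have : (- (zn * (zn - 1)) <= q * t <= zn * (zn - 1))%ZZ by nia.
have -> : (4 * L * q * t = 4 * L * (q * t))%ZZ by lia.
move: (q * t)%ZZ => r r1.
have : (4 * L * r <= 4 * L * (zn * (zn - 1)))%ZZ by nia.
have : (- (4 * L * (zn * (zn - 1))) <= 4 * L * r)%ZZ by nia.
have : (L <= L * zn)%ZZ by nia.
have : (L * zn <= L * zn * zn)%ZZ by nia.
nia.
Qed.

Section Distance.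
Variables (h : nat -> nat -> Z) (i j : nat).
Hypothesis (i_n : i < n) (j_n : j < n).
Hypothesis h_left : forall k x, k < n -> x.+1 < n -> h k x = hleft k x.
Hypothesis h_right : forall k y, k < n -> y.+1 < n -> h k (n + y) = hright k y.
Hypothesis h_mid : forall k, k < n -> h k n.-1 = hmid (i + j) k.
Hypothesis h_ge0 : forall k x, (0 <= h k x)%ZZ.

Lemma reach_turn k : k < n -> reach (grid n vweight h) (vert n 0 i) (vert n n.-1 (n + j))
  (offset i + (X i k + X k j))%ZZ.
Proof.
move=> kn.
(* Primitives of the weights of row k; [f'] is shifted because column n + y of the grid carries the
   index y of [X]. *)
pose f x := (scale * (zn - Z.of_nat k) * Z.of_nat x - X x k)%ZZ.
pose f' x := (scale * (Z.of_nat k + 1) * Z.of_nat x + X k (x - n)%N)%ZZ.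
have r1 : reach (grid n vweight h) (vert n 0 i) (vert n k i) (Z.of_nat k * vweight)%ZZ.
  by apply: (@reach_ver _ _ _ 0); lia.
have r2 : reach (grid n vweight h) (vert n k i) (vert n k n.-1) (f n.-1 - f i)%ZZ.
  have e : n.-1 = i + (n.-1 - i) by lia.
  rewrite e; apply: reach_hor => //; first by lia.
  by move=> x' H; rewrite h_left //; [rewrite /hleft /f; lia|lia].
have r3 : reach (grid n vweight h) (vert n k n.-1) (vert n k n) (hmid (i + j) k).
  apply: reach_edge; rewrite -h_mid //.
  have := @grid_hor n vweight h k n.-1 kn; rewrite prednK; last by lia.
  by apply; lia.
have r4 : reach (grid n vweight h) (vert n k n) (vert n k (n + j)) (f' (n + j)%N - f' n)%ZZ.
  apply: reach_hor => //; first by lia.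
  move=> x' H; have -> : x' = n + (x' - n) by lia.
  rewrite h_right //; last by lia.
  rewrite /hright /f' -addnS !addKn; lia.
have r5 : reach (grid n vweight h) (vert n k (n + j)) (vert n n.-1 (n + j))
    (Z.of_nat (n.-1 - k) * vweight)%ZZ.
  have e : n.-1 = k + (n.-1 - k) by lia.
  by rewrite {1}e; apply: reach_ver; lia.
have := reach_trans r1 (reach_trans r2 (reach_trans r3 (reach_trans r4 r5))).
congr reach; rewrite /offset /f /f' /hmid addKn subnn.
have -> : Z.of_nat n.-1 = (zn - 1)%ZZ by lia.
have -> : Z.of_nat (n.-1 - k) = (zn - 1 - Z.of_nat k)%ZZ by lia.
have -> : Z.of_nat (i + j) = (Z.of_nat i + Z.of_nat j)%ZZ by lia.
have -> : Z.of_nat (n + j) = (zn + Z.of_nat j)%ZZ by lia.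
rewrite /vweight; move: scale Cmid (X _ _) (X _ _) (X _ _) (X _ _) => *; lia.
Qed.

(* A potential that no edge raises by more than its weight: the distance from [(0, i)]
   in the left half, and [T] minus the distance to [(n - 1, n + j)] in the right half.
   It rises by [T] from [(0, i)] to [(n - 1, n + j)], so the distance is at least [T]. *)
Definition pot (T : Z) (r x : nat) : Z :=
  if x < n then
    (Z.of_nat r * vweight +
     if (i <= x)%N then scale * (zn - Z.of_nat r) * (Z.of_nat x - Z.of_nat i) + X i r - X x r
     else 0)%ZZ
  else
    (T - (zn - 1 - Z.of_nat r) * vweight -
     let y := (x - n)%N in
     if (y <= j)%N then scale * (Z.of_nat r + 1) * (Z.of_nat j - Z.of_nat y) + X r j - X r y
     else 0)%ZZ.

(** Inside a half the change is 0 or the weight. [T] matters only at the middle edge of row r, where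
    the rise is [hmid] minus the excess of [offset i + X i r + X r j] over [T]. The excess is
    nonnegative by the first assumption on [T], and at most 4L, twice the least middle weight, by
    the second. *)
Lemma pot_hor T r x : r < n -> x < n.*2 ->
  (forall k, k < n -> (T <= offset i + (X i k + X k j))%ZZ) ->
  (offset i - 2 * L <= T)%ZZ ->
  (Z.abs (pot T r x.+1 - pot T r x) <= h r x)%ZZ.
Proof.
move=> rn xn T_le T_ge; rewrite /pot.
case: (ltngtP x.+1 n) => Hx.
- have Hx' : x < n by lia.
  rewrite h_left // /hleft.
  have x1 := XL Hx' rn; have x2 := XL Hx rn.
  have hb := hleft_bound rn Hx; rewrite /hleft in hb.
  case: (leqP i x) => ix.
    rewrite (leq_trans ix) //; move: hb.
    have -> : Z.of_nat x.+1 = (Z.of_nat x + 1)%ZZ by lia.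
    move: scale => m; nia.
  case: leqP => ix'; last by lia.
  have <- : x.+1 = i by lia.
  move: hb; move: scale => m; nia.
- have -> : x = n + (x - n) by lia.
  move: (x - n)%N (ltac:(lia) : x - n < n)%N => y yn.
  rewrite -addnS !addKn.
  case: (ltnP y.+1 n) => yn'.
    rewrite h_right // /hright.
    have x1 := XL rn yn; have x2 := XL rn yn'; have x3 := XL rn j_n.
    have hb := hright_bound rn yn'; rewrite /hright in hb.
    case: (leqP y.+1 j) => yj.
      rewrite (ltnW yj); move: hb; have -> : Z.of_nat y.+1 = (Z.of_nat y + 1)%ZZ by lia.
      by move: scale => m; nia.
    case: leqP => yj'; last by move: hb; lia.
    have -> : j = y by lia.
    by move: hb; move: scale => m; nia.
  (* About the edge into the extra column only nonnegativity is known; the potential is equal at its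
     two ends. *)
  have H := @h_ge0 r (n + y).
  rewrite ifF; last by lia.
  case: leqP => yj; last by lia.
  have -> : j = y by lia.
  by move: scale => m; nia.
- have -> : x = n.-1 by lia.
  rewrite h_mid // prednK; last by lia.
  rewrite subnn leq0n.
  have -> : i <= n.-1 by lia.
  have hb := @hmid_bound (i + j) r rn (ltac:(lia)).
  have := T_le r rn; move: T_ge; move: hb; rewrite /offset /hmid.
  have := XL i_n rn; have := XL rn j_n.
  have -> : Z.of_nat n.-1 = (zn - 1)%ZZ by lia.
  have -> : Z.of_nat (i + j) = (Z.of_nat i + Z.of_nat j)%ZZ by lia.
  rewrite /vweight; move: scale Cmid (X _ _) (X _ _) (X _ _) (X _ _) => *; lia.
Qed.

Lemma pot_ver T r x : r.+1 < n -> x < n.*2 ->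
  (Z.abs (pot T r.+1 x - pot T r x) <= vweight)%ZZ.
Proof.
(* Going down one row takes q units of [scale] off the increase [vweight], up to four entries of
   [X]. Here q is the distance of the column from i or from the column of j, so 1 <= q <= n, and the
   amount lies between 0 and [vweight]. For q = 0 the entries cancel, which is treated apart. *)
have key q a b c d t : (0 < q <= zn)%ZZ -> (Z.abs a <= L)%ZZ -> (Z.abs b <= L)%ZZ ->
    (Z.abs c <= L)%ZZ -> (Z.abs d <= L)%ZZ -> t = (vweight - (scale * q + a + b - c - d))%ZZ ->
    (Z.abs t <= vweight)%ZZ.
  move=> q1 ha hb hc hd ->; rewrite /vweight /scale; nia.
have v0 : (0 <= vweight)%ZZ by rewrite /vweight /scale; nia.
move=> rn xn; have rn' : r < n by lia.
rewrite /pot; case: ifP => Hx.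
  case: (ltngtP i x) => ix; try by lia.
    apply: (key (Z.of_nat x - Z.of_nat i)%ZZ (X i r) (X x r.+1) (X i r.+1) (X x r));
      try exact: XL; try lia.
  rewrite ix Z.sub_diag !Z.mul_0_r.
  have -> : Z.of_nat r.+1 = (Z.of_nat r + 1)%ZZ by lia.
  by move: v0; move: vweight => v; lia.
case: (ltngtP (x - n) j) => ix; try by lia.
  apply: (key (Z.of_nat j - Z.of_nat (x - n)%N)%ZZ (X r.+1 j) (X r (x - n)%N) (X r j) (X r.+1
    (x - n)%N)); try (apply: XL; lia); try lia.
rewrite ix Z.sub_diag !Z.mul_0_r.
have -> : Z.of_nat r.+1 = (Z.of_nat r + 1)%ZZ by lia.
by move: v0; move: vweight => v; lia.
Qed.

Lemma grid_dist T k0 : k0 < n -> T = (X i k0 + X k0 j)%ZZ ->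
  (forall k, k < n -> (T <= X i k + X k j)%ZZ) ->
  is_dist (grid n vweight h) (vert n 0 i) (vert n n.-1 (n + j)) (Some (offset i + T)%ZZ).
Proof.
move=> kn eT minT; split; first by rewrite eT; apply: reach_turn.
move=> p wp lp.
have H1 k : k < n -> (offset i + T <= offset i + (X i k + X k j))%ZZ by move/minT; lia.
have H2 : (offset i - 2 * L <= offset i + T)%ZZ.
  by have := XL i_n kn; have := XL kn j_n; lia.
(* Row n gets the potential of row n - 1, so the dead ends in the extra row cause no change at
   all. *)
pose phi (u : 'I_(nodes n)) := pot (offset i + T) (minn (u %/ width n) n.-1) (u %% width n).
have phiE k x : k <= n -> x < width n -> phi (vert n k x) = pot (offset i + T) (minn k n.-1) x.
  by move=> kn' xw; rewrite /phi val_vert // divw // modw.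
have lip u v w : grid n vweight h u v = Some w -> (phi v - phi u <= w)%ZZ.
  case/grid_edgeP => k [x [k' [x' [[kn' xn H] H']]]].
  have xw : x < width n by rewrite /width; lia.
  have xw' : x.+1 < width n by rewrite /width; lia.
  suff : (Z.abs (phi (vert n k' x') - phi (vert n k x)) <= w)%ZZ.
    by case: H' => [[-> ->]|[-> ->]]; lia.
  case: H => [[-> -> ->]|[-> -> ->]]; rewrite !phiE ?(ltnW kn') //.
    have -> : minn k n.-1 = k by lia.
    exact: pot_hor.
  case: (ltnP k.+1 n) => kn''.
    have -> : minn k n.-1 = k by lia.
    have -> : minn k.+1 n.-1 = k.+1 by lia.
    exact: pot_ver.
  have -> : minn k.+1 n.-1 = minn k n.-1 by lia.
  by rewrite /vweight /scale; nia.
have := wlen_potential lip wp; rewrite lp !phiE; try (rewrite /width; lia).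
rewrite min0n minnn /pot i_n leqnn ifF ?addKn ?leqnn; last by lia.
have -> : Z.of_nat n.-1 = (zn - 1)%ZZ by lia.
lia.
Qed.

End Distance.
End Product.

(** * Shortest paths by repeated min-plus squaring *)

(** Nodes are added at the front; if the new one already occurs, the closed walk back to it is
    removed, and its weight is nonnegative. *)
Lemma walk_uniq n (g : wgraph n) x p : no_negative_cycle g -> walk g x p ->
  exists q, [/\ walk g x q, last x q = last x p, (wlen g x q <= wlen g x p)%ZZ &
    uniq (x :: q)].
Proof.
move=> nn; elim: p x => [|y p IH] x; first by move=> _; exists [::]; split=> //; lia.
rewrite /walk /= => /andP [exy /IH [q [wq lq le uq]]].
case: (boolP (x \in y :: q)) => [xq|nxq]; last first.
  exists (y :: q); split=> //=; [by rewrite exy|lia|by move: nxq uq => /= -> ->].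
have wyq : walk g x (y :: q) by rewrite /walk /= exy.
have lyq : last x (y :: q) = last y p by [].
have eyq : (wlen g x (y :: q) <= wlen g x (y :: p))%ZZ by rewrite /=; lia.
move: xq wyq lyq eyq uq; move: (y :: q) => s /path.splitPr [r1 r2].
rewrite -cat_rcons => ws ls es us; exists r2.
have lr : last x (rcons r1 x) = x by rewrite last_rcons.
move: ws ls es us; rewrite /walk cat_path last_cat wlen_cat cat_uniq lr => /andP [w1 w2] ls es.
have := nn x (rcons r1 x) w1 lr => cyc; case/and3P => _ hs us.
split=> //; first by move: es cyc; rewrite /=; lia.
rewrite /= us andbT; apply/negP => xr; move/hasP: hs; apply; exists x => //.
by rewrite /= mem_rcons inE eqxx.
Qed.

Section MinPlus.
Variables (n : nat) (g : wgraph n) (W : Z).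
Local Notation L := (4 * Z.of_nat n * W)%ZZ.
Hypothesis W_gt0 : (0 < W)%ZZ.
Hypothesis gW : forall x y w, g x y = Some w -> (Z.abs w <= W)%ZZ.
Hypothesis nn : no_negative_cycle g.

Lemma wlen_bound x p : walk g x p -> (Z.abs (wlen g x p) <= Z.of_nat (size p) * W)%ZZ.
Proof.
elim: p x => [|y p IH] x //; rewrite /walk.
have -> : Z.of_nat (size (y :: p)) = (Z.of_nat (size p) + 1)%ZZ by rewrite /=; lia.
rewrite /= /edge; case E: (g x y) => [w|//] /= /IH; have := gW E; lia.
Qed.

(* Missing edges have weight [L], too much for any shortest path. *)
Definition walks_upto (len : nat) (X : nat -> nat -> Z) : Prop :=
  [/\ forall i j : 'I_n,
        (exists p, [/\ walk g i p, last i p = j, wlen g i p = X i j & size p <= len]) \/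
        (L - Z.of_nat len * W <= X i j)%ZZ,
      forall (i j : 'I_n) p, walk g i p -> last i p = j -> size p <= len ->
        (X i j <= wlen g i p)%ZZ,
      forall i j : 'I_n, (X i j <= L)%ZZ &
      forall i : 'I_n, (X i i <= 0)%ZZ].

Lemma walks_upto_ge len (X : nat -> nat -> Z) (i j : 'I_n) : walks_upto len X ->
  (- Z.of_nat len * W <= X i j)%ZZ.
Proof.
case=> H _ _ _; case: (H i j) => [[p [wp _ <- sp]]|]; last by nia.
by have := wlen_bound wp; nia.
Qed.

Lemma walks_upto_abs len (X : nat -> nat -> Z) (i j : 'I_n) : len < 4 * n -> walks_upto len X ->
  (Z.abs (X i j) <= L)%ZZ.
Proof.
move=> ln wX; have := @walks_upto_ge _ _ i j wX; case: wX => _ _ /(_ i j) le _.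
have : (Z.of_nat len * W <= L)%ZZ by nia.
lia.
Qed.

Lemma walks_upto1 (X : nat -> nat -> Z) :
  (forall i j : 'I_n, X i j = if i == j then 0%ZZ else odflt L (g i j)) ->
  walks_upto 1 X.
Proof.
move=> HX; split=> [i j|i j|i j|i].
- rewrite HX; case: eqP => [->|ne]; first by left; exists [::].
  case E: (g i j) => [w|]; last by right; have -> : odflt L None = L by []; lia.
  by left; exists [:: j]; rewrite /walk /= /edge E; split=> //=; lia.
- case=> [|y [|z p]] //= wp <- _; rewrite HX; first by rewrite eqxx; lia.
  case: eqP => [e|ne].
    (* A loop has nonnegative weight, so the 0 on the diagonal does not exceed it. *)
    by have H := @nn i [:: y] wp; rewrite e /= in H *; apply: H.
  by move: wp; rewrite /walk /= /edge; case: (g i y) => //= w _; lia.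
- have := ltn_ord i => lt; rewrite HX; case: eqP => _; first by nia.
  by case E: (g i j) => [w|]; [have := gW E; have -> : odflt L (Some w) = w by [];
    nia|have -> : odflt L None = L by []; lia].
- by rewrite HX eqxx; lia.
Qed.

(** The nonpositive diagonal gives Y <= X, which keeps the entries at most L in all rounds. If a
    summand is not the length of a walk, it is at least L - len W, and the other one takes off at
    most another len W. *)
Lemma walks_upto_double len (X Y : nat -> nat -> Z) : walks_upto len X ->
  (forall i j : 'I_n, (exists k : 'I_n, Y i j = (X i k + X k j)%ZZ) /\
     forall k : 'I_n, (Y i j <= X i k + X k j)%ZZ) ->
  walks_upto (len + len) Y.
Proof.
move=> wX HY; have ge i j := @walks_upto_ge _ _ i j wX; case: wX => H1 H2 H3 H4; split.
- move=> i j; case: (HY i j) => [[k ->] _].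
  have := ge i k; have := ge k j => g1 g2.
  case: (H1 i k) => [[p [wp lp ep sp]]|]; last by right; lia.
  case: (H1 k j) => [[q [wq lq eq sq]]|]; last by right; lia.
  left; exists (p ++ q); split.
  + by rewrite /walk cat_path lp; apply/andP.
  + by rewrite last_cat lp.
  + by rewrite wlen_cat lp ep eq.
  + by rewrite size_cat; lia.
- move=> i j p wp lp sp.
  move: wp lp; rewrite -(cat_take_drop len p) /walk cat_path last_cat wlen_cat.
  set k := last i (take len p) => /andP [w1 w2] l2.
  have s1 : size (take len p) <= len by rewrite size_take_min; lia.
  have s2 : size (drop len p) <= len by rewrite size_drop; lia.
  have := H2 i k _ w1 erefl s1; have := H2 k j _ w2 l2 s2; have [_ /(_ k)] := HY i j; lia.
- by move=> i j; have [_ /(_ i)] := HY i j; have := H3 i j; have := H4 i; lia.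
- by move=> i; have [_ /(_ i)] := HY i i; have := H4 i; lia.
Qed.

(** Simple walks have fewer than n edges, so finite distances are at most nW, while entries that are
    not lengths of walks are at least 4nW - len W > 2nW. The threshold nW + 1 separates them. *)
Lemma walks_upto_dist len (X : nat -> nat -> Z) (i j : 'I_n) : n <= len -> len < 2 * n ->
  walks_upto len X ->
  is_dist g i j (if (X i j <? Z.of_nat n * W + 1)%ZZ then Some (X i j) else None).
Proof.
move=> le1 le2 [H1 H2 H3 H4].
have short p : walk g i p -> last i p = j ->
    (X i j <= wlen g i p)%ZZ /\ (X i j <= Z.of_nat n * W)%ZZ.
  move=> wp lp; have [q [wq lq le uq]] := walk_uniq nn wp.
  have sq : size q < n.
    by move/card_uniqP: uq => /= <-; rewrite -[X in _ <= X]card_ord; apply: max_card.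
  have := H2 i j q wq (etrans lq lp) (ltac:(lia)); have := wlen_bound wq; split; first lia.
  by nia.
case: Z.ltb_spec => [lt|ge] /=; last by move=> p wp lp; have := short p wp lp; lia.
split; last by move=> p wp /(short p wp) [].
case: (H1 i j) => [[p [wp lp ep _]]|]; first by exists p.
have := ltn_ord i; nia.
Qed.

End MinPlus.

(** * Hoare rules *)

Notation "a +' b" := (Bin APlus a b) (at level 50, left associativity).
Notation "a -' b" := (Bin AMinus a b) (at level 50, left associativity).
Notation "a *' b" := (Bin ATimes a b) (at level 40, left associativity).
Notation "c1 ;; c2" := (CSeq c1 c2) (at level 60, right associativity).

Definition CFor (v : nat) (e : expr) (c : cmd) : cmd :=
  CAsg v (Cst 0) ;; CWhile (Var v) e (c ;; CAsg v (Var v +' Cst 1)).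

Section Triples.
Variables (n c' : nat) (B V : Z) (lim : nat).
Hypothesis B_gt0 : (0 < B)%ZZ.

(** Total correctness with a time bound. The operations are left existential: their legality and
    number follow from [ev], whatever they are. *)
Definition tri (c : cmd) (s : astate) (k : nat) (Q : astate -> Prop) : Prop :=
  exists t ops s', [/\ ev n c' B V lim c s t ops s', t <= k & Q s'].

Lemma tri_le c s k k' (Q Q' : astate -> Prop) : tri c s k Q -> k <= k' ->
  (forall s', Q s' -> Q' s') -> tri c s k' Q'.
Proof.
move=> [t [ops [s' [e le q]]]] kk H; exists t, ops, s'; split=> //; [lia|exact: H].
Qed.

Lemma tri_skip s (Q : astate -> Prop) : Q s -> tri CSkip s 0 Q.
Proof. by move=> q; exists 0, [::], s; split=> //; constructor. Qed.

Lemma tri_asg v e s (Q : astate -> Prop) : small B (var s) e ->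
  Q (set_var s v (eval (var s) e)) -> tri (CAsg v e) s 1 Q.
Proof. by move=> sm q; exists 1, [::], (set_var s v (eval (var s) e)); split=> //;
  constructor. Qed.

Lemma tri_load a v e s (Q : astate -> Prop) : small B (var s) e ->
  eval (var s) e = Z.of_nat a -> a < lim -> (Z.abs (mem s a) <= B)%ZZ ->
  Q (set_var s v (mem s a)) -> tri (CLoad v e) s 1 Q.
Proof.
move=> sm ea al ab q; exists 1, [::], (set_var s v (mem s a)); split=> //.
exact: ev_load ea al ab.
Qed.

Lemma tri_store a ea e s (Q : astate -> Prop) : small B (var s) ea -> small B (var s) e ->
  eval (var s) ea = Z.of_nat a -> a < lim ->
  Q (set_mem s a (eval (var s) e)) -> tri (CStore ea e) s 1 Q.
Proof.
move=> sm1 sm2 Ea al q; exists 1, [::], (set_mem s a (eval (var s) e)); split=> //.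
exact: ev_store Ea al.
Qed.

Lemma tri_seq c1 c2 s k1 k2 (Q : astate -> Prop) :
  tri c1 s k1 (fun s1 => tri c2 s1 k2 Q) -> tri (c1 ;; c2) s (k1 + k2) Q.
Proof.
move=> [t1 [ops1 [s1 [e1 le1 [t2 [ops2 [s2 [e2 le2 q]]]]]]]].
by exists (t1 + t2), (ops1 ++ ops2), s2; split=> //; [apply: ev_seq e1 e2|lia].
Qed.

Lemma tri_if a b c1 c2 s k (Q : astate -> Prop) : small B (var s) a -> small B (var s) b ->
  ((eval (var s) a < eval (var s) b)%ZZ -> tri c1 s k Q) ->
  ((eval (var s) b <= eval (var s) a)%ZZ -> tri c2 s k Q) ->
  tri (CIf a b c1 c2) s k.+1 Q.
Proof.
move=> sm1 sm2 H1 H2.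
have [t [ops [s' [e le q]]]] : tri (if (eval (var s) a <? eval (var s) b)%ZZ then c1 else c2)
  s k Q.
  by case: Z.ltb_spec.
by exists t.+1, ops, s'; split=> //; apply: ev_if.
Qed.

Lemma tri_while_stop a b c s (Q : astate -> Prop) : small B (var s) a -> small B (var s) b ->
  (eval (var s) b <= eval (var s) a)%ZZ -> Q s -> tri (CWhile a b c) s 1 Q.
Proof. by move=> sm1 sm2 le q; exists 1, [::], s; split=> //; apply: ev_while_stop. Qed.

Lemma tri_while_step a b c s k1 k2 (Q : astate -> Prop) :
  small B (var s) a -> small B (var s) b ->
  (eval (var s) a < eval (var s) b)%ZZ ->
  tri c s k1 (fun s1 => tri (CWhile a b c) s1 k2 Q) -> tri (CWhile a b c) s (k1 + k2).+1 Q.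
Proof.
move=> sm1 sm2 lt [t1 [ops1 [s1 [e1 le1 [t2 [ops2 [s2 [e2 le2 q]]]]]]]].
by exists (t1 + t2).+1, (ops1 ++ ops2), s2; split=> //; [apply: ev_while_step e1 e2|lia].
Qed.

(** Each round adds a test and an increment to the body; the initialization and the last test are
    the remaining 2. *)
Lemma tri_for m (I : nat -> astate -> Prop) v e c s k (Q : astate -> Prop) :
  (Z.of_nat m <= B)%ZZ ->
  (forall i s', i <= m -> I i s' -> var s' v = Z.of_nat i ->
     small B (var s') e /\ eval (var s') e = Z.of_nat m) ->
  I 0 (set_var s v 0) ->
  (forall i s', i < m -> I i s' -> var s' v = Z.of_nat i ->
     tri c s' k (fun s'' => var s'' v = Z.of_nat i /\
                            I i.+1 (set_var s'' v (Z.of_nat i.+1)))) ->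
  (forall s', I m s' -> Q s') ->
  tri (CFor v e c) s (m * k.+2 + 2) Q.
Proof.
move=> mB He I0 Hc HQ.
suff H j i s' : m = i + j -> I i s' -> var s' v = Z.of_nat i ->
    tri (CWhile (Var v) e (c ;; CAsg v (Var v +' Cst 1))) s' (j * k.+2 + 1) Q.
  apply: (@tri_le _ _ (1 + (m * k.+2 + 1)) _ Q) => //; last by lia.
  apply: tri_seq; apply: tri_asg; first by rewrite /=; lia.
  by apply: (H m 0) => //; rewrite /= /upd eqxx.
elim: j i s' => [|j IH] i s' em Ii vi.
  have [sm ee] := He i s' (ltac:(lia)) Ii vi.
  apply: tri_while_stop => //=; [lia|rewrite ee; lia|].
  by apply: HQ; rewrite em addn0.
have [sm ee] := He i s' (ltac:(lia)) Ii vi.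
apply: (@tri_le _ _ ((k + 1) + (j * k.+2 + 1)).+1 _ Q) => //; last by lia.
apply: tri_while_step => //=; [lia|rewrite ee; lia|].
apply: tri_seq; apply: tri_le (Hc i s' (ltac:(lia)) Ii vi) (leqnn k) _ => s'' [v'' I''].
apply: tri_asg; first by rewrite /=; lia.
have -> : eval (var s'') (Var v +' Cst 1) = Z.of_nat i.+1 by rewrite /= v''; lia.
apply: (IH i.+1) => //; first by rewrite em addnS addSn.
by rewrite /= /upd eqxx.
Qed.

End Triples.
Arguments tri n c' B V lim c s k Q : clear implicits.

Fixpoint minz (f : nat -> Z) (m : nat) : Z :=
  if m is m'.+1 then Z.min (f m) (minz f m') else f 0%N.

Lemma minz_le f m k : k <= m -> (minz f m <= f k)%ZZ.
Proof.
elim: m => [|m IH] /=; first by case: k => // _; lia.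
rewrite leq_eqVlt => /predU1P [->|]; first by lia.
by rewrite ltnS => /IH; lia.
Qed.

Lemma minz_ex f m : exists2 k, k <= m & minz f m = f k.
Proof.
elim: m => [|m [k le e]]; first by exists 0.
case: (Z.min_spec (f m.+1) (minz f m)) => -[_ H].
  by exists m.+1.
by exists k; [lia|rewrite /= H].
Qed.

Definition minplus (n : nat) (X : nat -> nat -> Z) (i j : nat) : Z :=
  minz (fun k => (X i k + X k j)%ZZ) n.-1.

(** * Squaring a matrix *)

Local Arguments Z.add : simpl never.
Local Arguments Z.sub : simpl never.
Local Arguments Z.mul : simpl never.
Local Arguments Z.of_nat : simpl never.

(* Variables 0 to 6 hold n, W, L, [scale L], [vweight n L], [Cmid n L] and the number
   of edges that walks may have so far; the others are counters and temporaries.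
   Entry (i, j) of the current matrix is in cell 2(in + j) + 1, that of the next one
   in cell 2(in + j). *)
Definition cell_new (i j : expr) : expr := Cst 2 *' (i *' Var 0 +' j).
Definition cell_cur (i j : expr) : expr := cell_new i j +' Cst 1.
Definition node (k x : expr) : expr := k *' (Cst 2 *' Var 0 +' Cst 1) +' x.

Definition set_sides : cmd :=
  CFor 7 (Var 0) (CFor 8 (Var 0 -' Cst 1) (
    CLoad 10 (cell_cur (Var 8) (Var 7)) ;;
    CLoad 11 (cell_cur (Var 8 +' Cst 1) (Var 7)) ;;
    CChange (node (Var 7) (Var 8)) (node (Var 7) (Var 8 +' Cst 1))
      (Var 3 *' (Var 0 -' Var 7) +' Var 10 -' Var 11) ;;
    CLoad 10 (cell_cur (Var 7) (Var 8 +' Cst 1)) ;;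
    CLoad 11 (cell_cur (Var 7) (Var 8)) ;;
    CChange (node (Var 7) (Var 0 +' Var 8)) (node (Var 7) (Var 0 +' Var 8 +' Cst 1))
      (Var 3 *' (Var 7 +' Cst 1) +' Var 10 -' Var 11))).

Definition set_middle : cmd :=
  CFor 7 (Var 0) (
    CLoad 10 (cell_cur (Var 0 -' Cst 1) (Var 7)) ;;
    CLoad 11 (cell_cur (Var 7) (Cst 0)) ;;
    CChange (node (Var 7) (Var 0 -' Cst 1)) (node (Var 7) (Var 0))
      (Var 5 -' Var 3 *' (Var 7 +' Cst 1) *' (Var 9 -' Var 0 +' Cst 1) +' Var 10 +' Var 11)).

(** Variable 9 holds the sum t = i + j. The two tests keep exactly those i for which j = t - i lies
    between 0 and n - 1. *)
Definition query_all : cmd :=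
  CFor 7 (Var 0) (
    CIf (Var 7) (Var 9 +' Cst 1) (CIf (Var 9) (Var 7 +' Var 0) (
      CQuery 10 (Var 7) (node (Var 0 -' Cst 1) (Var 0 +' (Var 9 -' Var 7))) ;;
      CStore (cell_new (Var 7) (Var 9 -' Var 7))
        (Var 10 -' ((Var 0 -' Cst 1) *' Var 4 +' Var 5 +'
           Var 3 *' (Var 0 -' Cst 1 -' Var 7) *' (Var 0 +' Cst 1)))) CSkip) CSkip).

(** The product is moved only at the end, as the middle weights of every round are computed from the
    old matrix. *)
Definition copy_back : cmd :=
  CFor 12 (Var 0 *' Var 0) (
    CLoad 10 (Cst 2 *' Var 12) ;; CStore (Cst 2 *' Var 12 +' Cst 1) (Var 10)).

Definition square : cmd :=
  set_sides ;; CFor 9 (Cst 2 *' Var 0 -' Cst 1) (set_middle ;; query_all) ;; copy_back.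

Lemma index_lt n i j : i < n -> j < n -> i * n + j < n * n.
Proof. nia. Qed.

Lemma index_inj n i j i' j' : j < n -> j' < n -> i * n + j = i' * n + j' -> i = i' /\ j = j'.
Proof.
move=> lj lj' e; have n_gt0 : 0 < n by lia.
have ei : i = i'.
  by have := congr1 (divn^~ n) e; rewrite !divnMDl // !divn_small // !addn0.
by split=> //; move: e; rewrite ei; lia.
Qed.

Lemma indexE n q : q < n * n -> exists i j, [/\ i < n, j < n & q = i * n + j].
Proof.
move=> lt; have n0 : 0 < n by case: n lt.
exists (q %/ n), (q %% n); split; [by rewrite ltn_divLR|by rewrite ltn_pmod|].
exact: divn_eq.
Qed.

Lemma last_rowE n x : 0 < n ->
  Z.of_nat (n.-1 * width n + x) = ((Z.of_nat n - 1) * (2 * Z.of_nat n + 1) + Z.of_nat x)%ZZ.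
Proof.
move=> n_gt0.
have -> : (Z.of_nat n - 1 = Z.of_nat n.-1)%ZZ by lia.
by rewrite /width; move: (n.-1) => m; lia.
Qed.

(** * Correctness and cost of one squaring *)

Section Verification.
Variables (n c' : nat) (B W : Z).
Local Notation zn := (Z.of_nat n).
Local Notation L := (4 * Z.of_nat n * W)%ZZ.
Local Notation V := (vweight n L).
Local Notation lim := (2 * n ^ 2).
Record inv (len : nat) (X : nat -> nat -> Z) (s : astate) : Prop := Inv {
  inv0 : var s 0 = zn;
  inv1 : var s 1 = W;
  inv2 : var s 2 = L;
  inv3 : var s 3 = scale L;
  inv4 : var s 4 = V;
  inv5 : var s 5 = Cmid n L;
  inv6 : var s 6 = Z.of_nat len;
  inv_mem : forall i j, i < n -> j < n -> mem s (2 * (i * n + j)).+1 = X i j;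
  inv_hor : forall k x, (0 <= hor s k x)%ZZ }.

Lemma inv_set_var len X s v z : 6 < v -> inv len X s -> inv len X (set_var s v z).
Proof.
move=> lt [h0 h1 h2 h3 h4 h5 h6 hm hh].
have ne u : u <= 6 -> upd (var s) v z u = var s u by move=> le; rewrite /upd ifF //; lia.
by split=> //; rewrite /= ne.
Qed.

Lemma inv_set_hor len X s k x w : (0 <= w)%ZZ -> inv len X s -> inv len X (set_hor s k x w).
Proof.
move=> w0 [h0 h1 h2 h3 h4 h5 h6 hm hh]; split=> // k' x'.
by rewrite /= /upd2; case: ifP.
Qed.

Lemma inv_set_mem len X s a z : inv len X s -> inv len X (set_mem s (2 * a) z).
Proof.
move=> [h0 h1 h2 h3 h4 h5 h6 hm hh]; split=> // i j lti ltj.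
by rewrite /= /upd ifF ?hm //; lia.
Qed.

Hypothesis n_gt0 : 0 < n.
Hypothesis W_gt0 : (0 < W)%ZZ.
Hypothesis W_B : (1000 * zn * zn * zn * W <= B)%ZZ.

(** The largest values are distances in the grid, below 60 n^3 W, so the factor 1000 in [W_B] is
    ample. *)
Lemma B_facts : [/\ (1 <= zn)%ZZ, (zn <= zn * zn)%ZZ, (20 * (zn * zn) <= B)%ZZ,
  (0 < W <= B)%ZZ & [/\ (0 < L <= B)%ZZ, (0 < scale L <= B)%ZZ, (0 < V <= B)%ZZ &
  (0 < Cmid n L <= B)%ZZ]].
Proof.
have h1 : (1 <= zn)%ZZ by lia.
have h2 : (zn <= zn * zn)%ZZ by nia.
have h3 : (zn * zn <= zn * zn * zn)%ZZ by nia.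
have h4 : (zn * zn * zn <= zn * zn * zn * W)%ZZ by nia.
have h5 : (W <= zn * W)%ZZ by nia.
have h6 : (zn * W <= zn * zn * W)%ZZ by nia.
have h7 : (zn * zn * W <= zn * zn * zn * W)%ZZ by nia.
rewrite /vweight /Cmid /scale; split; try lia.
by split; lia.
Qed.

Lemma offset_bound i : i < n -> (2 * L <= B - offset n L i)%ZZ /\ (0 <= offset n L i)%ZZ.
Proof.
move=> lt.
have h1 : (1 <= zn)%ZZ by lia.
have h5 : (W <= zn * W)%ZZ by nia.
have h6 : (zn * W <= zn * zn * W)%ZZ by nia.
have h7 : (zn * zn * W <= zn * zn * zn * W)%ZZ by nia.
rewrite /offset /vweight /Cmid /scale.
have : (0 <= zn - 1 - Z.of_nat i <= zn)%ZZ by lia.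
move: (zn - 1 - Z.of_nat i)%ZZ => q hq.
have : (0 <= 4 * (4 * zn * W) * q * (zn + 1) <= 4 * (4 * zn * W) * zn * (zn + 1))%ZZ.
  have : (0 <= 4 * (4 * zn * W) * (zn + 1))%ZZ by lia.
  nia.
have : (0 <= (zn - 1) * (4 * (4 * zn * W) * (zn + 1)) <= zn * (4 * (4 * zn * W) * (zn + 1)))%ZZ.
  have : (0 <= 4 * (4 * zn * W) * (zn + 1))%ZZ by lia.
  nia.
lia.
Qed.

Local Notation tri := (tri n c' B V lim).

Lemma small0 len X s : inv len X s -> (Z.abs (var s 0) <= B)%ZZ.
Proof. by move=> I; have [*] := B_facts; rewrite (inv0 I); lia. Qed.

Lemma tri_load_cell len X s v i j ei ej Q : inv len X s ->
  (Z.abs (X i j) <= L)%ZZ ->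
  small B (var s) ei -> small B (var s) ej ->
  eval (var s) ei = Z.of_nat i -> eval (var s) ej = Z.of_nat j -> i < n -> j < n ->
  Q (set_var s v (X i j)) -> tri (CLoad v (cell_cur ei ej)) s 1 Q.
Proof.
move=> I XL sm1 sm2 e1 e2 lti ltj q; have [h1 h2 h3 h4 [h5 h6 h7 h8]] := B_facts.
have s0 := small0 I.
have l0 := index_lt lti ltj.
apply: (@tri_load _ _ _ _ _ (2 * (i * n + j)).+1).
- by rewrite /=; do ?split=> //; lia.
- by rewrite /= e1 e2 (inv0 I); lia.
- by rewrite -mulnn; lia.
- by rewrite (inv_mem I) //; lia.
- by rewrite (inv_mem I).
Qed.

Hypothesis weight_ok : (2 * scale L * zn * zn + Cmid n L <= Z.of_nat (nodes n ^ c'))%ZZ.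

Lemma tri_change len X s k x ek ex ex' ew w Q : inv len X s ->
  small B (var s) ek -> small B (var s) ex -> small B (var s) ex' -> small B (var s) ew ->
  eval (var s) ek = Z.of_nat k -> eval (var s) ex = Z.of_nat x ->
  eval (var s) ex' = Z.of_nat x.+1 -> eval (var s) ew = w ->
  k < n -> x < n.*2 -> (0 <= w <= 2 * scale L * zn * zn + Cmid n L)%ZZ ->
  Q (set_hor s k x w) -> tri (CChange (node ek ex) (node ek ex') ew) s 1 Q.
Proof.
move=> I sm1 sm2 sm3 sm4 e1 e2 e3 e4 kn xn wb q; have [h1 h2 h3 h4 [h5 h6 h7 h8]] := B_facts.
have s0 := small0 I.
eexists; eexists; exists (set_hor s k x w); split; last exact: q.
  apply: ev_change; try exact: e4; try exact: kn; try exact: xn; try by [].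
  - by rewrite /=; do ?split=> //; lia.
  - by rewrite /=; do ?split=> //; lia.
  - by rewrite /= e1 e2 (inv0 I) /width; lia.
  - by rewrite /= e1 e3 (inv0 I) /width; lia.
  - by move: weight_ok; lia.
by [].
Qed.

Section Square.
Variables (len : nat) (X : nat -> nat -> Z).
Hypothesis XL : forall i j, i < n -> j < n -> (Z.abs (X i j) <= L)%ZZ.

Definition sides_done (k y : nat) (s : astate) : Prop :=
  forall k' y', k' < n -> y'.+1 < n -> k' < k \/ (k' = k /\ y' < y) ->
  hor s k' y' = hleft n L X k' y' /\ hor s k' (n + y') = hright L X k' y'.

Lemma set_sides_correct s : inv len X s ->
  tri set_sides s (40 * (n * n)) (fun s' => inv len X s' /\ sides_done n 0 s').
Proof.
move=> I0; have [h1 h2 h3 h4 [h5 h6 h7 h8]] := B_facts.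
have L0 : (0 < L)%ZZ by lia.
apply: (@tri_le _ _ _ _ _ _ _ (n * ((n.-1 * (6.+2) + 2).+2) + 2)); last by move=> s'; exact: id.
  apply: (@tri_for _ _ _ _ _ _ n (fun k s' => inv len X s' /\ sides_done k 0 s')) => //;
    try lia.
  - by move=> i s' _ [I' _] _; rewrite /= (inv0 I'); lia.
  - split; first exact: inv_set_var.
    by move=> k' y' _ _ [|[_]].
  move=> k s1 kn [I1 S1] v1.
  apply: (@tri_for _ _ _ _ _ _ n.-1
    (fun y s' => [/\ inv len X s', sides_done k y s' & var s' 7 = Z.of_nat k])) => //; try lia.
  - by move=> i s' _ [I' _ _] _; rewrite /= (inv0 I'); lia.
  - by split=> //; apply: inv_set_var.
  - move=> y s2 yn [I2 S2 v2] w2.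
    have yn1 : y < n by lia.
    have yn2 : y.+1 < n by lia.
    apply: (@tri_le _ _ _ _ _ _ _ (1 + (1 + (1 + (1 + (1 + 1)))))) => //; last by move=> s';
      exact: id.
    apply: tri_seq; apply: (tri_load_cell (i:=y) (j:=k) I2) => //=; [exact: XL|lia|lia|].
    have I3 : inv len X (set_var s2 10 (X y k)) by apply: inv_set_var.
    apply: tri_seq; apply: (tri_load_cell (i:=y.+1) (j:=k) I3) => //=; [exact: XL| | | |].
    1-3: rewrite /upd /=; lia.
    set s3 := set_var _ 11 _; have I4 : inv len X s3 by apply: inv_set_var.
    apply: tri_seq.
    have b3 := XL yn1 kn; have b4 := XL yn2 kn.
    apply: (tri_change (k:=k) (x:=y) (w:=hleft n L X k y) I4) => //=;
      rewrite ?(inv0 I4) ?(inv3 I4) /upd /= ?(inv0 I2) ?(inv3 I2); try lia.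
    + by rewrite v2 /hleft.
    + exact: hleft_bound.
    have I5 : inv len X (set_hor s3 k y (hleft n L X k y)).
      by apply: inv_set_hor => //; have := hleft_bound L0 XL kn yn2; lia.
    apply: tri_seq; apply: (tri_load_cell (i:=k) (j:=y.+1) I5) => //=; rewrite /upd /=;
      [exact: XL|lia..|].
    set s4 := set_var _ 10 _; have I6 : inv len X s4 by apply: inv_set_var.
    apply: tri_seq; apply: (tri_load_cell (i:=k) (j:=y) I6) => //=; rewrite /upd /=;
      [exact: XL|lia..|].
    set s5 := set_var _ 11 _; have I7 : inv len X s5 by apply: inv_set_var.
    have b5 := XL kn yn1; have b6 := XL kn yn2.
    apply: (tri_change (k:=k) (x:=n + y) (w:=hright L X k y) I7) => //=;
      rewrite ?(inv0 I7) ?(inv3 I7) /upd /= ?(inv0 I2) ?(inv3 I2); try lia.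
    + by rewrite v2 /hright.
    + exact: hright_bound.
    split=> //; split=> //.
      apply: inv_set_var => //; apply: inv_set_hor => //.
      by have := hright_bound L0 XL kn yn2; lia.
    move=> k' y' lk ly H.
    rewrite /= /upd2 /=; case: (k' =P k) => [ek|nk] /=; last first.
      by have [] := S2 k' y' lk ly (ltac:(lia)).
    rewrite !eqn_add2l.
    have -> : (y' == n + y) = false by lia.
    have -> : (n + y' == y) = false by lia.
    case: (y' =P y) => [-> | ny]; first by rewrite ek.
    by apply: S2 => //; lia.
  move=> s' [I' S' v']; split=> //; split; first exact: inv_set_var.
  by move=> k' y' lk ly H; apply: S' => //; lia.
nia.
Qed.
Definition middle_done (t k : nat) (s : astate) : Prop :=
  forall k', k' < k -> hor s k' n.-1 = hmid n L X t k'.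

(** Progress along the antidiagonals i + j = t, and by i within one of them. *)
Definition queries_done (t i : nat) (s : astate) : Prop :=
  forall i' j', i' < n -> j' < n -> i' + j' < t \/ (i' + j' = t /\ i' < i) ->
  mem s (2 * (i' * n + j')) = minplus n X i' j'.

Lemma set_middle_correct t s : inv len X s -> sides_done n 0 s -> var s 9 = Z.of_nat t ->
  t < 2 * n - 1 -> queries_done t 0 s ->
  tri set_middle s (7 * n)
    (fun s' => [/\ inv len X s', sides_done n 0 s', middle_done t n s',
                   var s' 9 = Z.of_nat t & queries_done t 0 s']).
Proof.
move=> I0 S0 v0 tn Q0; have [h1 h2 h3 h4 [h5 h6 h7 h8]] := B_facts.
have L0 : (0 < L)%ZZ by lia.
apply: (@tri_le _ _ _ _ _ _ _ (n * (3.+2) + 2)); last by move=> s'; exact: id.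
  apply: (@tri_for _ _ _ _ _ _ n (fun k s' =>
    [/\ inv len X s', sides_done n 0 s', middle_done t k s',
        var s' 9 = Z.of_nat t & queries_done t 0 s'])) => //; try lia.
  - by move=> i s' _ [I' *]; rewrite /= (inv0 I'); lia.
  - by split=> //; apply: inv_set_var.
  move=> k s2 kn [I2 S2 M2 v2 Q2] w2.
  have n1 : n.-1 < n by lia.
  apply: (@tri_le _ _ _ _ _ _ _ (1 + (1 + 1))) => //; last by move=> s'; exact: id.
  apply: tri_seq; apply: (tri_load_cell (i:=n.-1) (j:=k) I2) => //=; rewrite ?(inv0 I2);
    [exact: XL|lia..|].
  have I3 : inv len X (set_var s2 10 (X n.-1 k)) by apply: inv_set_var.
  apply: tri_seq; apply: (tri_load_cell (i:=k) (j:=0) I3) => //=; rewrite /upd /=;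
    [exact: XL|lia..|].
  set s3 := set_var _ 11 _; have I4 : inv len X s3 by apply: inv_set_var.
  have b3 := XL n1 kn; have b4 := XL kn n_gt0.
  have [hm1 hm2] := hmid_bound L0 XL kn tn.
  apply: (tri_change (k:=k) (x:=n.-1) (w:=hmid n L X t k) I4) => //=;
    rewrite ?(inv0 I4) /upd /= ?(inv0 I2) ?(inv3 I2) ?(inv5 I2); try lia.
  + by rewrite v2 w2 /hmid; lia.
  split=> //; split=> //.
  - by apply: inv_set_var => //; apply: inv_set_hor => //; lia.
  - move=> k' y' lk ly H; rewrite /= /upd2.
    have -> : (y' == n.-1) = false by lia.
    have -> : (n + y' == n.-1) = false by lia.
    by rewrite !andbF; apply: S2.
  - move=> k' lk; rewrite /= /upd2 eqxx andbT; case: eqP => [->|ne] //.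
    by apply: M2; lia.
lia.
Qed.

Lemma query_all_correct t s : inv len X s -> sides_done n 0 s -> middle_done t n s ->
  var s 9 = Z.of_nat t -> t < 2 * n - 1 -> queries_done t 0 s ->
  tri query_all s (8 * n)
    (fun s' => [/\ inv len X s', sides_done n 0 s', var s' 9 = Z.of_nat t &
                   queries_done t n s']).
Proof.
move=> I0 S0 M0 v0 tn Q0; have [h1 h2 h3 h4 [h5 h6 h7 h8]] := B_facts.
have L0 : (0 < L)%ZZ by lia.
apply: (@tri_le _ _ _ _ _ _ _ (n * (4.+2) + 2)); last by move=> s'; exact: id.
  apply: (@tri_for _ _ _ _ _ _ n (fun i s' =>
    [/\ inv len X s', sides_done n 0 s', middle_done t n s',
        var s' 9 = Z.of_nat t & queries_done t i s'])) => //; try lia; first last.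
  - by move=> s' [].
  - move=> i s2 il [I2 S2 M2 v2 Q2] w2.
    (* Row i has no entry on this antidiagonal, so the invariant advances without a query. *)
    have fin : (t < i \/ i + n <= t) ->
        tri CSkip s2 0 (fun s'' => var s'' 7 = Z.of_nat i /\
          [/\ inv len X (set_var s'' 7 (Z.of_nat i.+1)),
              sides_done n 0 (set_var s'' 7 (Z.of_nat i.+1)),
              middle_done t n (set_var s'' 7 (Z.of_nat i.+1)),
              var (set_var s'' 7 (Z.of_nat i.+1)) 9 = Z.of_nat t &
              queries_done t i.+1 (set_var s'' 7 (Z.of_nat i.+1))]).
      move=> out; apply: tri_skip; split=> //; split=> //; first exact: inv_set_var.
      by move=> i' j' li lj H; apply: Q2 => //; lia.
    apply: tri_if; [rewrite /=; lia|rewrite /=; lia| |]; last first.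
      rewrite /= v2 w2 => H; apply: (tri_le (k:=0)) (fun s' => id) => //; apply: fin; lia.
    rewrite /= v2 w2 => H1.
    apply: tri_if; [rewrite /=; lia|rewrite /= (inv0 I2); lia| |]; last first.
      rewrite /= v2 w2 (inv0 I2) => H; apply: (tri_le (k:=0)) (fun s' => id) => //;
        apply: fin; lia.
    rewrite /= v2 w2 (inv0 I2) => H2.
    pose j := t - i; have jn : j < n by rewrite /j; lia.
    have et : i + j = t by rewrite /j; lia.
    have [k0 k0n ek0] := minz_ex (fun k => (X i k + X k j)%ZZ) n.-1.
    have k0n' : k0 < n by lia.
    have mb : (Z.abs (minplus n X i j) <= 2 * L)%ZZ.
      by rewrite /minplus ek0; have := XL il k0n'; have := XL k0n' jn; lia.
    have [ob1 ob2] := offset_bound il.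
    have isd : is_dist (grid n V (hor s2)) (vert n 0 i) (vert n n.-1 (n + j))
        (Some (offset n L i + minplus n X i j)%ZZ).
      apply: (grid_dist L0 XL il jn _ _ _ _ k0n' ek0).
      + by move=> k x kn xn; have [] := S2 k x kn xn (ltac:(lia)).
      + by move=> k y kn yn; have [] := S2 k y kn yn (ltac:(lia)).
      + by move=> k kn; rewrite et; apply: M2.
      + exact: inv_hor I2.
      + by move=> k kn; apply: minz_le; lia.
    have iw : i < width n by rewrite /width; lia.
    have jw : n + j < width n by rewrite /width; lia.
    have n1 : n.-1 <= n by lia.
    apply: (@tri_le _ _ _ _ _ _ _ (1 + 1)) => //; last by move=> s'; exact: id.
    apply: tri_seq.
    eexists; eexists; exists (set_var s2 10 (offset n L i + minplus n X i j)%ZZ); split.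
      apply: ev_query isd _ => //.
      * by rewrite /= w2; lia.
      * by rewrite /= w2 v2 (inv0 I2); lia.
      * by rewrite /= w2 /zord val_vert //; lia.
      * by rewrite /= w2 v2 (inv0 I2) /zord val_vert // last_rowE // /j; lia.
      * lia.
      by [].
    apply: (@tri_store _ _ _ _ _ (2 * (i * n + j))).
    + by rewrite /= /upd /= w2 v2 (inv0 I2); lia.
    + by rewrite /= /upd /= w2 (inv0 I2) (inv3 I2) (inv4 I2) (inv5 I2); lia.
    + by rewrite /= /upd /= w2 v2 (inv0 I2) /j; lia.
    + by rewrite -mulnn; have := index_lt il jn; lia.
    set z := eval _ _; have ez : z = minplus n X i j.
      by rewrite /z /= /upd /= w2 (inv0 I2) (inv3 I2) (inv4 I2) (inv5 I2) /offset; lia.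
    split=> //; split=> //.
    + by apply: inv_set_var => //; apply: inv_set_mem; apply: inv_set_var.
    + move=> i' j' li lj H; rewrite /= /upd.
      case: eqP => [e|ne].
        have [-> ->] : i' = i /\ j' = j by apply: (@index_inj n); lia.
        exact: ez.
      apply: Q2 => //.
      case: H => [H|[H H']]; first by left.
      right; split=> //; rewrite ltn_neqAle; apply/andP; split; last by lia.
      apply/eqP => e; apply: ne; have -> : j' = j by rewrite /j; lia.
      by rewrite e.
  - by split=> //; apply: inv_set_var.
  - by move=> i s' _ [I' *]; rewrite /= (inv0 I'); lia.
lia.
Qed.

Lemma copy_back_correct s : inv len X s -> queries_done (2 * n - 1) 0 s ->
  tri copy_back s (6 * (n * n)) (inv len (minplus n X)).
Proof.
move=> I0 Q0; have [h1 h2 h3 h4 [h5 h6 h7 h8]] := B_facts.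
have mb i j : i < n -> j < n -> (Z.abs (minplus n X i j) <= B)%ZZ.
  move=> il jn; have [k0 k0n ek0] := minz_ex (fun k => (X i k + X k j)%ZZ) n.-1.
  have k0n' : k0 < n by lia.
  have [ob1 ob2] := offset_bound il.
  by rewrite /minplus ek0; have := XL il k0n'; have := XL k0n' jn; lia.
pose Y i j := minplus n X i j.
apply: (@tri_le _ _ _ _ _ _ _ ((n * n) * (2.+2) + 2)); last by move=> s'; exact: id.
  (* During the copying the odd cells hold a mixture of both matrices. [X'] stands for it, and only
     the copied entries are described. *)
  apply: (@tri_for _ _ _ _ _ _ (n * n) (fun q s' =>
    [/\ exists X', inv len X' s', queries_done (2 * n - 1) 0 s' &
        forall i j, i < n -> j < n -> i * n + j < q ->
        mem s' (2 * (i * n + j)).+1 = minplus n X i j])) => //; try lia; first last.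
  - move=> s' [[X' I'] Q' C']; case: I' => *; split=> // i j li lj.
    by apply: C' => //; apply: index_lt.
  - move=> q s2 ql [[X' I2] Q2 C2] w2.
    have [i [j [il jn eq]]] := indexE ql; subst q.
    have Q2' := Q2 i j il jn (ltac:(lia)).
    have ijl := index_lt il jn.
    apply: (@tri_le _ _ _ _ _ _ _ (1 + 1)) => //; last by move=> s'; exact: id.
    apply: tri_seq; apply: (@tri_load _ _ _ _ _ (2 * (i * n + j))).
    + by rewrite /= w2; lia.
    + by rewrite /= w2; lia.
    + by rewrite -mulnn; lia.
    + by rewrite Q2'; apply: mb.
    apply: (@tri_store _ _ _ _ _ (2 * (i * n + j)).+1).
    + by rewrite /= /upd /= w2; lia.
    + by rewrite /= /upd /= Q2'; apply: mb.
    + by rewrite /= /upd /= w2; lia.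
    + by rewrite -mulnn; lia.
    rewrite /= {1}/upd /= Q2'; split=> //; split.
    + exists (fun i' j' => if (i' == i) && (j' == j) then minplus n X i j else X' i' j').
      apply: inv_set_var => //.
      case: (I2) => g0 g1 g2 g3 g4 g5 g6 gm gh; split=> // i' j' li lj /=.
      rewrite /upd /=; case: eqP => [e|ne].
        by have [-> ->] : i' = i /\ j' = j by [apply: (@index_inj n); lia]; rewrite !eqxx.
      rewrite ifF ?gm //; apply/andP => -[/eqP e1 /eqP e2]; apply: ne.
      by rewrite e1 e2.
    + move=> i' j' li lj H; rewrite /= /upd ifF; last by lia.
      exact: Q2.
    + move=> i' j' li lj H; rewrite /= /upd; case: eqP => [e|ne].
        by have [-> ->] : i' = i /\ j' = j by apply: (@index_inj n); lia.
      by apply: C2 => //; lia.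
  - by split=> //; exists X; apply: inv_set_var.
  - by move=> i s' _ [[X' I'] *]; rewrite /= (inv0 I'); lia.
lia.
Qed.

Lemma square_correct s : inv len X s ->
  tri square s (90 * (n * n)) (inv len (minplus n X)).
Proof.
move=> I0; have [h1 h2 h3 h4 [h5 h6 h7 h8]] := B_facts.
apply: (@tri_le _ _ _ _ _ _ _ (40 * (n * n) + (((2 * n - 1) * ((7 * n + 8 * n).+2) + 2) + 6 *
  (n * n)))); last by move=> s'; exact: id.
  apply: tri_seq; apply: tri_le (set_sides_correct I0) (leqnn _) _ => s1 [I1 S1].
  apply: tri_seq.
  apply: (@tri_for _ _ _ _ _ _ (2 * n - 1) (fun t s' =>
    [/\ inv len X s', sides_done n 0 s' & queries_done t 0 s'])) => //; try lia; first last.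
  - by move=> s' [I' S' Q']; apply: copy_back_correct.
  - move=> t s2 tn [I2 S2 Q2] w2; apply: tri_seq.
    apply: tri_le (set_middle_correct I2 S2 w2 tn Q2) (leqnn _) _ => s3 [I3 S3 M3 w3 Q3].
    apply: tri_le (query_all_correct I3 S3 M3 w3 tn Q3) (leqnn _) _ => s4 [I4 S4 w4 Q4].
    split=> //; split=> //; first exact: inv_set_var.
    by move=> i j li lj H; apply: Q4 => //; lia.
  - split=> //; first exact: inv_set_var.
    by move=> i j _ _ [|[_]].
  - by move=> i s' _ [I' *]; rewrite /= (inv0 I'); lia.
nia.
Qed.

End Square.
End Verification.

(** * The main loop *)

(** The program may depend on c, so n^c is computed by c multiplications. Variables 13 and 14, the
    numbers of nodes and edges, are the arguments for the initialization of the dynamic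
    algorithm. *)
Definition set_consts (c : nat) : cmd :=
  CAsg 1 (Cst 1) ;; CFor 12 (Cst (Z.of_nat c)) (CAsg 1 (Var 1 *' Var 0)) ;;
  CAsg 2 (Cst 4 *' Var 0 *' Var 1) ;; CAsg 3 (Cst 4 *' Var 2) ;;
  CAsg 4 (Var 3 *' (Var 0 +' Cst 1)) ;; CAsg 5 (Var 3 *' Var 0 *' Var 0) ;;
  CAsg 6 (Cst 1) ;; CAsg 13 (Var 0 *' (Cst 2 *' Var 0 +' Cst 3) +' Cst 1) ;;
  CAsg 14 (Cst 4 *' Var 0 *' Var 0).

(** The input has its values in the odd cells, which is where the current matrix is kept; so only
    missing edges and the diagonal need changes. *)
Definition load_matrix : cmd :=
  CFor 12 (Var 0 *' Var 0) (
    CLoad 10 (Cst 2 *' Var 12) ;;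
    CIf (Var 10) (Cst 1) (CStore (Cst 2 *' Var 12 +' Cst 1) (Var 2)) CSkip) ;;
  CFor 7 (Var 0) (CStore (cell_cur (Var 7) (Var 7)) (Cst 0)).

(** Horizontal edges start with weight 0: the weights that depend on the matrix are set by updates,
    in the first squaring as in the later ones. *)
Definition write_graph : cmd :=
  CFor 7 (Var 0) (CFor 8 (Cst 2 *' Var 0) (
    CAsg 10 (Cst 2 *' Var 0 *' Var 0 +' Cst 6 *' (Var 7 *' (Cst 2 *' Var 0) +' Var 8)) ;;
    CAsg 11 (node (Var 7) (Var 8)) ;;
    CStore (Var 10) (Var 11) ;;
    CStore (Var 10 +' Cst 1) (Var 11 +' Cst 1) ;;
    CStore (Var 10 +' Cst 2) (Cst 0) ;;
    CStore (Var 10 +' Cst 3) (Var 11) ;;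
    CStore (Var 10 +' Cst 4) (Var 11 +' (Cst 2 *' Var 0 +' Cst 1)) ;;
    CStore (Var 10 +' Cst 5) (Var 4))).

Definition setup (c : nat) : cmd := set_consts c ;; load_matrix ;; write_graph.

Definition write_output : cmd :=
  CFor 12 (Var 0 *' Var 0) (
    CLoad 10 (Cst 2 *' Var 12 +' Cst 1) ;;
    CIf (Var 10) (Var 0 *' Var 1 +' Cst 1)
      (CStore (Cst 2 *' Var 12) (Cst 1)) (CStore (Cst 2 *' Var 12) (Cst 0))).

Definition main_loop : cmd :=
  CWhile (Var 6) (Var 0) (square ;; CAsg 6 (Var 6 +' Var 6)) ;; write_output.

Section MainLoop.
Variables (n c' : nat) (B W : Z) (g : wgraph n).
Local Notation zn := (Z.of_nat n).
Local Notation L := (4 * Z.of_nat n * W)%ZZ.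
Local Notation V := (vweight n L).
Hypothesis n_gt0 : 0 < n.
Hypothesis W_gt0 : (0 < W)%ZZ.
Hypothesis W_B : (1000 * zn * zn * zn * W <= B)%ZZ.
Hypothesis weight_ok : (2 * scale L * zn * zn + Cmid n L <= Z.of_nat (nodes n ^ c'))%ZZ.
Hypothesis gW : forall x y w, g x y = Some w -> (Z.abs w <= W)%ZZ.
Hypothesis nn : no_negative_cycle g.

Local Notation tri := (tri n c' B V (2 * n ^ 2)).

Lemma walks_upto_XL len (X : nat -> nat -> Z) : len < 4 * n -> walks_upto g W len X ->
  forall i j, i < n -> j < n -> (Z.abs (X i j) <= L)%ZZ.
Proof.
move=> ln wX i j il jn.
exact: (walks_upto_abs W_gt0 gW (i := Ordinal il) (j := Ordinal jn) ln wX).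
Qed.

Lemma walks_upto_minplus len X : walks_upto g W len X ->
  walks_upto g W (len + len) (minplus n X).
Proof.
move=> wX; apply: (walks_upto_double W_gt0 gW wX) => i j; split.
  have [k kn ek] := minz_ex (fun k => (X i k + X k j)%ZZ) n.-1.
  have kn' : k < n by lia.
  by exists (Ordinal kn'); rewrite /minplus ek.
by move=> k; apply: minz_le; have := ltn_ord k; lia.
Qed.

(** [m] bounds the doublings still to come. Doubling only while [len < n] keeps [len < 2 * n], on
    which the threshold in [walks_upto_dist] relies. *)
Lemma squares_correct m len X s : n <= len * 2 ^ m -> len < 2 * n ->
  inv n W len X s -> walks_upto g W len X ->
  tri (CWhile (Var 6) (Var 0) (square ;; CAsg 6 (Var 6 +' Var 6))) s
    (m * (90 * (n * n) + 2) + 1)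
    (fun s' => exists len' X', [/\ n <= len', len' < 2 * n, inv n W len' X' s' &
                                   walks_upto g W len' X']).
Proof.
have [h1 h2 h3 h4 [h5 h6 h7 h8]] := B_facts n_gt0 W_gt0 W_B.
elim: m len X s => [|m IH] len X s nm ln I wX.
  rewrite expn0 muln1 in nm.
  apply: tri_while_stop; try (rewrite /= ?(inv0 I) ?(inv6 I); lia).
  by exists len, X; split.
case: (leqP n len) => nl.
  apply: (@tri_le _ _ _ _ _ _ _ 1) (fun s' => id); last by lia.
  apply: tri_while_stop; try (rewrite /= ?(inv0 I) ?(inv6 I); lia).
  by exists len, X; split=> //; lia.
apply: (@tri_le _ _ _ _ _ _ _ ((90 * (n * n) + 1) + (m * (90 * (n * n) + 2) + 1)).+1) (fun s'
  => id); last by lia.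
have XL := walks_upto_XL (ltac:(lia) : len < 4 * n) wX.
apply: tri_while_step; try (rewrite /= ?(inv0 I) ?(inv6 I); lia).
apply: tri_seq.
apply: tri_le (square_correct n_gt0 W_gt0 W_B weight_ok XL I) (leqnn _) _ => s1 I1.
apply: tri_asg; first by rewrite /= (inv6 I1); lia.
apply: (IH (len + len) (minplus n X)); last exact: walks_upto_minplus.
- by move: nm; rewrite expnS; lia.
- by lia.
- case: I1 => h01 h11 h21 h31 h41 h51 h61 hm hh; split=> //.
  by rewrite /= /upd /= h61; lia.
Qed.

Lemma write_output_correct len X s : inv n W len X s ->
  (forall i j, i < n -> j < n -> (Z.abs (X i j) <= L)%ZZ) ->
  tri write_output s (7 * (n * n))
    (fun s' => forall i j, i < n -> j < n ->
       decode_dist (mem s' (2 * (i * n + j))) (mem s' (2 * (i * n + j)).+1) =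
       if (X i j <? zn * W + 1)%ZZ then Some (X i j) else None).
Proof.
have [h1 h2 h3 h4 [h5 h6 h7 h8]] := B_facts n_gt0 W_gt0 W_B.
have nW : (0 < zn * W <= L)%ZZ by nia.
move=> I0 XL.
apply: (@tri_le _ _ _ _ _ _ _ ((n * n) * ((1 + 2).+2) + 2)); last by move=> s'; exact: id.
  apply: (@tri_for _ _ _ _ _ _ (n * n) (fun q s' => inv n W len X s' /\
      forall i j, i < n -> j < n -> i * n + j < q ->
       mem s' (2 * (i * n + j)) = if (X i j <? zn * W + 1)%ZZ then 1%ZZ else 0%ZZ)) => //;
         try lia.
  - by move=> i s' _ [I' *]; rewrite /= (inv0 I'); lia.
  - by split=> //; apply: inv_set_var.
  - move=> q s2 ql [I2 Q2] w2.
    have [i [j [il jn eq]]] := indexE ql; subst q.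
    have ijl := index_lt il jn.
    have Xij := XL i j il jn.
    apply: tri_seq; apply: (@tri_load _ _ _ _ _ (2 * (i * n + j)).+1).
    + by rewrite /= w2; lia.
    + by rewrite /= w2; lia.
    + by rewrite -mulnn; lia.
    + by rewrite (inv_mem I2) //; lia.
    rewrite (inv_mem I2) //.
    have fin z : (if (X i j <? zn * W + 1)%ZZ then 1%ZZ else 0%ZZ) = z -> (0 <= z <= 1)%ZZ ->
      tri (CStore (Cst 2 *' Var 12) (Cst z)) (set_var s2 10 (X i j)) 1 (fun s'' =>
        var s'' 12 = Z.of_nat (i * n + j) /\
        (inv n W len X (set_var s'' 12 (Z.of_nat (i * n + j).+1)) /\
        forall i' j', i' < n -> j' < n -> i' * n + j' < (i * n + j).+1 ->
        mem (set_var s'' 12 (Z.of_nat (i * n + j).+1)) (2 * (i' * n + j')) =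
        if (X i' j' <? zn * W + 1)%ZZ then 1%ZZ else 0%ZZ)).
      move=> ez z01; apply: (@tri_store _ _ _ _ _ (2 * (i * n + j))).
      * by rewrite /= /upd /= w2; lia.
      * by rewrite /= /upd /=; lia.
      * by rewrite /= /upd /= w2; lia.
      * by rewrite -mulnn; lia.
      split=> //; split; first by apply: inv_set_var => //; apply: inv_set_mem;
        apply: inv_set_var.
      move=> i' j' li lj H; rewrite /= /upd; case: eqP => [e|ne].
        by have [-> ->] : i' = i /\ j' = j by apply: (@index_inj n); lia.
      by apply: Q2 => //; lia.
    apply: tri_if.
    + by rewrite /= /upd /=; lia.
    + by rewrite /= /upd /= (inv0 I2) (inv1 I2); lia.
    + rewrite /= /upd /= (inv0 I2) (inv1 I2) => H.
      apply: (@tri_le _ _ _ _ _ _ _ 1) (fun s' => id) => //; apply: fin => //.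
      by case: Z.ltb_spec => //; lia.
    + rewrite /= /upd /= (inv0 I2) (inv1 I2) => H.
      apply: (@tri_le _ _ _ _ _ _ _ 1) (fun s' => id) => //; apply: fin => //.
      by case: Z.ltb_spec => //; lia.
  move=> s' [I' Q'] i j il jn; rewrite Q' ?(inv_mem I') //; last exact: index_lt.
  by case: Z.ltb_spec.
lia.
Qed.

Lemma main_loop_correct X s : inv n W 1 X s -> walks_upto g W 1 X ->
  tri main_loop s ((trunc_log 2 n).+1 * (90 * (n * n) + 2) + 1 + 7 * (n * n))
    (fun s' => forall i j : 'I_n, is_dist g i j
       (decode_dist (mem s' (2 * (i * n + j))) (mem s' (2 * (i * n + j)).+1))).
Proof.
move=> I wX; apply: tri_seq.
have nm : n <= 1 * 2 ^ (trunc_log 2 n).+1 by rewrite mul1n ltnW // trunc_log_ltn.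
have n2 : 1 < 2 * n by lia.
apply: tri_le (squares_correct nm n2 I wX) (leqnn _) _.
move=> s1 [len [X1 [ln1 ln2 I1 wX1]]].
have XL := walks_upto_XL (ltac:(lia) : len < 4 * n) wX1.
apply: tri_le (write_output_correct I1 XL) (leqnn _) _ => s2 H i j.
by rewrite H //; apply: walks_upto_dist wX1.
Qed.

End MainLoop.

(** * Building the input of the dynamic algorithm *)

(** Graph operations require [lim = 2 * n ^ 2], so the code that builds the input, which has a
    larger limit, performs none. *)
Lemma ev_quiet n c' B V lim c s t ops s' : ev n c' B V lim c s t ops s' ->
  lim <> 2 * n ^ 2 -> ops = [::] /\ hor s' = hor s.
Proof.
elim=> {c s t ops s'} //.
- move=> c1 c2 s t1 ops1 s1 t2 ops2 s2 _ IH1 _ IH2 ne.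
  by have [-> <-] := IH1 ne; have [-> <-] := IH2 ne.
- move=> a b c s t1 ops1 s1 t2 ops2 s2 _ _ _ _ IH1 _ IH2 ne.
  by have [-> <-] := IH1 ne; have [-> <-] := IH2 ne.
Qed.

(* The two edges that start at a node of the grid, as they appear in the input of the
   dynamic algorithm. *)
Definition edge_words (n : nat) (V : Z) (k x : nat) : seq Z :=
  let u := Z.of_nat (k * width n + x) in
  [:: u; u + 1; 0; u; u + Z.of_nat (width n); V]%ZZ.

Section Setup.
Variables (n c' c : nat) (B : Z) (g : wgraph n).
Local Notation zn := (Z.of_nat n).
Local Notation W := (Z.of_nat (n ^ c)).
Local Notation L := (4 * Z.of_nat n * W)%ZZ.
Local Notation V := (vweight n L).
(** 2n^2 cells for the matrices, and three words for each of the 4n^2 edges. *)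
Local Notation lim := (14 * n ^ 2).
Local Notation tri := (tri n c' B V lim).

(** The matrix in [inv] is read off the memory itself, so stores preserve it trivially. *)
Definition ready (s : astate) : Prop :=
  [/\ inv n W 1 (fun i j => mem s (2 * (i * n + j)).+1) s,
      var s 13 = Z.of_nat (nodes n) & var s 14 = (4 * zn * zn)%ZZ].

Lemma ready_set_mem s a z : ready s -> ready (set_mem s a z).
Proof. by case=> -[*]; split. Qed.

Lemma ready_set_var s v z : 6 < v -> v != 13 -> v != 14 -> ready s -> ready (set_var s v z).
Proof.
move=> v6 v13 v14 [I e1 e2]; split; first exact: inv_set_var.
  by rewrite /= /upd eq_sym (negbTE v13).
by rewrite /= /upd eq_sym (negbTE v14).
Qed.

Definition input_ok (s : astate) : Prop :=
  forall i j : 'I_n, mem s (2 * (i * n + j)) = (if g i j is Some _ then 1%ZZ else 0%ZZ) /\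
    mem s (2 * (i * n + j)).+1 = odflt 0%ZZ (g i j).

Definition start_ok (s : astate) : Prop :=
  forall i j : 'I_n, mem s (2 * (i * n + j)).+1 =
    if i == j then 0%ZZ else odflt L (g i j).

Hypothesis n_gt0 : 0 < n.
Hypothesis W_B : (1000 * zn * zn * zn * W <= B)%ZZ.
Hypothesis c_B : (Z.of_nat c <= B)%ZZ.
Hypothesis gW : forall x y w, g x y = Some w -> (Z.abs w <= W)%ZZ.

Lemma W_gt0 : (0 < W)%ZZ.
Proof. by have : 0 < n ^ c by [rewrite expn_gt0 n_gt0]; lia. Qed.

Lemma set_consts_correct s : var s 0 = zn -> (forall k x, (0 <= hor s k x)%ZZ) ->
  tri (set_consts c) s (3 * c + 10) (fun s' => ready s' /\ mem s' = mem s).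
Proof.
move=> v0 h0; have [h1 h2 h3 h4 [h5 h6 h7 h8]] := B_facts n_gt0 W_gt0 W_B.
apply: (@tri_le _ _ _ _ _ _ _ (1 + ((c * 1.+2 + 2) + (1 + (1 + (1 + (1 + (1 + (1 + 1)))))))) )
  (fun s' => id); last by lia.
apply: tri_seq; apply: tri_asg; first by rewrite /=; lia.
apply: tri_seq.
apply: (@tri_for _ _ _ _ _ _ c (fun i s' => [/\ var s' 0 = zn, mem s' = mem s,
    (forall k x, (0 <= hor s' k x)%ZZ) & var s' 1 = Z.of_nat (n ^ i)])) => //; try lia.
- by move=> i s' _ _ _; rewrite /=; lia.
- move=> i s1 ic [e0 em eh e1] w1.
  have : n ^ i <= n ^ c by rewrite leq_pexp2l // ltnW.
  move=> le; apply: tri_asg; first by rewrite /= e0 e1; lia.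
  split=> //; split=> //; rewrite /= /upd /= e0 e1 expnSr; lia.
move=> s1 [e0 em eh e1].
apply: tri_seq; apply: tri_asg; first by rewrite /= e0 e1; lia.
apply: tri_seq; apply: tri_asg; first by rewrite /= /upd /= e0 e1; lia.
have eL : (4 * zn * W)%ZZ = L by [].
apply: tri_seq; apply: tri_asg.
  by rewrite /= /upd /= e0 e1; move: h6; rewrite /scale; lia.
apply: tri_seq; apply: tri_asg.
  by rewrite /= /upd /= e0 e1; move: h6; rewrite /scale; lia.
apply: tri_seq; apply: tri_asg; first by rewrite /=; lia.
apply: tri_seq; apply: tri_asg; first by rewrite /= /upd /= e0; lia.
apply: tri_asg; first by rewrite /= /upd /= e0; lia.
split; last exact: em.
split=> //; last first.
- by rewrite /= /upd /= e0; lia.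
- by rewrite /= /upd /= e0 /nodes; lia.
split=> //; rewrite /= /upd /= ?e0 ?e1 //.
Qed.

Lemma load_matrix_correct s : ready s -> input_ok s ->
  tri load_matrix s (12 * (n * n)) (fun s' => ready s' /\ start_ok s').
Proof.
move=> R0 I0; have [h1 h2 h3 h4 [h5 h6 h7 h8]] := B_facts n_gt0 W_gt0 W_B.
have s14 : 2 * (n * n) <= lim by rewrite -mulnn; lia.
apply: (@tri_le _ _ _ _ _ _ _ (((n * n) * ((1 + 1.+1).+2) + 2) + (n * 1.+2 + 2))) (fun s' =>
  id); last first.
  nia.
apply: tri_seq.
(* The value cell of a missing edge holds 0 in the input, and L once the loop has passed it. *)
apply: (@tri_for _ _ _ _ _ _ (n * n) (fun q s' => [/\ ready s',
   forall i j : 'I_n, mem s' (2 * (i * n + j)) = (if g i j is Some _ then 1%ZZ else 0%ZZ) &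
   forall i j : 'I_n, mem s' (2 * (i * n + j)).+1 =
     odflt (if i * n + j < q then L else 0%ZZ) (g i j)])) => //; try lia.
- by move=> q s' _ [[I' _ _] *]; rewrite /= (inv0 I'); lia.
- split; first exact: ready_set_var.
    by move=> i j; case: (I0 i j).
  by move=> i j; case: (I0 i j).
- move=> q s2 ql [R2 F2 G2] w2.
  have [i' [j' [il jn eq]]] := indexE ql; subst q.
  pose i := Ordinal il; pose j := Ordinal jn.
  have ijl := index_lt il jn.
  have mf : mem s2 (2 * (i' * n + j')) = (if g i j is Some _ then 1%ZZ else 0%ZZ) := F2 i j.
  apply: tri_seq; apply: (@tri_load _ _ _ _ _ (2 * (i' * n + j'))).
  + by rewrite /= w2; lia.
  + by rewrite /= w2; lia.
  + by lia.
  + by rewrite mf; case: (g i j) => *; lia.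
  rewrite mf.
  have sm := R2; case: sm => I2 _ _.
  apply: tri_if.
  + by rewrite /= /upd /=; case: (g i j) => *; lia.
  + by rewrite /=; lia.
  + rewrite /= /upd /=; case E: (g i j) => [w|] H; first by lia.
    apply: (@tri_store _ _ _ _ _ (2 * (i' * n + j')).+1).
    * by rewrite /= /upd /= w2; lia.
    * by rewrite /= /upd /= (inv2 I2); lia.
    * by rewrite /= /upd /= w2; lia.
    * by lia.
    split=> //; split.
    * by apply: ready_set_var => //; apply: ready_set_mem; apply: ready_set_var.
    * by move=> a b; rewrite /= /upd ifF; [exact: F2|lia].
    move=> a b; rewrite /= /upd; case: eqP => [e|ne].
      have [ea eb] : a = i /\ b = j.
        have [e1 e2] : a = i' :> nat /\ b = j' :> nat.
          by have := ltn_ord b; move=> lb; apply: (@index_inj n); lia.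
        by split; apply: val_inj.
      by rewrite ea eb E /= ltnSn (inv2 I2).
    rewrite G2 [in RHS]ltnS [in RHS]leq_eqVlt; case: eqP => // e; case: ne.
    by rewrite e.
  + rewrite /= /upd /=; case E: (g i j) => [w|] H; last by lia.
    apply: (@tri_le _ _ _ _ _ _ _ 0) (fun s' => id) => //; apply: tri_skip.
    split=> //; split.
    * by apply: ready_set_var => //; apply: ready_set_var.
    * exact: F2.
    move=> a b; rewrite /= G2; case: (ltngtP (a * n + b) (i' * n + j')) => [lt|gt|e].
    * by rewrite ltnS (ltnW lt).
    * by rewrite ltnS leqNgt gt.
    have [ea eb] : a = i /\ b = j.
      have [e1 e2] : a = i' :> nat /\ b = j' :> nat.
        by have := ltn_ord b; move=> lb; apply: (@index_inj n); lia.
      by split; apply: val_inj.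
    by rewrite ea eb E.
move=> s1 [R1 _ G1].
apply: (@tri_for _ _ _ _ _ _ n (fun k s' => ready s' /\
   forall i j : 'I_n, mem s' (2 * (i * n + j)).+1 =
     if (i == j) && (i < k) then 0%ZZ else odflt L (g i j))) => //; try lia.
- by move=> q s' _ [[I' _ _] *]; rewrite /= (inv0 I'); lia.
- split; first exact: ready_set_var.
  by move=> i j; rewrite andbF /= G1 index_lt.
- move=> k s2 kl [R2 G2] w2.
  have kk := index_lt kl kl.
  case: (R2) => I2 _ _.
  apply: (@tri_store _ _ _ _ _ (2 * (k * n + k)).+1).
  + by rewrite /= w2 (inv0 I2); lia.
  + by rewrite /=; lia.
  + by rewrite /= w2 (inv0 I2); lia.
  + by lia.
  split=> //; split; first by apply: ready_set_var => //; apply: ready_set_mem.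
  move=> i j; rewrite /= /upd; case: eqP => [e|ne].
    have [e1 e2] : i = k :> nat /\ j = k :> nat.
      by have := ltn_ord j; move=> lb; apply: (@index_inj n); lia.
    by rewrite ifT // -(inj_eq val_inj) /= e1 e2 eqxx ltnSn.
  rewrite G2; case: (i =P j) => //= eij; rewrite ltnS [i <= k]leq_eqVlt.
  case: eqP => // ek; case: ne.
  by rewrite -eij ek.
- move=> s' [R' G']; split=> // i j; rewrite G'.
  by rewrite ltn_ord andbT.
Qed.

Lemma write_graph_correct s : ready s -> start_ok s ->
  tri write_graph s (30 * (n * n)) (fun s' => [/\ ready s', start_ok s' &
    forall k x b, k < n -> x < n.*2 -> b < 6 ->
      mem s' (2 * n ^ 2 + (6 * (k * n.*2 + x) + b)) = nth 0%ZZ (edge_words n V k x) b]).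
Proof.
move=> R0 S0; have [h1 h2 h3 h4 [h5 h6 h7 h8]] := B_facts n_gt0 W_gt0 W_B.
pose G k y s' := [/\ ready s', start_ok s' &
    forall k' x b, k' < n -> x < n.*2 -> b < 6 -> k' < k \/ (k' = k /\ x < y) ->
      mem s' (2 * n ^ 2 + (6 * (k' * n.*2 + x) + b)) = nth 0%ZZ (edge_words n V k' x) b].
apply: (@tri_le _ _ _ _ _ _ _ (n * ((n.*2 * (8.+2) + 2).+2) + 2)) (fun s' => id); last first.
  nia.
apply: (@tri_for _ _ _ _ _ _ n (fun k s' => G k 0 s')) => //; try lia.
- by move=> q s' _ [[I' _ _] *]; rewrite /= (inv0 I'); lia.
- split; [exact: ready_set_var|exact: S0|].
  by move=> k' x b _ _ _ [|[_]].
- move=> k s1 kn G1 w1.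
  apply: (@tri_for _ _ _ _ _ _ n.*2 (fun y s' => G k y s' /\ var s' 7 = Z.of_nat k)) => //;
    try lia.
  + by move=> q s' _ [[[I' _ _] _ _] _] _; rewrite /= (inv0 I'); lia.
  + by split=> //; case: G1 => R1 S1 G1; split=> //; apply: ready_set_var.
  + move=> x s2 xn [[R2 S2 G2] v2] w2.
    case: (R2) => I2 _ _.
    have ql : k * n.*2 + x < n * n.*2 by nia.
    move: (ql); move eq : (k * n.*2 + x) => q ql'.
    have eqz : (Z.of_nat k * (2 * zn) + Z.of_nat x)%ZZ = Z.of_nat q by rewrite -eq; lia.
    have ul : (Z.of_nat (k * width n + x) <= 5 * (zn * zn))%ZZ.
      by rewrite /width; nia.
    have qz : (Z.of_nat q < 2 * (zn * zn))%ZZ by lia.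
    have n2 : Z.of_nat (n ^ 2) = (zn * zn)%ZZ by rewrite -mulnn; lia.
    apply: (@tri_le _ _ _ _ _ _ _ (1 + (1 + (1 + (1 + (1 + (1 + (1 + 1)))))))) (fun s' => id)
      => //.
    apply: tri_seq; apply: tri_asg; first by rewrite /= w2 v2 (inv0 I2); lia.
    have -> : eval (var s2) (Cst 2 *' Var 0 *' Var 0 +'
         Cst 6 *' (Var 7 *' (Cst 2 *' Var 0) +' Var 8)) = Z.of_nat (2 * n ^ 2 + 6 * q).
      by rewrite /= w2 v2 (inv0 I2) eqz; lia.
    apply: tri_seq; apply: tri_asg; first by rewrite /= /upd /= w2 v2 (inv0 I2); lia.
    set u := eval _ _; have eu : u = Z.of_nat (k * width n + x).
      by rewrite /u /= /upd /= w2 v2 (inv0 I2) /width; lia.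
    set a0 := 2 * n ^ 2 + 6 * q.
    have a0z : Z.of_nat a0 = (2 * (zn * zn) + 6 * Z.of_nat q)%ZZ by rewrite /a0; lia.
    have a0l b : b < 6 -> a0 + b < lim.
      move=> b6; have qn : q < 2 * (n * n) by lia.
      by rewrite /a0 -mulnn; lia.
    apply: tri_seq; apply: (@tri_store _ _ _ _ _ (a0 + 0)); [by rewrite /= /upd /=;
      lia..| |exact: a0l|].
      by rewrite /= /upd /=; lia.
    apply: tri_seq; apply: (@tri_store _ _ _ _ _ (a0 + 1)); [by rewrite /= /upd /=;
      lia..| |exact: a0l|].
      by rewrite /= /upd /=; lia.
    apply: tri_seq; apply: (@tri_store _ _ _ _ _ (a0 + 2)); [by rewrite /= /upd /=;
      lia..| |exact: a0l|].
      by rewrite /= /upd /=; lia.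
    apply: tri_seq; apply: (@tri_store _ _ _ _ _ (a0 + 3)); [by rewrite /= /upd /=;
      lia..| |exact: a0l|].
      by rewrite /= /upd /=; lia.
    apply: tri_seq; apply: (@tri_store _ _ _ _ _ (a0 + 4));
      [by rewrite /= /upd /= ?(inv0 I2); lia..| |exact: a0l|].
      by rewrite /= /upd /=; lia.
    apply: (@tri_store _ _ _ _ _ (a0 + 5)); [by rewrite /= /upd /= ?(inv4 I2);
      lia..| |exact: a0l|].
      by rewrite /= /upd /=; lia.
    rewrite /= {1}/upd /=; split=> //; split; last by rewrite /= /upd /=.
    split.
    * apply: ready_set_var => //; do 6 apply: ready_set_mem.
      by do 2 apply: ready_set_var => //.
    * move=> i j; have ijl := index_lt (ltn_ord i) (ltn_ord j).
      rewrite /= -S2 /upd; have ba : 2 * (i * n + j) < a0.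
        by rewrite /a0 -mulnn; lia.
      by rewrite !ifF //; apply/negP => /eqP; lia.
    * move=> k' x' b k'n x'n b6 H.
      case: (k' * n.*2 + x' =P q) => [e|ne]; last first.
        rewrite /= -G2 //; last first.
          case: H => [|[ek H]]; first by left.
          right; split=> //; rewrite ltn_neqAle; apply/andP; split; last by lia.
          by apply/eqP => ex; apply: ne; rewrite ek ex eq.
          by rewrite /upd !ifF //; apply/negP => /eqP; rewrite /a0; lia.
      have [-> ->] : k' = k /\ x' = x by apply: (@index_inj n.*2); lia.
      rewrite eq addnA -/a0 /edge_words /= -eu.
      case: b b6 H => [|[|[|[|[|[|b]]]]]] // _ _;
        rewrite /upd !eqn_add2l /= ?(inv0 I2) ?(inv4 I2) // /width; lia.
  + move=> s' [[R' S' G'] v']; split=> //; split; [exact: ready_set_var|exact: S'|].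
    by move=> k' x b k'n xn b6 H; apply: G' => //; lia.
- move=> s' [R' S' G']; split=> // k x b kn xn b6; apply: G' => //; lia.
Qed.

Lemma setup_correct s : var s 0 = zn -> (forall k x, (0 <= hor s k x)%ZZ) -> input_ok s ->
  tri (setup c) s ((3 * c + 10) + (12 * (n * n) + 30 * (n * n))) (fun s' => [/\ ready s',
    start_ok s' &
    forall k x b, k < n -> x < n.*2 -> b < 6 ->
      mem s' (2 * n ^ 2 + (6 * (k * n.*2 + x) + b)) = nth 0%ZZ (edge_words n V k x) b]).
Proof.
move=> v0 h0 i0; apply: tri_seq.
apply: tri_le (set_consts_correct v0 h0) (leqnn _) _ => s1 [R1 M1].
apply: tri_seq; apply: tri_le (load_matrix_correct R1 _) (leqnn _) _.
  by move=> i j; rewrite M1; apply: i0.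
by move=> s2 [R2 S2]; apply: write_graph_correct.
Qed.

End Setup.

(** * Legality of the operations, and the input in memory *)

Definition hor_ok (wmax : Z) (h : nat -> nat -> Z) : Prop :=
  forall k x, (0 <= h k x <= wmax)%ZZ.

Lemma grid_valid (R : realType) c' n V h :
  (0 <= V <= Z.of_nat (nodes n ^ c'))%ZZ -> hor_ok (Z.of_nat (nodes n ^ c')) h ->
  valid_graph R c' (grid n V h).
Proof.
move=> Vb hb; split; [exact: grid_sym| | |exact: grid_planar].
  move=> u; case E: grid => [w|//]; have := @edge_neq n V h u u.
  by rewrite /edge E => /(_ isT).
move=> u v w /grid_edgeP [k [x [k' [x' [[_ _ H] _]]]]].
by case: H => [[_ _ ->]|[_ _ ->]]; [exact: hb|exact: Vb].
Qed.

(** [M] is arbitrary because the only updates recorded are changes of weights, which both models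
    allow. *)
Lemma ev_legal (R : realType) M n c' B V lim c s t ops s' :
  ev n c' B V lim c s t ops s' ->
  (0 <= V <= Z.of_nat (nodes n ^ c'))%ZZ ->
  hor_ok (Z.of_nat (nodes n ^ c')) (hor s) ->
  [/\ hor_ok (Z.of_nat (nodes n ^ c')) (hor s'),
      n_updates ops <= t, n_queries ops <= t &
      forall rest, legal R M c' (grid n V (hor s')) rest ->
        legal R M c' (grid n V (hor s)) (ops ++ rest)].
Proof.
move=> + Vb; elim=> {c s t ops s'} //.
- move=> c1 c2 s t1 ops1 s1 t2 ops2 s2 _ IH1 _ IH2 /IH1 [h1 u1 q1 l1].
  have [h2 u2 q2 l2] := IH2 h1; split=> //.
  + by move: u1 u2; rewrite /n_updates count_cat; lia.
  + by move: q1 q2; rewrite /n_queries count_cat; lia.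
  + by move=> rest lr; rewrite -catA; apply: l1; apply: l2.
- move=> a b c1 c2 s t ops s' _ _ _ IH /IH [h1 u1 q1 l1]; split=> //; exact: leqW.
- move=> a b c s t1 ops1 s1 t2 ops2 s2 _ _ _ _ IH1 _ IH2 /IH1 [h1 u1 q1 l1].
  have [h2 u2 q2 l2] := IH2 h1; split=> //.
  + by move: u1 u2; rewrite /n_updates count_cat; lia.
  + by move: q1 q2; rewrite /n_queries count_cat; lia.
  + by move=> rest lr; rewrite -catA; apply: l1; apply: l2.
- move=> a b e s k x w _ _ _ _ kn xn _ _ _ wb hb.
  have hb' : hor_ok (Z.of_nat (nodes n ^ c')) (upd2 (hor s) k x w).
    by move=> k' x'; rewrite /upd2; case: ifP.
  split=> // rest lr; split; rewrite /= ?set_edge_grid //.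
  + by case: (M).
  + by rewrite /edge grid_hor.
  + exact: grid_valid.
Qed.

Lemma nth_flatten_map (S T : Type) (x0 : T) (y0 : S) (f : S -> seq T) b s k r :
  (forall x, size (f x) = b) -> k < size s -> r < b ->
  nth x0 (flatten (map f s)) (b * k + r) = nth x0 (f (nth y0 s k)) r.
Proof.
move=> Hf; elim: s k => [|y s IH] [|k] //= ks rb; rewrite nth_cat Hf.
  by rewrite muln0 rb.
have -> : (b * k.+1 + r < b) = false by apply/negbTE; rewrite -leqNgt mulnS -addnA leq_addr.
have -> : b * k.+1 + r - b = b * k + r by rewrite mulnS -addnA addKn.
by rewrite IH.
Qed.

Lemma apsp_input_cell n (g : wgraph n) (i j : 'I_n) r : r < 2 ->
  cell (apsp_input g) (2 * (i * n + j) + r) = nth 0%ZZ (encode_weight (g i j)) r.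
Proof.
move=> r2; rewrite /apsp_input /=.
have -> : [seq encode_weight (g i0 j0) | i0 <- enum 'I_n, j0 <- enum 'I_n] =
    [seq encode_weight (g p.1 p.2) | p <- [seq (i0, j0) | i0 <- enum 'I_n, j0 <- enum 'I_n]].
  by rewrite map_allpairs.
have i0 : 'I_n := i.
rewrite (nth_flatten_map 0%ZZ (i, j) (b := 2)) //; first last.
- by rewrite size_allpairs size_enum_ord; apply: index_lt.
- by case=> a b /=; case: (g a b).
rewrite [i * n]mulnC (nth_flatten_map (i, j) i (b := n)) ?size_enum_ord //.
  by rewrite (nth_map i) ?size_enum_ord // !nth_ord_enum.
by move=> x; rewrite size_map size_enum_ord.
Qed.

Lemma apsp_input_cell_default n (g : wgraph n) a : 2 * n ^ 2 <= a ->
  cell (apsp_input g) a = 0%ZZ.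
Proof.
move=> le; rewrite /apsp_input /= nth_default //.
have -> : [seq encode_weight (g i0 j0) | i0 <- enum 'I_n, j0 <- enum 'I_n] =
    [seq encode_weight (g p.1 p.2) | p <- [seq (i0, j0) | i0 <- enum 'I_n, j0 <- enum 'I_n]].
  by rewrite map_allpairs.
rewrite (@size_flatten_map _ _ _ 2) ?size_allpairs ?size_enum_ord ?mulnn //.
by case=> i j /=; case: (g i j).
Qed.

(** [q] numbers the nodes in the order in which [write_graph] stores their edges. *)
Definition own_edge (n q : nat) (d : bool) : 'I_(nodes n) * 'I_(nodes n) :=
  let k := q %/ n.*2 in let x := q %% n.*2 in
  (vert n k x, if d then vert n k.+1 x else vert n k x.+1).

Definition grid_edges (n : nat) : seq ('I_(nodes n) * 'I_(nodes n)) :=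
  [seq own_edge n q d | q <- iota 0 (n * n.*2), d <- [:: false; true]].

Lemma size_grid_edges n : size (grid_edges n) = 4 * n ^ 2.
Proof. by rewrite size_allpairs size_iota /= -mulnn; lia. Qed.

Lemma own_edge_val n q d : q < n * n.*2 ->
  let k := q %/ n.*2 in let x := q %% n.*2 in
  [/\ k < n, x < n.*2, (own_edge n q d).1 = k * width n + x :> nat &
      (own_edge n q d).2 = k * width n + x + (if d then width n else 1) :> nat].
Proof.
move=> qn /=; have n0 : 0 < n.*2 by case: n qn.
have kn : q %/ n.*2 < n by rewrite ltn_divLR.
have xn : q %% n.*2 < n.*2 by rewrite ltn_pmod.
split=> //=; first by rewrite val_vert ?(ltnW kn) // /width; lia.
case: d; rewrite val_vert ?(ltnW kn) /width //; lia.
Qed.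

Lemma grid_edges_listing n V h : edge_listing (grid n V h) (grid_edges n).
Proof.
rewrite /edge_listing /grid_edges map_allpairs; split.
  apply: allpairs_uniq; [exact: iota_uniq|by []|].
  move=> [q d] [q' d'] /allpairsP [[q1 d1] [qn _ [-> ->]]].
  move=> /allpairsP [[q2 d2] [q'n _ [-> ->]]] {q d q' d'}.
  rewrite !mem_iota !add0n !leq0n /= in qn q'n.
  have [kn xn e1 e2] := own_edge_val d1 qn.
  have [kn' xn' e1' e2'] := own_edge_val d2 q'n.
  rewrite /uncurry => /eqP; rewrite set2_eq => H.
  (* The difference of the end nodes, 1 or [width n], tells the two edges of a node apart. Swapped
     ends are impossible, as the second node of each pair is the larger. *)
  have w0 : 1 < width n by rewrite /width; lia.
  case/orP: H => /andP [/eqP /(congr1 (@nat_of_ord _)) f1 /eqP /(congr1 (@nat_of_ord _)) f2];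
    rewrite ?e1 ?e2 ?e1' ?e2' in f1 f2.
    have [ek ex] : q1 %/ n.*2 = q2 %/ n.*2 /\ q1 %% n.*2 = q2 %% n.*2.
      by apply: (@index_inj (width n)) => //; rewrite /width; lia.
    have -> : q1 = q2 by rewrite (divn_eq q1 n.*2) (divn_eq q2 n.*2) ek ex.
    congr pair; move: f2; rewrite f1 => /addnI.
    by case: (d1) (d2) => [] [] // f2; lia.
  by move: f1 f2 w0; case: (d1) (d2) => [] []; lia.
move=> u v; apply/idP/allpairsP.
  rewrite /edge; case E: grid => [w|//] _.
  have [k [x [k' [x' [[kn xn H] H']]]]] := grid_edgeP E.
  have n0 : 0 < n.*2 by lia.
  have dk : (k * n.*2 + x) %/ n.*2 = k by rewrite divnMDl // divn_small // addn0.
  have mx : (k * n.*2 + x) %% n.*2 = x by rewrite modnMDl modn_small.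
  exists (k * n.*2 + x, k' == k.+1); split=> /=.
  - by rewrite mem_iota /=; nia.
  - by case: eqP; rewrite !inE.
  - have -> : [set u; v]%SET = [set vert n k x; vert n k' x']%SET.
      by case: H' => [[-> ->]|[-> ->]] //; rewrite finset.setUC.
    by rewrite dk mx; case: H => [[-> -> _]|[-> -> _]]; rewrite ?eqxx // ltn_eqF.
case=> [[q d] /= [+ _ +]]; rewrite mem_iota add0n leq0n /= => qn e.
have [kn xn _ _] := own_edge_val d qn.
have H : edge (grid n V h) (own_edge n q d).1 (own_edge n q d).2.
  by rewrite /edge /=; case: d {e}; rewrite ?grid_hor ?grid_ver.
move/eqP: e; rewrite set2_eq => /orP [] /andP [/eqP -> /eqP ->] //.
by rewrite /edge grid_sym.
Qed.

Lemma graph_input_cell n V k x b : k < n -> x < n.*2 -> b < 6 ->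
  cell (graph_input (grid n V (fun _ _ => 0%ZZ)) (grid_edges n)) (6 * (k * n.*2 + x) + b) =
  nth 0%ZZ (edge_words n V k x) b.
Proof.
move=> kn xn b6; rewrite /graph_input /=.
set words := fun e => _.
have -> : [seq words e | e <- grid_edges n] =
    [seq words (own_edge n q d) | q <- iota 0 (n * n.*2), d <- [:: false; true]].
  by rewrite /grid_edges map_allpairs.
have -> : flatten [seq words (own_edge n q d) | q <- iota 0 (n * n.*2), d <- [:: false; true]] =
    flatten [seq words (own_edge n q false) ++ words (own_edge n q true) | q <- iota 0 (n *
      n.*2)].
  by elim: (iota 0 _) => //= q s ->.
have n0 : 0 < n.*2 by lia.
have lt : k * n.*2 + x < n * n.*2 by nia.
rewrite (nth_flatten_map 0%ZZ 0 (b := 6)) ?size_iota // nth_iota // add0n.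
have dk : (k * n.*2 + x) %/ n.*2 = k by rewrite divnMDl // divn_small // addn0.
have mx : (k * n.*2 + x) %% n.*2 = x by rewrite modnMDl modn_small.
rewrite /words /own_edge /= dk mx grid_hor // grid_ver // /edge_words /zord.
have x1 : x < width n by rewrite /width; lia.
have x2 : x.+1 < width n by rewrite /width; lia.
rewrite !val_vert ?(ltnW kn) //.
case: b b6 => [|[|[|[|[|[|b]]]]]] //= _; [lia|rewrite mulSn; lia].
Qed.

Lemma graph_input_default n V h a : 12 * n ^ 2 <= a ->
  cell (graph_input (grid n V h) (grid_edges n)) a = 0%ZZ.
Proof.
move=> le; rewrite /graph_input /= nth_default //.
rewrite (@size_flatten_map _ _ _ 3) // size_grid_edges; lia.
Qed.

(** * Word size *)

Lemma Zpow2 k : (2 ^ Z.of_nat k)%ZZ = Z.of_nat (2 ^ k).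
Proof. by elim: k => [|k IH] //; rewrite Nat2Z.inj_succ Z.pow_succ_r ?IH ?expnS; lia. Qed.

Lemma nodes_bound n : 0 < n -> n ^ 2 <= nodes n /\ 6 <= nodes n <= 6 * n ^ 2.
Proof. by rewrite -mulnn /nodes => n0; split; nia. Qed.

Section WordSize.
Variables (n c kD : nat).
Hypothesis n_gt0 : 0 < n.
Local Notation l := (trunc_log 2 n).+1.

(** In units of [l], where n < 2^l: 10 for the factor 1000, 3 for n^3, c for n^c, and 1 to spare. *)
Definition value_exp := (c + 14)%N.
(** As N <= 6n^2 < 2^(5l), the words of the dynamic algorithm have at most 5l kD bits and the
    weights, up to N^(c + 6), at most 5l(c + 6); a further 5 is to spare. *)
Definition dyn_exp := (5 * (kD + c + 7))%N.
(** The first term is for expressions with [max_leaves] leaves, the second for the dynamic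
    algorithm; the 3 leaves room for the sign bit and the base address. *)
Definition apsp_words := (16 * value_exp + dyn_exp + 3)%N.

Lemma n_lt_pow : n < 2 ^ l.
Proof. exact: trunc_log_ltn. Qed.

Lemma nodes_lt_pow : nodes n < 2 ^ (5 * l).
Proof.
have [_ /andP [_ H]] := nodes_bound n_gt0; apply: leq_ltn_trans H _.
apply: (@leq_trans (2 ^ 3 * (2 ^ l) ^ 2)).
  have := n_lt_pow; move: (2 ^ l) => m nm; rewrite -!mulnn -[2 ^ 3]/8; nia.
by rewrite -expnM -expnD leq_exp2l //; lia.
Qed.


Lemma value_fits : 1000 * n * n * n * n ^ c <= 2 ^ (value_exp * l).
Proof.
have nl := ltnW n_lt_pow.
have h1 : 1000 <= 2 ^ (10 * l) by apply: (@leq_trans (2 ^ 10)) => //; rewrite leq_exp2l //; lia.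
have h2 : n ^ c <= 2 ^ (c * l).
  by rewrite [c * l]mulnC expnM; case: (c) => [|k] //; rewrite leq_exp2r.
have -> : value_exp * l = (10 * l + l + l + l + c * l) + l by rewrite /value_exp; lia.
apply: (@leq_trans (2 ^ (10 * l + l + l + l + c * l))); last by rewrite leq_exp2l // leq_addr.
by rewrite !expnD; do 4 (apply: leq_mul => //).
Qed.

Lemma exponent_fits : c <= 2 ^ (value_exp * l).
Proof.
apply: leq_trans (ltnW (ltn_expl c (isT : 1 < 2))) _.
by rewrite leq_exp2l // /value_exp; nia.
Qed.

Lemma dyn_word_fits : 2 ^ word_size kD (nodes n) <= 2 ^ (dyn_exp * l).
Proof.
rewrite leq_exp2l // /word_size.
have [_ /andP [N6 _]] := nodes_bound n_gt0.
have : trunc_log 2 (nodes n) < 5 * l.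
  rewrite -(@ltn_exp2l 2) //; apply: leq_ltn_trans nodes_lt_pow.
  by apply: trunc_logP => //; lia.
rewrite /dyn_exp; move: (trunc_log 2 (nodes n)) (l) => a b ab; nia.
Qed.

Lemma nodes_fits : nodes n <= 2 ^ (dyn_exp * l).
Proof.
apply: leq_trans (ltnW nodes_lt_pow) _; rewrite leq_exp2l // /dyn_exp.
by apply: leq_mul => //; lia.
Qed.

Lemma weight_fits : nodes n ^ (c + 6) <= 2 ^ (dyn_exp * l).
Proof.
apply: (@leq_trans ((2 ^ (5 * l)) ^ (c + 6))).
  by rewrite leq_exp2r; [apply: ltnW; apply: nodes_lt_pow|rewrite addn_gt0 orbT].
by rewrite -expnM leq_exp2l // /dyn_exp; move: (l) => b; nia.
Qed.

Lemma word_size_sub1 : (Z.of_nat (word_size apsp_words n) - 1)%ZZ =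
  Z.of_nat (word_size apsp_words n).-1.
Proof.
have : 0 < word_size apsp_words n by rewrite muln_gt0 /apsp_words addn_gt0 orbT.
lia.
Qed.

Lemma value_top : (Z.of_nat (2 ^ (value_exp * l)) ^ Z.of_nat max_leaves <
  2 ^ (Z.of_nat (word_size apsp_words n) - 1))%ZZ.
Proof.
rewrite -Zpow2 -Z.pow_mul_r; try lia.
apply: Z.pow_lt_mono_r; try lia; rewrite word_size_sub1.
  lia.
rewrite -Nat2Z.inj_mul; apply/Nat2Z.inj_lt.
rewrite /word_size /apsp_words /max_leaves.
have : 0 < l by [].
move: (l) => b; nia.
Qed.

Lemma base_top : (Z.of_nat (2 ^ (dyn_exp * l)) + Z.of_nat (2 * n ^ 2) <
  2 ^ (Z.of_nat (word_size apsp_words n) - 1))%ZZ.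
Proof.
rewrite word_size_sub1 Zpow2.
suff : 2 ^ (dyn_exp * l) + 2 * n ^ 2 < 2 ^ (word_size apsp_words n).-1 by lia.
have nl := n_lt_pow.
have h : 2 * n ^ 2 < 2 ^ (dyn_exp * l).
  apply: (@leq_trans (2 * (2 ^ l) ^ 2)); first by rewrite ltn_pmul2l // ltn_exp2r.
  rewrite -expnM -expnS leq_exp2l // /dyn_exp; have : 0 < l by [].
  move: (l) => b; nia.
apply: (@leq_trans (2 ^ (dyn_exp * l).+1)); first by move: h;
  rewrite (expnS 2 (dyn_exp * l)); move: (2 ^ (dyn_exp * l)) (2 * n ^ 2) => a b; lia.
rewrite leq_exp2l // /word_size /apsp_words.
have : 0 < l by [].
move: (l) => b; nia.
Qed.

(** The bound has to hold for every n, without a constant factor. As N >= 6, N^3 absorbs the factor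
    48 and N^(c + 3) absorbs n^(c + 3); hence the exponent c + 6. *)
Lemma weight_range : (2 * scale (4 * Z.of_nat n * Z.of_nat (n ^ c)) * Z.of_nat n * Z.of_nat n +
    Cmid n (4 * Z.of_nat n * Z.of_nat (n ^ c)) <= Z.of_nat (nodes n ^ (c + 6)))%ZZ /\
  (vweight n (4 * Z.of_nat n * Z.of_nat (n ^ c)) <= Z.of_nat (nodes n ^ (c + 6)))%ZZ.
Proof.
have [N1 /andP [N2 _]] := nodes_bound n_gt0.
have Nn : n <= nodes n by apply: leq_trans N1; rewrite -mulnn; nia.
suff H : 48 * (n * n * n * n ^ c) <= nodes n ^ (c + 6).
  have : Z.of_nat (48 * (n * n * n * n ^ c)) = (48 * (Z.of_nat n * Z.of_nat n * Z.of_nat n *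
    Z.of_nat (n ^ c)))%ZZ by lia.
  have : (Z.of_nat n * Z.of_nat (n ^ c) <= Z.of_nat n * Z.of_nat n * Z.of_nat (n ^ c))%ZZ by
    nia.
  have : (Z.of_nat n * Z.of_nat n * Z.of_nat (n ^ c) <= Z.of_nat n * Z.of_nat n * Z.of_nat n *
    Z.of_nat (n ^ c))%ZZ by nia.
  by rewrite /vweight /Cmid /scale; lia.
have -> : n * n * n * n ^ c = n ^ (c + 3) by rewrite expnD mulnC !expnS expn0 muln1 !mulnA.
have -> : c + 6 = 3 + (c + 3) by lia.
rewrite (expnD (nodes n)); apply: leq_mul.
  by apply: (@leq_trans (6 ^ 3)); [|rewrite leq_exp2r].
by rewrite leq_exp2r // addn_gt0 orbT.
Qed.

End WordSize.

(** * The reduction *)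

Definition base_code : program :=
  [:: Op Mul (rtmp 0) (rvar 0) (rvar 0); Op Add (rtmp 0) (rtmp 0) (rtmp 0)].

Definition args_code : program := mov (rdyn 0) (rvar 13) ++ mov (rdyn 1) (rvar 14).

Definition apsp_program (D : dyn_program) (c : nat) : program :=
  let o1 := 2 + clen D (setup c) in
  let o2 := o1 + 4 in
  let o3 := o2 + 2 * size (init_code D) in
  base_code ++ comp D 2 (setup c) ++ args_code ++ reloc o2 (init_code D) ++
  comp D o3 main_loop.

Definition main_cost (n : nat) : nat :=
  (trunc_log 2 n).+1 * (90 * (n * n) + 2) + 1 + 7 * (n * n).

Definition apsp_cost (n c : nat) : nat :=
  6 + 200 * (3 * c + 10 + (12 * (n * n) + 30 * (n * n))) + 200 * main_cost n.

Lemma base_code_run w P n s : code_at P 0 base_code -> reg s (rvar 0) = Z.of_nat n ->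
  (Z.of_nat (2 * n ^ 2) < 2 ^ (Z.of_nat w - 1))%ZZ ->
  msteps w P 0 s 2 2 (set_reg (set_reg s (rtmp 0) (Z.of_nat (n ^ 2)))
                               (rtmp 0) (Z.of_nat (2 * n ^ 2))).
Proof.
move=> /code_at_cons [c1 /code_at_cons [c2 _]] r0 nw.
have e1 : eval_binop Mul (reg s (rvar 0)) (reg s (rvar 0)) = Z.of_nat (n ^ 2).
  by rewrite /= r0 -mulnn; lia.
have := step_op (w := w) (s := s) c1; rewrite e1 => /(_ (ltac:(lia))) st1.
apply: msteps_step st1 _; set s1 := set_reg _ _ _.
have e2 : eval_binop Add (reg s1 (rtmp 0)) (reg s1 (rtmp 0)) = Z.of_nat (2 * n ^ 2).
  by rewrite /= /s1 /=; lia.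
have := step_op (w := w) (s := s1) c2; rewrite e2 => /(_ (ltac:(lia))) st2.
exact: msteps1 st2.
Qed.

Section Reduction.
Variables (R : realType) (M : model) (c : nat) (D : dyn_program) (kD : nat).
Variables (K : R) (u q : nat -> R).
Hypothesis D_correct : forall (N : nat) (g : wgraph N) (es : seq ('I_N * 'I_N))
      (ops : seq (operation N)),
    (0 < N)%N -> valid_graph R (c + 6) g -> edge_listing g es ->
    legal R M (c + 6) g ops ->
    exists t0 s0 t,
      [/\ exec (word_size kD N) (init_code D) (graph_input g es) t0 s0,
          serves (word_size kD N) D g s0 ops t &
          ((t0 + t)%:R <=
            K * ((N + size es + n_updates ops)%:R * u N
                 + (n_queries ops)%:R * q N))%R].

(** [K], [u] and [q] may be negative, so the amortized bound is stated with the exact numbers [nu]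
    and [nq] and not with their common bound. *)
Lemma apsp_program_correct n (g : wgraph n) : 0 < n ->
  (forall x y w, g x y = Some w -> (Z.abs w <= Z.of_nat (n ^ c))%ZZ) ->
  no_negative_cycle g ->
  exists t s' tD nu nq,
    [/\ exec (word_size (apsp_words c kD) n) (apsp_program D c) (apsp_input g) t s',
      forall i j, is_dist g i j (apsp_output s' i j),
      t <= apsp_cost n c + 2 * tD,
      nu <= main_cost n /\ nq <= main_cost n &
      (tD%:R <= K * ((nodes n + 4 * n ^ 2 + nu)%:R * u (nodes n)
                     + nq%:R * q (nodes n)))%R].
Proof.
move=> n0 gW nn.
set w := word_size _ _; set P := apsp_program D c.
pose l := (trunc_log 2 n).+1.
pose B := Z.of_nat (2 ^ (value_exp c * l)).
pose BD := Z.of_nat (2 ^ (dyn_exp c kD * l)).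
pose wD := word_size kD (nodes n).
pose W := Z.of_nat (n ^ c).
pose V := vweight n (4 * Z.of_nat n * W)%ZZ.
have W0 : (0 < W)%ZZ by have : 0 < n ^ c by [rewrite expn_gt0 n0]; rewrite /W; lia.
have WB : (1000 * Z.of_nat n * Z.of_nat n * Z.of_nat n * W <= B)%ZZ.
  by have := value_fits c n0; rewrite /B /W /l; lia.
have cB : (Z.of_nat c <= B)%ZZ by have := exponent_fits c n0; rewrite /B /l; lia.
have [h1 h2 h3 h4 [h5 h6 h7 h8]] := B_facts n0 W0 WB.
have B2 : (2 <= B)%ZZ by lia.
have Btop : (B ^ Z.of_nat max_leaves < 2 ^ (Z.of_nat w - 1))%ZZ by apply: value_top.
have BDw : (2 ^ Z.of_nat wD <= BD)%ZZ.
  by rewrite Zpow2 /BD; have := dyn_word_fits c kD n0; rewrite -/wD -/l; lia.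
have BDtop : (BD + Z.of_nat (2 * n ^ 2) < 2 ^ (Z.of_nat w - 1))%ZZ by apply: base_top.
have NBD : (Z.of_nat (nodes n) <= BD)%ZZ.
  by have := nodes_fits c kD n0; rewrite /BD /l; lia.
have WBD : (Z.of_nat (nodes n ^ (c + 6)) <= BD)%ZZ.
  by have := weight_fits c kD n0; rewrite /BD /l; lia.
have [wr1 wr2] := weight_range c n0.
have BD0 : (0 <= BD)%ZZ by rewrite /BD; lia.
have := @code_at0 P; rewrite {2}/P /apsp_program.
move=> /code_at_cat [cP1 /code_at_cat [cP2 /code_at_cat [cP3 /code_at_cat [cP4 cP5]]]].
rewrite add0n [size base_code]/= in cP2 cP3 cP4 cP5.
rewrite size_comp in cP3 cP4 cP5.
rewrite [size args_code]/= in cP4 cP5.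
rewrite size_reloc in cP5.
pose s0 := apsp_input g.
(* Variable 0 is compiled to register 0, where n is given. *)
have r0 : reg s0 (rvar 0) = Z.of_nat n by [].
have m1 := base_code_run (w := w) cP1 r0 (ltac:(lia)).
set s1 := set_reg _ _ _ in m1.
pose a0 := AState (fun v => if v == 0 then Z.of_nat n else 0%ZZ) (cell s0)
  (fun _ _ => 0%ZZ).
(* The dynamic algorithm has not started yet; this state stands in for its own during the setup. *)
pose sD0 := State (fun _ => 0%ZZ) (fun i => cell s0 (2 * n ^ 2 + i)).
have ss1 : sim n (14 * n ^ 2) BD s1 a0 sD0.
  split=> //.
  - move=> v; rewrite /s1 /= /rvar /rtmp.
    have -> : (4 * v == 4 * 0 + 2) = false by apply/eqP; lia.
    by case: v => [|v] //=; rewrite mulnS /= nth_nil.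
  - move=> r; rewrite /s1 /= /rdyn /rtmp.
    have -> : (2 * r + 1 == 4 * 0 + 2) = false by apply/eqP; lia.
    by rewrite addn1 /= nth_nil.
have in0 : input_ok g a0.
  move=> i j; have := @apsp_input_cell n g i j 0 isT; have := @apsp_input_cell n g i j 1 isT.
  by rewrite /= addn0 addn1 => -> ->; case: (g i j).
have [ks [ops1 [a1 [ev1 le1 [R1 S1 E1]]]]] :=
  @setup_correct n (c + 6) c B g n0 WB cB a0 erefl (fun _ _ => Z.le_refl _) in0.
have n20 : 0 < n ^ 2 by rewrite expn_gt0 n0.
have [nil1 hor1] := ev_quiet ev1 (ltac:(lia)).
subst ops1.
have [t2 [s2 [sD2 [t2' [m2 ss2 _ le2 eD]]]]] := comp_correct (wD := wD) (D := D)
  (ltac:(lia) : 2 * n ^ 2 <= 14 * n ^ 2) B2 Btop BDw BDtop NBD WBD ev1 isT cP2 ss1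
  (erefl : serves wD D (grid n V (hor a0)) sD0 [::] 0).
move: (eD erefl) => {}eD; subst sD2.
have [I1 v13 v14] := R1.
have wX : walks_upto g W 1 (fun i j => mem a1 (2 * (i * n + j)).+1).
  exact: walks_upto1 W0 gW nn _ S1.
have [km [ops [a3 [ev3 le3 dist3]]]] :=
  main_loop_correct (c' := c + 6) n0 W0 WB wr1 gW nn I1 wX.
have hok : hor_ok (Z.of_nat (nodes n ^ (c + 6))) (hor a1).
  by move=> k x; rewrite hor1 /=; lia.
have [_ nu nq lg] := ev_legal R M ev3 (ltac:(move: wr2; rewrite -/W; lia)) hok.
move: (lg [::] I); rewrite cats0 => {}lg.
have vg : valid_graph R (c + 6) (grid n V (hor a1)).
  by apply: grid_valid => //; move: wr2; rewrite -/W -/V; lia.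
have [t0 [sD3 [t [ex3 sv3 le0]]]] :=
  D_correct (ltac:(by []) : 0 < nodes n) vg (grid_edges_listing n V (hor a1)) lg.
rewrite size_grid_edges in le0.
have v13w : (Z.abs (reg s2 (rvar 13)) <= BD)%ZZ by rewrite (sim_var ss2) v13; lia.
have v14w : (Z.abs (reg s2 (rvar 14)) <= BD)%ZZ.
  have [N1 /andP [N2 _]] := nodes_bound n0.
  have : 4 * (n * n) <= nodes n ^ (c + 6).
    apply: (@leq_trans (nodes n * nodes n)).
      by apply: leq_mul; [apply: leq_trans N2|rewrite mulnn].
    by rewrite mulnn leq_pexp2l // addnC.
  by rewrite (sim_var ss2) v14; lia.
(* The initial state of the dynamic algorithm without its two arguments, which [args_code]
   supplies. *)
pose sD4 := State (fun _ => 0%ZZ)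
  (cell (graph_input (grid n V (hor a1)) (grid_edges n))).
have d2 : dsim (2 * n ^ 2) BD s2 sD4.
  case: ss2 => q1 q2 q3 q4 q5 q6; split=> // i.
  have -> : cell sD4 i = cell (graph_input (grid n V (fun _ _ => 0%ZZ)) (grid_edges n)) i.
    by rewrite /sD4 hor1.
  (* Beyond the edge list both memories are zero, as the setup never writes there. *)
  case: (ltnP i (12 * n ^ 2)) => il; last first.
    by rewrite graph_input_default // q5 /=; [apply: apsp_input_cell_default|]; lia.
  rewrite q2; last by lia.
  have i6 := divn_eq i 6.
  have r6 : i %% 6 < 6 by rewrite ltn_pmod.
  move: i6 r6 il; move: (i %/ 6) (i %% 6) => k b -> b6 il.
  have n2 : 0 < n.*2 by lia.
  have kE := divn_eq k n.*2.
  have kr : k %% n.*2 < n.*2 by rewrite ltn_pmod.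
  have kd : k %/ n.*2 < n by rewrite ltn_divLR // -mulnn in il *; lia.
  rewrite [k * 6]mulnC kE.
  by rewrite graph_input_cell // E1.
have [d3 o3] := dsim_tmp (d := 1) 0 isT d2.
have [d4 o4] := dsim_dyn 0 v13w d3.
have [d5 o5] := dsim_tmp (d := 1) 0 isT d4.
have [d6 o6] := dsim_dyn 1 v14w d5.
move: d6 o6.
have -> : set_reg (set_reg sD4 0 (reg s2 (rvar 13))) 1 (reg s2 (rvar 14)) =
    graph_input (grid n V (hor a1)) (grid_edges n).
  rewrite /sD4 /set_reg /= /graph_input /input_state; congr State; apply/funext.
  case=> [|[|i]] /=; last by rewrite nth_nil.
    by rewrite (sim_var ss2) v13.
  by rewrite (sim_var ss2) v14 size_grid_edges -mulnn; lia.
move: d3 o3 d4 o4 d5 o5.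
set s3 := set_reg s2 _ _; set s4 := set_reg s3 _ _; set s5 := set_reg s4 _ _.
set s6 := set_reg s5 _ _ => d3 o3 d4 o4 d5 o5 d6 o6.
have own26 : same_own (2 * n ^ 2) s2 s6.
  exact: same_own_trans o3 (same_own_trans o4 (same_own_trans o5 o6)).
have v14' : reg s4 (rvar 14) = reg s2 (rvar 14) by rewrite (proj1 o4) (proj1 o3).
move: cP3 => /code_at_cat [cP3a cP3b].
have m3 := mov_steps (w := w) (s := s2) cP3a isT (ltac:(lia)).
have m4 := mov_steps (w := w) (s := s4) cP3b isT (ltac:(rewrite v14'; lia)).
rewrite -/s3 -/s4 in m3; rewrite -/s5 v14' -/s6 in m4.
have [t7 [s7 [le7 m7 d7 o7]]] := reloc_run BDw BDtop cP4 d6 ex3.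
rewrite min0n muln0 addn0 size_reloc in m7.
have own27 := same_own_trans own26 o7.
have ss7 : sim n (2 * n ^ 2) BD s7 a1 sD3.
  case: d7 => g1 g2 g3 g4; split=> // [v|i il].
    by rewrite (proj1 own27) (sim_var ss2).
  by rewrite (proj2 own27) // (sim_mem ss2) //; lia.
rewrite -[ops]cats0 in sv3.
have [t8 [s8 [sD8 [t8' [m8 ss8 _ le8 _]]]]] := comp_correct (wD := wD) (D := D)
  (leqnn (2 * n ^ 2)) B2 Btop BDw BDtop NBD WBD ev3 isT cP5 ss7 sv3.
exists (2 + t2 + 2 + 2 + t7 + t8), s8, (t0 + t), (n_updates ops), (n_queries ops).
split=> //.
- apply: (@msteps_run _ _ _ _ _ (2 + clen D (setup c) + 4 + 2 * size (init_code D) + clen D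
  main_loop)).
    apply: msteps_trans m8; apply: msteps_trans m7.
    have -> : 2 + clen D (setup c) + 4 = 2 + clen D (setup c) + 2 + 2 by lia.
    apply: msteps_trans m4; apply: msteps_trans m3.
    exact: msteps_trans m1 m2.
  rewrite /P /apsp_program (size_cat base_code) (size_cat (comp D 2 _)) (size_cat args_code).
  by rewrite (size_cat (reloc _ _)) !size_comp size_reloc [size base_code]/= [size
    args_code]/=; lia.
- move=> i j; have ij := index_lt (ltn_ord i) (ltn_ord j).
  rewrite /apsp_output !(sim_mem ss8); [exact: dist3| |]; rewrite -mulnn; lia.
- rewrite /apsp_cost; move: le1 le2 le7 le8 le3; rewrite -/(main_cost n); lia.
- by split; [apply: leq_trans nu le3|apply: leq_trans nq le3].
Qed.
End Reduction.

(** * Running time *)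

Lemma cost_bound n c : 0 < n ->
  let G := (200 * (3 * c + 200)) * (n * n * (trunc_log 2 n).+1) in
  [/\ apsp_cost n c <= G, nodes n + 4 * n ^ 2 + main_cost n <= G & main_cost n <= G].
Proof.
move=> n0 /=; have [_ /andP [_ N2]] := nodes_bound n0.
rewrite /apsp_cost /main_cost; move: N2; rewrite -!mulnn.
move: (nodes n) => N; have nn1 : 0 < n * n by nia.
move: (n * n) nn1 => s s1 N2; have : 0 < (trunc_log 2 n).+1 by [].
move: (trunc_log 2 n).+1 => l l1.
have sl : s <= s * l by nia.
have sl1 : l <= s * l by nia.
have -> : l * (90 * s + 2) = 90 * (s * l) + 2 * l by lia.
have ct : c <= c * (s * l) by nia.
have -> : 200 * (3 * c + 200) * (s * l) = 600 * (c * (s * l)) + 200 * (200 * (s * l)) by lia.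
move: (s * l) ct sl sl1 => t ct sl sl1; split; lia.
Qed.

Section Asymptotics.
Variable R : realType.
Local Open Scope classical_set_scope.
Local Open Scope ring_scope.

(** From d ln n <= exp(d ln n) = n^d, together with 2^([trunc_log 2 n]) <= n. *)
Lemma log_bound (d : R) : 0 < d -> exists2 A, 0 < A &
  forall n : nat, (0 < n)%N -> (trunc_log 2 n).+1%:R <= A * n%:R `^ d.
Proof.
move=> d0; have l2 : 0 < ln (2 : R) by apply: ln_gt0; lra.
exists (1 + (d * ln 2)^-1); first by rewrite addr_gt0 ?invr_gt0 ?mulr_gt0.
move=> n n0; have n1 : 1 <= n%:R :> R by rewrite ler1n.
have p1 : 1 <= n%:R `^ d :> R by have := ler_powR n1 (ltW d0); rewrite powRr0.
have lnn : d * ln (n%:R : R) <= n%:R `^ d.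
  rewrite /powR ifF; last by apply/negbTE; lra.
  by apply: le_trans (expR_ge1Dx _); lra.
have tl : (trunc_log 2 n)%:R * ln 2 <= ln (n%:R : R).
  rewrite mulr_natl -lnXn // ler_ln ?posrE ?exprn_gt0 ?ltr0n //.
  by rewrite -natrX ler_nat trunc_logP.
have H : (trunc_log 2 n)%:R <= (d * ln 2)^-1 * n%:R `^ d.
  rewrite mulrC ler_pdivlMr ?mulr_gt0 //.
  by apply: le_trans lnn; rewrite mulrCA ler_pM2l.
by rewrite -natr1 mulrDl mul1r; lra.
Qed.

(** N <= 6n^2 is raised to the power 1/2 - d, which is monotone because [d <= 2^-1] makes the
    exponent nonnegative. *)
Lemma nodes_powR (a d : R) n : (0 < n)%N -> a <= 2^-1 - d -> d <= 2^-1 -> 0 < d ->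
  (nodes n)%:R `^ a <= 6 * n%:R `^ (1 - 2 * d).
Proof.
move=> n0 ad d2 d0; have [_ /andP [N1 N2]] := nodes_bound n0.
have n1 : 1 <= n%:R :> R by rewrite ler1n.
apply: (@le_trans _ _ ((nodes n)%:R `^ (2^-1 - d))).
  by apply: ler_powR => //; rewrite ler1n; apply: leq_trans N1.
apply: (@le_trans _ _ ((6 * n%:R ^+ 2) `^ (2^-1 - d))).
  apply: ge0_ler_powR; rewrite ?nnegrE ?mulr_ge0 ?exprn_ge0 //; try lra.
  by rewrite -natrX -natrM ler_nat.
rewrite powRM ?exprn_ge0 //; try lra.
rewrite -[n%:R ^+ 2]powR_mulrn; last by lra.
rewrite -powRrM; have -> : 2%:R * (2^-1 - d) = 1 - 2 * d :> R by lra.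
rewrite ler_wpM2r ?powR_ge0 //.
apply: (@le_trans _ _ (6 `^ 1)); last by rewrite powRr1 //; lra.
by apply: ler_powR; lra.
Qed.

(** About n^2 log n operations cost n^(1-2d) each. Half of the saving n^(2d) pays for the logarithm,
    which is at most A n^d, and n^(3-d) remains. *)
Lemma total_bound (a d : R) (c : nat) (K : R) (u q : nat -> R) :
  0 < d -> d <= 2^-1 -> a <= 2^-1 - d ->
  (u : nat -> R^o) =O_\oo (fun N => (N%:R `^ a : R^o)) ->
  (q : nat -> R^o) =O_\oo (fun N => (N%:R `^ a : R^o)) ->
  ((fun n => (apsp_cost n c)%:R + 2 * (`|K| *
      ((nodes n + 4 * n ^ 2 + main_cost n)%:R * `|u (nodes n)| +
       (main_cost n)%:R * `|q (nodes n)|))) : nat -> R^o)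
    =O_\oo (fun n => (n%:R `^ (3 - d) : R^o)).
Proof.
move=> d0 d2 ad /eqO_exP [ku ku0 [Nu _ Hu]] /eqO_exP [kq kq0 [Nq _ Hq]].
have [A A0 HA] := log_bound d0.
pose Cc : R := (200 * (3 * c + 200))%:R.
apply/eqO_exP; exists (Cc * A * (1 + 12 * `|K| * (ku + kq))).
  rewrite !mulr_gt0 // /Cc ?ltr0n ?muln_gt0 ?addn_gt0 ?orbT //.
  by rewrite ltr_wpDr // !mulr_ge0 // addr_ge0 // ltW.
exists (Nu + Nq).+1 => // n /= nN.
have n0 : (0 < n)%N by lia.
have n1 : 1 <= n%:R :> R by rewrite ler1n.
have [N1 /andP [N2 N3]] := nodes_bound n0.
have nle : (n <= nodes n)%N by apply: leq_trans N1; rewrite -mulnn; nia.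
have Nu' : (Nu <= nodes n)%N by lia.
have Nq' : (Nq <= nodes n)%N by lia.
have := Hu _ Nu'; have := Hq _ Nq'; rewrite /= !(ger0_norm (powR_ge0 _ _)).
have Np := nodes_powR n0 ad d2 d0.
have y1 : 1 <= n%:R `^ (1 - 2 * d) :> R.
  by have := ler_powR n1 (ltac:(lra) : 0 <= 1 - 2 * d); rewrite powRr0.
have [c1 c2 c3] := @cost_bound n c n0.
move: Np y1; set y := n%:R `^ (1 - 2 * d); set z := (nodes n)%:R `^ a => Np y1 hq hu.
have hq' : `|q (nodes n)| <= kq * (6 * y).
  by apply: le_trans hq _; rewrite ler_pM2l.
have hu' : `|u (nodes n)| <= ku * (6 * y).
  by apply: le_trans hu _; rewrite ler_pM2l.
set G := ((200 * (3 * c + 200)) * (n * n * (trunc_log 2 n).+1))%N in c1 c2 c3.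
have G0 : 0 <= G%:R :> R by [].
rewrite ger0_norm; last by rewrite addr_ge0 // !mulr_ge0 // addr_ge0 // mulr_ge0.
have GA : G%:R <= Cc * A * (n%:R ^+ 2 * n%:R `^ d).
  rewrite /G natrM -/Cc -mulrA ler_wpM2l // natrM natrM -expr2 mulrCA ler_wpM2l ?exprn_ge0 //.
  by rewrite HA.
apply: (@le_trans _ _ (G%:R * ((1 + 12 * `|K| * (ku + kq)) * y))); last first.
  have -> : n%:R `^ (3 - d) = (n%:R ^+ 2 * n%:R `^ d) * y.
    rewrite /y -[n%:R ^+ 2]powR_mulrn; last by lra.
    rewrite -!powRD; try by apply/implyP => _; lra.
    by congr (_ `^ _); lra.
  have -> : Cc * A * (1 + 12 * `|K| * (ku + kq)) * (n%:R ^+ 2 * n%:R `^ d * y) =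
     (Cc * A * (n%:R ^+ 2 * n%:R `^ d)) * ((1 + 12 * `|K| * (ku + kq)) * y) by ring.
  apply: ler_wpM2r => //; rewrite mulr_ge0 //; last by lra.
  by rewrite addr_ge0 // !mulr_ge0 // addr_ge0 // ltW.
have e1 : (apsp_cost n c)%:R <= G%:R * y.
  by apply: (@le_trans _ _ G%:R); [rewrite ler_nat|rewrite ler_peMr].
have e2 : (nodes n + 4 * n ^ 2 + main_cost n)%:R * `|u (nodes n)| <= G%:R * (ku * (6 * y)).
  by apply: ler_pM => //; rewrite ler_nat.
have e3 : (main_cost n)%:R * `|q (nodes n)| <= G%:R * (kq * (6 * y)).
  by apply: ler_pM => //; rewrite ler_nat.
have e4 : `|K| * ((nodes n + 4 * n ^ 2 + main_cost n)%:R * `|u (nodes n)| +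
       (main_cost n)%:R * `|q (nodes n)|) <= `|K| * (G%:R * (ku * (6 * y)) + G%:R * (kq * (6 *
         y))).
  by apply: ler_wpM2l => //; apply: lerD.
have -> : G%:R * ((1 + 12 * `|K| * (ku + kq)) * y) =
  G%:R * y + 2 * (`|K| * (G%:R * (ku * (6 * y)) + G%:R * (kq * (6 * y)))) by ring.
by apply: lerD => //; rewrite ler_pM2l //; lra.
Qed.

End Asymptotics.

Lemma not_solvable (R : realType) (M : model) (eps : R) : APSP_conjecture R ->
  (0 < eps)%R -> ~ dynamic_planar_APSP_solvable M (2^-1 - eps)%R.
Proof.
move=> conj eps0 H.
(* For large [eps] the saving is capped, so that 1/2 - d is nonnegative. *)
pose d : R := Num.min eps (4^-1)%R.
have d0 : (0 < d)%R by rewrite lt_min eps0 /=; lra.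
have d4 : (d <= 4^-1)%R by rewrite ge_min lexx orbT.
have de : (d <= eps)%R by rewrite ge_min lexx.
apply: (conj d d0) => c; have [D [u [q [[kD [K HD]] Ou Oq]]]] := H (c + 6)%N.
(* The time bound is the function in [total_bound], found by unification. *)
exists (apsp_program D c); eexists; split; last first.
  by apply: (total_bound c K d0 _ _ Ou Oq); lra.
exists (apsp_words c kD) => n g n0 gW nn.
have [t [s' [tD [nu [nq [ex dist tle [nule nqle] tDle]]]]]] :=
  apsp_program_correct HD n0 gW nn.
exists t, s'; split=> //.
apply: (@le_trans _ _ (apsp_cost n c + 2 * tD)%:R%R); first by rewrite ler_nat.
rewrite natrD natrM lerD2l ler_pM2l; last by lra.
(* With absolute values the bound becomes monotone in the numbers of operations. *)
apply: le_trans tDle _; apply: le_trans (ler_norm _) _; rewrite normrM ler_wpM2l //.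
apply: le_trans (ler_normD _ _) _; rewrite !normrM !normr_nat.
by apply: lerD; rewrite ler_wpM2r // ler_nat ?leq_add2l.
Qed.

Local Open Scope ring_scope.

Theorem theorem4 (R : realType) (conj : APSP_conjecture R) (eps : R)
    (eps_gt0 : 0 < eps) :
  ~ dynamic_planar_APSP_solvable Fully_dynamic (2^-1 - eps) /\
  ~ dynamic_planar_APSP_solvable Weight_updates_only (2^-1 - eps).
Proof. by split; apply: not_solvable. Qed.
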